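(* For all integer partitions $\lambda$ and $\nu$, $(-1)^{|\lambda|-|\nu|}\, b_{\lambda}^{\nu} \geq 0$, where the integers $b_\lambda^\nu$ are the entries of the inverse of the infinite uni-triangular matrix of stable restriction coefficients $a_\lambda^\nu$ from $\mathrm{GL}_t$ to $\mathfrak{S}_t$ (defined in the context).
   Context: All representations are over $\mathbb{C}$. For a partition $\lambda$, $|\lambda|$ is the sum of its parts and $\ell(\lambda)$ its number of nonzero parts. $\mathbb{S}_\lambda$ is the Schur functor, so $\mathbb{S}_\lambda(\mathbb{C}^t)$ with $\ell(\lambda)\le t$ are the irreducible polynomial representations of $\mathrm{GL}_t$ (and $\mathbb{S}_\lambda(\mathbb{C}^t)=0$ if $\ell(\lambda)>t$). $\mathrm{Sp}_\nu$ is the Specht module, the irreducible representation of $\mathfrak{S}_t$ indexed by a partition $\nu$ of $t$. The group $\mathfrak{S}_t$ is embedded in $\mathrm{GL}_t$ as permutation matrices. For a partition $\nu=(\nu_1,\ldots,\nu_r)$ and $t\ge \nu_1+|\nu|$, let $\nu^{(t)}=(t-|\nu|,\nu_1,\ldots,\nu_r)$, a partition of $t$. Define the nonnegative integers $a_\lambda^\nu(t)$ by $$\mathrm{Res}^{\mathrm{GL}_t}_{\mathfrak{S}_t}\mathbb{S}_\lambda(\mathbb{C}^t)\cong\bigoplus_\nu \mathrm{Sp}_{\nu^{(t)}}^{\oplus a_\lambda^\nu(t)} .$$ By a classical theorem of Littlewood, $a_\lambda^\nu(t)$ is independent of $t$ for $t$ sufficiently large; set $a_\lambda^\nu=\lim_{t\to\infty}a_\lambda^\nu(t)$.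 Moreover $a_\lambda^\nu=\delta_{\lambda,\nu}$ whenever $|\lambda|\le|\nu|$, so the infinite matrix $[a_\lambda^\nu]$ is uni-triangular. Its inverse $[b_\lambda^\nu]=[a_\lambda^\nu]^{-1}$ is indexed as follows: the $b_\lambda^\nu$ are the unique integers with $b_\lambda^\nu=0$ unless $|\lambda|\le|\nu|$ and $\sum_\lambda b_\lambda^\nu a_\lambda^\kappa=\delta_{\nu,\kappa}$ for all partitions $\nu,\kappa$. *)

(* Defs.v *)
From HB Require Import structures.
From mathcomp Require Import all_boot all_order all_algebra all_fingroup.
From mathcomp Require Import mxrepresentation character.
From mathcomp Require Import reals complex.

Set Implicit Arguments.
Unset Strict Implicit.
Unset Printing Implicit Defensive.

Import GRing.Theory.
Local Open Scope ring_scope.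

Definition is_part (s : seq nat) := sorted geq s && (0%N \notin s).

Record intpart := IntPart { parts :> seq nat; partsP : is_part parts }.

HB.instance Definition _ := [isSub for parts].
HB.instance Definition _ := [Countable of intpart by <:].

Definition psize (lam : intpart) : nat := sumn lam.

(* All partitions of size at most n: the admissible ones among the sequences
   of at most n parts, each of them at most n. *)
Definition intparts (n : nat) : seq intpart :=
  [seq lam : intpart <- pmap insub
     (flatten [seq [seq map val (tval u) | u : k.-tuple 'I_n.+1]
              | k <- iota 0 n.+1])
  | (psize lam <= n)%N].

Lemma intparts_uniq n : uniq (intparts n).
Proof.
apply/filter_uniq/pmap_sub_uniq.
have inj_val k : injective (fun u : k.-tuple 'I_n.+1 => map val (tval u)).
  by move=> u v /(inj_map val_inj)/val_inj.
suff uniq_flat m k : uniq (flatten [seq [seq map val (tval u) |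
    u : j.-tuple 'I_n.+1] | j <- iota k m]) by apply: uniq_flat.
elim: m k => //= m IHm k.
rewrite cat_uniq IHm andbT (map_inj_uniq (@inj_val k)) enum_uniq /=.
apply/hasPn => _ /flatten_mapP[j + /mapP[u _ ->]].
rewrite mem_iota => /andP[ltkj _]; apply/negP => /mapP[v _ /(congr1 size)].
by rewrite !size_map !size_tuple => eqjk; rewrite eqjk ltnn in ltkj.
Qed.

Lemma mem_intparts n (lam : intpart) : (lam \in intparts n) = (psize lam <= n)%N.
Proof.
rewrite mem_filter; case: leqP => // le_lam_n; rewrite andTb mem_pmap_sub.
have /andP[_ lam0] := partsP lam.
have [le_size le_parts] :
    (size lam <= n)%N /\ {in (lam : seq nat), forall i, i < n.+1}%N.
  move: le_lam_n lam0; rewrite /psize; elim: (parts lam) n => //= i s IHs n.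
  rewrite inE negb_or eq_sym -lt0n => le_n /andP[i_gt0 s0].
  have le_s : (sumn s <= n - i)%N by rewrite leq_subRL ?(leq_trans (leq_addr _ _) le_n).
  have [sz_s mem_s] := IHs _ le_s s0; split=> [|j].
    by rewrite (leq_ltn_trans sz_s) // ltn_subrL i_gt0 (leq_trans i_gt0) //
               (leq_trans (leq_addr _ _) le_n).
  rewrite inE => /predU1P[->|/mem_s]; first exact: leq_trans (leq_addr _ _) le_n.
  by rewrite !ltnS => /leq_trans -> //; apply: leq_subr.
apply/flatten_mapP; exists (size lam); first by rewrite mem_iota.
apply/mapP; exists (map_tuple (@inord n) (in_tuple lam)); first by rewrite mem_enum.
rewrite /= -map_comp -[LHS]map_id; apply/eq_in_map => i /le_parts lt_i /=.
by rewrite inordK.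
Qed.

(* nu^(t) = (t - |nu|, nu_1, ..., nu_r), meaningful when admissible t nu *)
Definition admissible (t : nat) (nu : intpart) : bool :=
  (head 0 nu + psize nu <= t)%N.

Definition pad (t : nat) (nu : intpart) : seq nat := (t - psize nu)%N :: nu.

(* The boxes of the diagram of sh are numbered row by row from 0, so that
   box i lies in row reshape_index sh i and column reshape_offset sh i. *)
Definition row_stab (d : nat) (sh : seq nat) : {set 'S_d} :=
  [set p : 'S_d | [forall i, reshape_index sh (p i) == reshape_index sh i]].

Definition col_stab (d : nat) (sh : seq nat) : {set 'S_d} :=
  [set q : 'S_d | [forall i, reshape_offset sh (q i) == reshape_offset sh i]].

(* The image of the Young symmetrizer of sh under the linear extension of e to
   the group algebra of 'S_d *)
Definition young_sym (F : fieldType) (V : lmodType F) (d : nat) (sh : seq nat)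
    (e : 'S_d -> V) : V :=
  \sum_(p in row_stab d sh) \sum_(q in col_stab d sh)
    (-1) ^+ odd_perm q *: e (p * q)%g.

Notation SymG t := [set: 'S_t]%G.

(* The right ideal of the group algebra generated by the Young symmetrizer of
   sh, a partition of t; 'M_n acts on row vectors from the right throughout,
   in accordance with the composition order of permutations. *)
Definition specht_gen (F : fieldType) (t : nat) (sh : seq nat) :
    'rV[F]_#|SymG t| :=
  young_sym sh (fun s : 'S_t => delta_mx 0 (gring_index (SymG t) s)).

Definition specht (F : fieldType) (t : nat) (sh : seq nat) :
    representation F (SymG t) :=
  Representation (submod_repr
    (cyclic_mx_module (regular_repr F (SymG t)) (specht_gen F t sh))).

Section Schur.

Variables (F : fieldType) (t : nat).

(* Dimension of the d-th tensor power of F^t, with basis the e_f for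
   f : {ffun 'I_d -> 'I_t} *)
Local Notation tdim d := #|{: {ffun 'I_d -> 'I_t}}|.

Definition word (d : nat) (i : 'I_(tdim d)) : {ffun 'I_d -> 'I_t} := enum_val i.

Definition tens_mx (d : nat) (g : 'M[F]_t) : 'M[F]_(tdim d) :=
  \matrix_(i, j) \prod_(k < d) g (word i k) (word j k).

(* The action of 'S_d by permutation of the tensor factors: e_f is sent to
   e_f' with f' \o s = f *)
Definition place_mx (d : nat) (s : 'S_d) : 'M[F]_(tdim d) :=
  \matrix_(i, j) (word i == [ffun k => word j (s k)])%:R.

Variable lam : intpart.

(* The row space of this matrix is the submodule of the |lam|-th tensor power
   which is the image of the Young symmetrizer *)
Definition schur_module : 'M[F]_(tdim (psize lam)) :=
  young_sym lam (@place_mx (psize lam)).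

(* The Schur functor on the endomorphism g of F^t; on invertible g this is the
   representation of GL_t on the Schur module, see schur_mx1 and schur_mxM. *)
Definition schur_mx (g : 'M[F]_t) : 'M[F]_(\rank schur_module) :=
  in_submod schur_module (val_submod 1%:M *m tens_mx (psize lam) g).

Lemma word_rank d f : word (enum_rank f) = f :> {ffun 'I_d -> 'I_t}.
Proof. exact: enum_rankK. Qed.

Lemma tens_mx1 d : tens_mx d 1%:M = 1%:M.
Proof.
apply/matrixP=> i j; rewrite !mxE; have [->|neq_ij] := eqVneq i j.
  by rewrite big1 // => k _; rewrite mxE eqxx.
have [k neq_k] : exists k, word i k != word j k.
  apply/existsP; rewrite -negb_forall; apply: contra neq_ij => /forallP eq_ij.
  by apply/eqP/enum_val_inj/ffunP => k; apply/eqP/eq_ij.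
by rewrite (bigD1 k) //= mxE (negPf neq_k) mul0r.
Qed.

Lemma tens_mxM d (g h : 'M[F]_t) :
  tens_mx d (g *m h) = tens_mx d g *m tens_mx d h.
Proof.
apply/matrixP=> i j; rewrite !mxE.
under eq_bigr do rewrite mxE.
rewrite (bigA_distr_bigA (fun k l => g (word i k) l * h l (word j k))).
rewrite (reindex (@word d)) /=; last first.
  by apply: onW_bij; apply: enum_val_bij.
by apply: eq_bigr => l _; rewrite !mxE -big_split.
Qed.

Lemma place_tensC d (s : 'S_d) (g : 'M[F]_t) :
  place_mx s *m tens_mx d g = tens_mx d g *m place_mx s.
Proof.
apply/matrixP=> i j; rewrite !mxE.
pose i' : {ffun 'I_d -> 'I_t} := [ffun k => word i (s^-1%g k)].
pose j' : {ffun 'I_d -> 'I_t} := [ffun k => word j (s k)].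
rewrite (bigD1 (enum_rank i')) //= [X in _ + X]big1 ?addr0; last first.
  move=> l neq_l; rewrite !mxE; case: eqP => [eq_i|]; last by rewrite mul0r.
  case/eqP: neq_l; apply: enum_val_inj; rewrite enum_rankK.
  by apply/ffunP=> k; rewrite ffunE eq_i ffunE permKV.
rewrite [RHS](bigD1 (enum_rank j')) //= [X in _ = _ + X]big1 ?addr0; last first.
  move=> l neq_l; rewrite !mxE; case: eqP => [eq_l|]; last by rewrite mulr0.
  by case/eqP: neq_l; apply: enum_val_inj; rewrite enum_rankK.
rewrite !mxE !word_rank eqxx mulr1.
rewrite (_ : (_ == _) = true) ?mul1r; last first.
  by apply/eqP/ffunP=> k; rewrite !ffunE permK.
rewrite (reindex_inj (@perm_inj _ s)) /=.
by apply: eq_bigr => k _; rewrite !ffunE permK.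
Qed.

Lemma schur_module_stable (g : 'M[F]_t) :
  (schur_module *m tens_mx (psize lam) g <= schur_module)%MS.
Proof.
suff -> : schur_module *m tens_mx (psize lam) g
          = tens_mx (psize lam) g *m schur_module by apply: submxMl.
rewrite /schur_module /young_sym mulmx_suml mulmx_sumr.
apply: eq_bigr => p _; rewrite mulmx_suml mulmx_sumr.
by apply: eq_bigr => q _; rewrite -scalemxAl -scalemxAr place_tensC.
Qed.

Lemma schur_mx1 : schur_mx 1%:M = 1%:M.
Proof. by rewrite /schur_mx tens_mx1 mulmx1 val_submodK. Qed.

Lemma schur_mxM (g h : 'M[F]_t) :
  schur_mx (g *m h) = schur_mx g *m schur_mx h.
Proof.
apply: (can_inj (@val_submodK _ _ _ _)).
have stab m (W : 'M_(m, _)) g' : (W <= schur_module)%MS ->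
    (W *m tens_mx (psize lam) g' <= schur_module)%MS.
  by move/(submxMr (tens_mx (psize lam) g'))/submx_trans; apply;
     apply: schur_module_stable.
rewrite {1}/schur_mx in_submodK ?stab ?val_submodP // tens_mxM mulmxA.
rewrite [RHS]val_submodE {2}/schur_mx -[_ *m schur_mx h *m _]mulmxA -val_submodE.
rewrite in_submodK ?stab ?val_submodP // mulmxA -val_submodE.
by rewrite /schur_mx in_submodK ?stab ?val_submodP.
Qed.

Lemma res_schur_mx_repr : mx_repr (SymG t) (fun s : 'S_t => schur_mx (perm_mx s)).
Proof.
by split=> [|s u _ _]; rewrite ?perm_mx1 ?schur_mx1 // perm_mxM schur_mxM.
Qed.

Definition res_schur : representation F (SymG t) :=
  Representation (MxRepresentation res_schur_mx_repr).

End Schur.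

(* at_ t lam nu is the multiplicity of the Specht module of nu^(t) in the
   restriction of the Schur module of lam; its value is irrelevant unless
   admissible t nu, which forces psize nu <= t *)
Definition restriction_coefs (F : fieldType)
    (at_ : nat -> intpart -> intpart -> nat) : Prop :=
  forall (t : nat) (lam : intpart),
    mx_rsim (res_schur F t lam)
      (\big[@dadd_grepr F _ (SymG t) / grepr0]_(nu <- intparts t | admissible t nu)
         muln_grepr (specht F t (pad t nu)) (at_ t lam nu)).

Definition stable_limit (at_ : nat -> intpart -> intpart -> nat)
    (a : intpart -> intpart -> nat) : Prop :=
  forall lam nu : intpart, exists T : nat, forall t : nat,
    (T <= t)%N -> at_ t lam nu = a lam nu.

(* The sum over lam only needs to range over psize lam <= psize nu, outside of
   which b lam nu vanishes. *)
Definition inverse_coefs (a : intpart -> intpart -> nat)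
    (b : intpart -> intpart -> int) : Prop :=
  (forall lam nu : intpart, (psize nu < psize lam)%N -> b lam nu = 0) /\
  (forall nu kap : intpart,
     \sum_(lam <- intparts (psize nu)) b lam nu * (a lam kap)%:Z
       = (nu == kap)%:Z).

(* Main.v *)
(* Let p(u, s) be the number of maps f with f \o u = s \o f, the trace of a pair
   of permutations on a tensor power of the permutation representation.
   Pairing p(-, s) with a Young idempotent of shape lam gives the character of
   the restricted Schur module of lam, so for t large the b lam nu express the
   Specht character of nu^(t) through these characters.

   Call bell u the family of class functions sending u' : 'S_m to the average
   of p(u, s^-1) p(u', s) over s : 'S_t. For w : 'S_k there is an explicit
   functional killing bell u for u of degree less than k, and counting the r
   with u^-1 ^ r = w for u of degree k: it sends phi to a signed sum of
   phi (induced g A w), over the g commuting with w and the w-stable sets A of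
   fixed points of g, where w induces a permutation of the cycles of g outside
   A, and the weight of g is a linear character of its centralizer, with values
   in the roots of unity (the one that cuts out free Lie algebras on a cycle).
   Evaluated on the irreducible character of lam, the functional obtained from
   the Specht character of nu^(t) yields b lam nu times a positive number.
   On the other hand this is a sum over the pairs (g, A); up to the global
   sign (-1)^(|lam| + |nu|), the contribution of each (g, A) is a positive
   multiple of the dimension of a space of invariants of its stabilizer. *)

Require Import Defs.
From HB Require Import structures.
From mathcomp Require Import all_boot all_order all_algebra all_fingroup.
From mathcomp Require Import pgroup cyclic separable cyclotomic.
From mathcomp Require Import mxrepresentation character.
From mathcomp Require Import reals complex ring.

Set Implicit Arguments.
Unset Strict Implicit.
Unset Printing Implicit Defensive.

Import Order.TTheory GRing.Theory Num.Theory.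


(** * Induced permutations of the quotient by a permutation *)

(** For [w = 1] and [A] empty, the sum over [g] is, up to a global sign, Möbius inversion in the
    lattice of set partitions: the signed cyclic orders on a block add up to its Möbius number, and
    only injective maps survive. For other [w] the signs alone do not cancel once a [w]-orbit is
    mapped onto a shorter orbit: if [w] exchanges two points that are mapped to one fixed point,
    then [g = 1] and [g = w] have the same sign. The roots of unity cure this, because rotating such
    an orbit by [g] runs through all powers of a root of unity. The other constraint on the weight
    comes from the end: once the sums are exchanged, [(g, A)] is fixed and the weight has to be
    multiplicative in [w]. The weight [twist] satisfies both demands. The sets [A] serve a second
    cancellation. Dropping a [w]-orbit offsets mapping it to values outside the image of a map [r]
    coming from [u], so that only injections into this image remain; there are none if [u] has
    smaller degree. *)

Section PartialMaps.

Variables (X Y : finType).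
Implicit Types f : X -> option Y.

Definition pim f : {set Y} := [set y | [exists x, f x == Some y]].

Definition same_ker f f' := [forall x, ((f x == None) == (f' x == None)) &&
  [forall y, (f x == f y) == (f' x == f' y)]].

Lemma pimP f y : reflect (exists x, f x = Some y) (y \in pim f).
Proof. by rewrite inE; apply: (iffP existsP) => -[x /eqP fx]; exists x => //; apply/eqP. Qed.

(** Equal kernels give a bijection [beta] between the two images; the complements of the images then
    have the same size and are matched along their enumerations. *)
Lemma perm_ext f f' : same_ker f f' ->
  exists s : {perm Y}, forall x, omap s (f x) = f' x.
Proof.
move=> kerP.
have kN x : (f x == None) = (f' x == None) by have /forallP/(_ x)/andP[/eqP] := kerP.
have kE x y : (f x == f y) = (f' x == f' y).
  by have /forallP/(_ x)/andP[_ /forallP/(_ y)/eqP] := kerP.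
pose beta y := odflt y (obind f' [pick x | f x == Some y]).
have betaE x y : f x = Some y -> f' x = Some (beta y).
  move=> fx; rewrite /beta; case: pickP => [z fz|/(_ x)]; last by rewrite fx eqxx.
  have := kE x z; rewrite fx (eqP fz) eqxx => /esym/eqP -> /=.
  by have := kN z; rewrite (eqP fz); case: (f' z).
have beta_inj : {in pim f &, injective beta}.
  move=> y y' /pimP[x fx] /pimP[x' fx'] eq_b.
  have := kE x x'; rewrite (betaE _ _ fx) (betaE _ _ fx') eq_b eqxx fx fx'.
  by move=> /eqP[].
have beta_im : beta @: pim f = pim f'.
  apply/setP=> y; apply/imsetP/pimP => [[z /pimP[x fx] ->]|[x f'x]].
    by exists x; apply: betaE.
  case fx: (f x) (betaE x) (kN x) => [z|] bx; last by rewrite f'x.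
  by exists z; [apply/pimP; exists x | apply/Some_inj; rewrite -f'x; apply: bx].
pose e := enum (pim f) ++ enum (~: pim f).
pose e' := map beta (enum (pim f)) ++ enum (~: pim f').
have uniq_cat (A : {set Y}) s : s =i A -> uniq s -> uniq (s ++ enum (~: A)).
  move=> eq_s Us; rewrite cat_uniq Us enum_uniq andbT /=.
  by apply/hasPn => y; rewrite mem_enum in_setC /= eq_s.
have Ue : uniq e by apply: uniq_cat; [exact: mem_enum | exact: enum_uniq].
have Ue' : uniq e'.
  apply: uniq_cat => [y|]; last first.
    rewrite map_inj_in_uniq ?enum_uniq // => y y'; rewrite !mem_enum.
    exact: beta_inj.
  rewrite -beta_im; apply/mapP/imsetP => -[z]; rewrite ?mem_enum => ? ->;
    by exists z; rewrite ?mem_enum.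
have mem_e y : y \in e by rewrite mem_cat !mem_enum in_setC orbN.
have sz : size e = size e'.
  rewrite !size_cat size_map -!cardE; congr (_ + _).
  by rewrite [LHS]cardsCs [RHS]cardsCs !setCK -beta_im card_in_imset.
have idx_lt y : index y e < size e' by rewrite -sz index_mem.
have s_inj : injective (fun y => nth y e' (index y e)).
  move=> y y'; have -> : nth y e' (index y e) = nth y' e' (index y e).
    exact: set_nth_default.
  move/eqP; rewrite nth_uniq // => /eqP eq_i.
  by rewrite -(nth_index y (mem_e y)) eq_i nth_index.
exists (perm s_inj) => x; case fx: (f x) => [y|] /=; last first.
  by have := kN x; rewrite fx eqxx; case: (f' x).
rewrite permE (betaE _ _ fx); congr Some.
have fy : y \in pim f by apply/pimP; exists x.
have ye : y \in enum (pim f) by rewrite mem_enum.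
rewrite /e /e' index_cat ye nth_cat size_map index_mem ye.
by rewrite (nth_map y) ?index_mem // nth_index.
Qed.

(** The solutions form a coset of the group of permutations fixing the image of [f] pointwise, so
    their number depends only on the size of that image. *)
Lemma card_perm_ext f f' : same_ker f f' ->
  #|[set s : {perm Y} | [forall x, omap s (f x) == f' x]]| = (#|Y| - #|pim f|)`!.
Proof.
move=> /perm_ext[s0 s0P]; rewrite -(cardsC (pim f)) addKn -card_perm.
rewrite -(card_imset (perm_on _) (mulIg s0)); apply: eq_card => s.
pose r := (s * s0^-1)%g; have -> : s = (mulg^~ s0 : {perm Y} -> {perm Y}) r.
  by rewrite mulgKV.
rewrite inE (mem_imset _ _ (mulIg s0)) /=; apply/forallP/subsetP => [rP y|r_on x].
  rewrite !inE; apply: contra => /existsP[x /eqP fx].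
  apply/eqP/(@perm_inj _ s0)/Some_inj; have /eqP := rP x.
  by rewrite -s0P fx /= permM.
rewrite -s0P; case fx: (f x) => [y|] //=; rewrite permM.
have [->//|/r_on] := eqVneq (r y) y.
by rewrite !inE => /negP[]; apply/existsP; exists x; rewrite fx.
Qed.

End PartialMaps.

(* The trace of the pair (u, s) on a tensor power, see trace_place_tens. *)
Definition fixc (X Y : finType) (u : {perm X}) (s : {perm Y}) : nat :=
  #|[set f : {ffun X -> Y} | [forall x, f (u x) == s (f x)]]|.

Lemma leq_card_imset_ker (T T1 T2 : finType) (B : {set T}) (f1 : T -> T1) (f2 : T -> T2) :
    {in B &, forall x y, f1 x = f1 y -> f2 x = f2 y} ->
  #|f2 @: B| <= #|f1 @: B|.
Proof.
move=> ker; case: (set_0Vmem B) => [->|[x0 Bx0]]; first by rewrite !imset0 !cards0.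
pose h z := f2 (odflt x0 [pick x in B | f1 x == z]).
have -> : f2 @: B = h @: (f1 @: B); last exact: leq_imset_card.
rewrite -imset_comp; apply: eq_in_imset => x Bx; rewrite /h /=.
case: pickP => [y /andP[By /eqP eq_f]|/(_ x)]; last by rewrite Bx eqxx.
exact: ker.
Qed.

Lemma card_imset_ker (T T1 T2 : finType) (B : {set T}) (f1 : T -> T1) (f2 : T -> T2) :
    {in B &, forall x y, f1 x = f1 y <-> f2 x = f2 y} ->
  #|f1 @: B| = #|f2 @: B|.
Proof.
move=> ker; apply/eqP; rewrite eqn_leq !leq_card_imset_ker // => x y Bx By /ker; exact.
Qed.

Section Quotient.

Variable X : finType.
Implicit Types (g w : {perm X}) (A : {set X}).

Definition cyc_off g A : {set {set X}} := [set porbit g x | x in ~: A].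
Definition ncyc g A := #|cyc_off g A|.
(* 'I_(ncyc g A) numbers the cycles of g that are not contained in A. *)
Definition quo g A x : option 'I_(ncyc g A) :=
  if x \in A then None else insub (index (porbit g x) (enum (cyc_off g A))).

Definition stabs w A := [forall x, (w x \in A) == (x \in A)].
Definition commutes g w := [forall x, w (g x) == g (w x)].

Lemma commutesX g w i x : commutes g w -> w ((g ^+ i)%g x) = (g ^+ i)%g (w x).
Proof.
move/forallP=> gw; elim: i => [|i IHi] in x *; first by rewrite expg0 !perm1.
by rewrite expgS !permM IHi (eqP (gw x)).
Qed.

Lemma commutesXX g w i j x : commutes g w ->
  (w ^+ j)%g ((g ^+ i)%g x) = (g ^+ i)%g ((w ^+ j)%g x).
Proof.
move=> gw; elim: j => [|j IHj] in x *; first by rewrite expg0 !perm1.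
by rewrite expgS !permM commutesX ?IHj.
Qed.

Lemma commutes_sym g w : commutes g w = commutes w g.
Proof. by apply: eq_forallb => x; rewrite eq_sym. Qed.

Lemma stabsX w A i x : stabs w A -> ((w ^+ i)%g x \in A) = (x \in A).
Proof.
move/forallP=> wA; elim: i => [|i IHi] in x *; first by rewrite expg0 perm1.
by rewrite expgS permM IHi (eqP (wA x)).
Qed.

Lemma quo_val g A x : x \notin A ->
  exists2 j : 'I_(ncyc g A), quo g A x = Some j
    & val j = index (porbit g x) (enum (cyc_off g A)).
Proof.
move=> xA; rewrite /quo (negPf xA).
have lt_i : index (porbit g x) (enum (cyc_off g A)) < ncyc g A.
  by rewrite /ncyc cardE index_mem mem_enum imset_f // inE.
by exists (Ordinal lt_i); rewrite ?insubT //=; congr Some; apply: val_inj.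
Qed.

Lemma quo_eq_None g A x : (quo g A x == None) = (x \in A).
Proof.
have [xA|xA] := boolP (x \in A); first by rewrite /quo xA.
by have [j -> _] := quo_val g xA.
Qed.

Lemma quo_eq g A x y : x \notin A -> y \notin A ->
  (quo g A x == quo g A y) = (y \in porbit g x).
Proof.
move=> xA yA; rewrite -eq_porbit_mem [RHS]eq_sym.
have [[i -> Di] [j -> Dj]] := (quo_val g xA, quo_val g yA).
apply/eqP/eqP => [[eq_ij]|eq_p]; last first.
  by congr Some; apply: val_inj; rewrite Di Dj eq_p.
have in_c z : z \notin A -> porbit g z \in enum (cyc_off g A).
  by move=> zA; rewrite mem_enum imset_f // inE.
by rewrite -(nth_index set0 (in_c _ xA)) -Di eq_ij Dj nth_index ?in_c.
Qed.

Lemma quo_surj g A (j : 'I_(ncyc g A)) : exists2 x, x \notin A & quo g A x = Some j.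
Proof.
have lt_j : j < size (enum (cyc_off g A)) by rewrite -cardE.
have /imsetP[x] : nth set0 (enum (cyc_off g A)) j \in cyc_off g A.
  by rewrite -mem_enum mem_nth.
rewrite inE => xA Dj; exists x => //; have [i -> Di] := quo_val g xA.
by congr Some; apply: val_inj; rewrite Di -Dj index_uniq ?enum_uniq.
Qed.

(** A permutation of numbered cycles, so that families of functions on the groups ['S_m] can be
    evaluated at it. The default [1] is not reached under the hypotheses of [inducedP]. *)
Definition induced g A w : {perm 'I_(ncyc g A)} :=
  odflt 1%g [pick u | [forall x, omap (u : {perm _}) (quo g A x) == quo g A (w x)]].

Lemma mem_porbitJ g w x y : commutes g w ->
  (w y \in porbit g (w x)) = (y \in porbit g x).
Proof.
move=> gw; apply/porbitP/porbitP => -[i Di]; exists i; last first.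
  by rewrite Di commutesX.
by apply: (@perm_inj _ w); rewrite commutesX.
Qed.

Lemma inducedP g A w : commutes g w -> stabs w A ->
  forall x, omap (induced g A w) (quo g A x) = quo g A (w x).
Proof.
move=> gw /forallP wA x; rewrite /induced; case: pickP => [u /forallP uP|noP].
  exact/eqP/uP.
have /perm_ext[u uP] : same_ker (quo g A) (quo g A \o w).
  apply/forallP=> y; rewrite /= !quo_eq_None (eqP (wA y)) eqxx.
  apply/forallP=> z; have [yA|yA] := boolP (y \in A).
    have wyA : w y \in A by rewrite (eqP (wA y)).
    have [-> ->] : quo g A y = None /\ quo g A (w y) = None.
      by split; apply/eqP; rewrite quo_eq_None.
    by rewrite ![None == _]eq_sym !quo_eq_None (eqP (wA z)).
  have wyA : w y \notin A by rewrite (eqP (wA y)).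
  have [zA|zA] := boolP (z \in A).
    have wzA : w z \in A by rewrite (eqP (wA z)).
    have [-> ->] : quo g A z = None /\ quo g A (w z) = None.
      by split; apply/eqP; rewrite quo_eq_None.
    by rewrite !quo_eq_None (negPf yA) (negPf wyA).
  by rewrite !quo_eq ?mem_porbitJ // (eqP (wA _)).
by case/forallP: (noP u) => z; rewrite uP.
Qed.

Lemma induced_uniq g A w (u : {perm 'I_(ncyc g A)}) : commutes g w -> stabs w A ->
  (forall x, omap u (quo g A x) = quo g A (w x)) -> u = induced g A w.
Proof.
move=> gw wA uP; apply/permP=> j; have [x _ Dj] := quo_surj j.
by have := uP x; rewrite -inducedP // Dj /= => -[].
Qed.

Lemma inducedX g A w i x : commutes g w -> stabs w A ->
  omap (induced g A w ^+ i)%g (quo g A x) = quo g A ((w ^+ i)%g x).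
Proof.
move=> gw wA; elim: i x => [|i IHi] x.
  by rewrite !expg0 perm1; case: (quo g A x) => //= j; rewrite perm1.
rewrite !expgS permM -IHi -inducedP //.
by case: (quo g A x) => //= j; rewrite permM.
Qed.

Lemma induced_porbit g A w x y i j : commutes g w -> stabs w A ->
    x \notin A -> quo g A x = Some i -> quo g A y = Some j ->
  j \in porbit (induced g A w) i <-> exists a b, y = (g ^+ a)%g ((w ^+ b)%g x).
Proof.
move=> gw wA xA Di Dj.
have yA : y \notin A by rewrite -(quo_eq_None g) Dj.
split=> [/porbitP[b Djb]|[a [b Dy]]].
  have := inducedX b x gw wA; rewrite Di /= -Djb -Dj => /eqP; rewrite eq_sym quo_eq //.
    by case/porbitP=> a Da; exists a, b.
  by rewrite stabsX.
apply/porbitP; exists b; apply: Some_inj; rewrite -Dj.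
have := inducedX b x gw wA; rewrite Di /= => ->; apply/eqP.
by rewrite eq_sym quo_eq ?stabsX // Dy mem_porbit.
Qed.

(** Both numbers count the orbits outside [A] of the group generated by [g] and [w]. Exchanging the
    two permutations makes the sign in [dform], for fixed [w] and up to a constant, the sign of a
    permutation that depends multiplicatively on [g]. *)
Lemma card_porbits_induced g w A : commutes g w -> stabs w A -> stabs g A ->
  #|porbits (induced g A w)| = #|porbits (induced w A g)|.
Proof.
move=> gw wA gA.
pose P a b c x := if quo a c x is Some j then porbit (induced a c b) j else set0.
have PE a b c : porbits (induced a c b) = P a b c @: ~: c.
  apply/setP=> S; apply/imsetP/imsetP => [[j _ ->]|[x]].
    by have [x xc Dx] := quo_surj j; exists x; rewrite ?inE // /P Dx.
  by rewrite inE => xc ->; have [j Dj _] := quo_val a xc; exists j; rewrite /P ?Dj.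
rewrite !PE; apply: card_imset_ker => x y; rewrite !inE => xA yA.
have wg : commutes w g by rewrite commutes_sym.
have PP a b : commutes a b -> stabs b A ->
    P a b A x = P a b A y <-> exists i j, y = (a ^+ i)%g ((b ^+ j)%g x).
  move=> ab bA; have [[i Di _] [j Dj _]] := (quo_val a xA, quo_val a yA).
  rewrite /P Di Dj; apply: iff_trans (induced_porbit ab bA xA Di Dj).
  by rewrite porbit_sym -eq_porbit_mem; split=> [->|/eqP].
apply: iff_trans (PP _ _ gw wA) (iff_trans _ (iff_sym (PP _ _ wg gA))).
by split=> -[i [j ->]]; exists j, i; rewrite commutesXX.
Qed.

(** Encoding maps on cycles as partial maps on [X] puts the maps for all [(g, A)] into one set. As
    [A] can be read off from the encoding, the sum over [A] is absorbed into a sum over partial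
    maps. *)
Lemma fixc_induced (Y : finType) g w A (s : {perm Y}) :
    commutes g w -> stabs w A -> stabs g A ->
  fixc (induced g A w) s = #|[set h : {ffun X -> option Y} |
    [forall x, [&& (h x == None) == (x \in A), h (g x) == h x
                 & h (w x) == omap s (h x)]]]|.
Proof.
move=> gw wA gA; pose lift (h : {ffun 'I_(ncyc g A) -> Y}) : {ffun X -> option Y} :=
  [ffun x => omap h (quo g A x)].
have lift_inj : injective lift.
  move=> h h' eq_l; apply/ffunP=> j; have [x _ Dj] := quo_surj j.
  by have := congr1 (fun f : {ffun X -> option Y} => f x) eq_l; rewrite !ffunE Dj => -[].
have quog x : quo g A (g x) = quo g A x.
  have [xA|xA] := boolP (x \in A).
    by rewrite /quo (eqP (forallP gA x)) xA.
  apply/eqP; rewrite eq_sym quo_eq ?(eqP (forallP gA x)) //.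
  exact: (mem_porbit g 1).
rewrite /fixc -(card_imset _ lift_inj); apply: eq_card => h; rewrite inE.
apply/imsetP/forallP => [[h' + ->] x|hP].
  rewrite inE => /forallP h'P; rewrite !ffunE quog eqxx /=; apply/andP; split.
    by rewrite -(quo_eq_None g); case: (quo g A x).
  rewrite -inducedP //; case: (quo g A x) => //= j; apply/eqP; congr Some; exact/eqP.
have hN x : (h x == None) = (x \in A) by have /and3P[/eqP] := hP x.
have hg x i : h ((g ^+ i)%g x) = h x.
  elim: i => [|i IHi]; first by rewrite expg0 perm1.
  by have /and3P[_ /eqP + _] := hP ((g ^+ i)%g x); rewrite expgSr permM IHi.
have [h' h'P] : exists h' : 'I_(ncyc g A) -> Y, forall j x,
    quo g A x = Some j -> h x = Some (h' j).
  suff: forall j : 'I_(ncyc g A), exists y, forall x, quo g A x = Some j -> h x = Some y.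
    by move=> /fin_all_exists.
  move=> j; have [x xA Dj] := quo_surj j.
  case Dx: (h x) (hN x) => [y|]; last by rewrite (negPf xA).
  move=> _; exists y => z Dz.
  have zA : z \notin A by rewrite -(quo_eq_None g) Dz.
  have /eqP := etrans Dj (esym Dz); rewrite quo_eq // => /porbitP[i ->].
  by rewrite hg.
exists [ffun j => h' j].
  rewrite inE; apply/forallP=> j; rewrite !ffunE; have [x xA Dj] := quo_surj j.
  have /and3P[_ _ /eqP] := hP x; rewrite (h'P _ _ Dj) (h'P (induced g A w j)) /=.
    by case=> ->.
  by rewrite -inducedP // Dj.
apply/ffunP=> x; rewrite ffunE; case Dx: (quo g A x) => [j|] /=.
  by rewrite ffunE (h'P _ _ Dx).
by apply/eqP; rewrite hN -(quo_eq_None g) Dx.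
Qed.

End Quotient.

(** * A linear character of the centralizer of a permutation *)

(** Modulo [d], [l] generates the same subgroup as [A], and [b] is an inverse of [A / l] modulo
    [d / l]. So [l * b] generates this subgroup too: it determines [l], and then [A / l] by
    inversion. *)
Lemma twist_exponent_inj d l1 l2 A1 A2 b1 b2 :
    l1 %| d -> l2 %| d -> l1 %| A1 -> l2 %| A2 ->
    A1 * b1 = l1 %[mod d] -> A2 * b2 = l2 %[mod d] ->
    l1 * b1 = l2 * b2 %[mod d] ->
  A1 = A2 %[mod d].
Proof.
move=> d1 d2 /dvdnP[a1 ->] /dvdnP[a2 ->] e1 e2 e12.
have {}e1 : a1 * (l1 * b1) = l1 %[mod d] by rewrite mulnA.
have {}e2 : a2 * (l2 * b2) = l2 %[mod d] by rewrite mulnA.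
have dvd_mod x y l : l %| d -> x = y %[mod d] -> (l %| x) = (l %| y).
  by move=> ld exy; rewrite /dvdn -(modn_dvdm x ld) -(modn_dvdm y ld) exy.
have l12 : l1 = l2.
  apply/eqP; rewrite eqn_dvd; apply/andP; split.
    rewrite -(dvd_mod _ _ _ d1 e2) dvdn_mull // -(dvd_mod _ _ _ d1 e12).
    exact: dvdn_mulr.
  rewrite -(dvd_mod _ _ _ d2 e1) dvdn_mull // (dvd_mod _ _ _ d2 e12).
  exact: dvdn_mulr.
rewrite -l12 in e2 e12 *.
have mulm x y z : y = z %[mod d] -> x * y = x * z %[mod d].
  by move=> eyz; rewrite -modnMmr eyz modnMmr.
(* Modulo [d], with [l] the common value: [a1 l = a1 a2 l b2 = a2 a1 l b1 = a2 l]. *)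
rewrite -(mulm a1 _ _ e2) -(mulm a2 _ _ e1) mulnCA.
exact/mulm/mulm/esym.
Qed.

Section Weights.

Variable X : finType.
Implicit Types (g w : {perm X}) (x y : X).

Lemma commutes_X g w i : commutes g w -> commutes g (w ^+ i)%g.
Proof. by move=> gw; apply/forallP=> x; rewrite (commutesXX 1 i x gw). Qed.

Lemma eq_expg_porbit g x i j :
  (g ^+ i)%g x = (g ^+ j)%g x <-> i = j %[mod #|porbit g x|].
Proof.
set c := #|porbit g x|.
have c_gt0 : 0 < c by rewrite lt0n card_porbit_neq0.
have perX m q : (g ^+ (q * c + m))%g x = (g ^+ m)%g x.
  rewrite expgD permM mulnC expgM; congr (_ _); elim: q => [|q IHq].
    by rewrite expg0 perm1.
  by rewrite expgS permM [(g ^+ c)%g x]permX iter_porbit IHq.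
have modX m : (g ^+ m)%g x = (g ^+ (m %% c))%g x by rewrite {1}(divn_eq m c) perX.
split=> [|eq_ij]; last by rewrite modX eq_ij -modX.
rewrite modX [RHS]modX !permX => /eqP.
have nthT m : m < c -> iter m g x = nth x (traject g x c) m by move=> ltm; rewrite nth_traject.
rewrite !nthT ?ltn_mod // nth_uniq ?size_traject ?ltn_mod ?uniq_traject_porbit //.
by move/eqP.
Qed.

Definition croot g x := odflt x [pick y in porbit g x].

Lemma croot_porbit g x : croot g x \in porbit g x.
Proof. by rewrite /croot; case: pickP => //= _; exact: porbit_id. Qed.

Lemma croot_eq g x y : y \in porbit g x -> croot g y = croot g x.
Proof.
move=> xy; have /eqP eq_p : porbit g y == porbit g x by rewrite eq_porbit_mem.
rewrite /croot eq_p; case: pickP => //= /(_ x).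
by rewrite porbit_id.
Qed.

Lemma croot_crootK g x : croot g (croot g x) = croot g x.
Proof. exact/croot_eq/croot_porbit. Qed.

Definition cidx g x := index x (traject g (croot g x) #|porbit g x|).

Lemma cidxP g x : (g ^+ cidx g x)%g (croot g x) = x.
Proof.
have /eqP eq_p : porbit g (croot g x) == porbit g x.
  by rewrite eq_porbit_mem croot_porbit.
have x_in : x \in traject g (croot g x) #|porbit g x|.
  by rewrite -eq_p -porbit_traject porbit_sym croot_porbit.
have lt_i : cidx g x < #|porbit g x|.
  by have := x_in; rewrite -index_mem size_traject.
by rewrite permX -(nth_traject g lt_i) nth_index.
Qed.

Definition orb2 g w x := [set y | [exists z in porbit w x, y \in porbit g z]].

Lemma orb2P g w x y :
  reflect (exists a b, y = (g ^+ a)%g ((w ^+ b)%g x)) (y \in orb2 g w x).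
Proof.
rewrite inE; apply: (iffP existsP) => [[z /andP[/porbitP[b ->] /porbitP[a ->]]]|].
  by exists a, b.
by case=> a [b ->]; exists ((w ^+ b)%g x); rewrite !mem_porbit.
Qed.

Variables (F : fieldType) (xi : F) (M : nat).
Local Open Scope ring_scope.
Hypotheses (xi_prim : M.-primitive_root xi) (M_dvd : forall c, (0 < c <= #|X|)%N -> (c %| M)%N).

(** Taking the roots for all cycle lengths as powers of one [xi] makes them coherent:
    [zeta c ^+ s = zeta d ^+ l] when [s] divides [c], [l] divides [d] and the quotients agree. This
    is used in [twist_exponent]. *)
Definition zeta c := xi ^+ (M %/ c).

Lemma porbit_dvd g x : (#|porbit g x| %| M)%N.
Proof. by rewrite M_dvd // lt0n card_porbit_neq0 max_card. Qed.

Lemma zetaX g x : zeta #|porbit g x| ^+ #|porbit g x| = 1.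
Proof. by rewrite -exprM divnK ?porbit_dvd // prim_expr_order. Qed.

Lemma zeta_neq0 c : zeta c != 0.
Proof.
rewrite expf_neq0 //; apply/eqP => xi0; have := prim_expr_order xi_prim.
by rewrite xi0 expr0n gtn_eqF ?(prim_order_gt0 xi_prim) // => /eqP; rewrite eq_sym oner_eq0.
Qed.

(** On each cycle an eigenfunction of [g] with eigenvalue [zeta], see [cvalX]. This makes the ratio
    [alpha] constant on the cycles of [g] when [w] commutes with [g]. *)
Definition cval g x := zeta #|porbit g x| ^+ cidx g x.

Lemma cval_neq0 g x : cval g x != 0.
Proof. by rewrite expf_neq0 ?zeta_neq0. Qed.

Lemma cvalX g i x : cval g ((g ^+ i)%g x) = zeta #|porbit g x| ^+ i * cval g x.
Proof.
rewrite /cval porbit_perm -exprD; set c := #|_|.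
rewrite -(expr_mod (cidx _ _) (zetaX g x)) -(expr_mod (i + _) (zetaX g x)).
congr (_ ^+ _); have /eqP eq_p : porbit g (croot g x) == porbit g x.
  by rewrite eq_porbit_mem croot_porbit.
rewrite -/c /c -eq_p; apply/eq_expg_porbit.
rewrite addnC expgD permM cidxP -[in LHS](croot_eq (mem_porbit g i x)).
by rewrite cidxP.
Qed.

Definition alpha g w x := cval g (w x) / cval g x.

Lemma card_porbitJ g w x : commutes g w -> #|porbit g (w x)| = #|porbit g x|.
Proof.
move=> gw; rewrite -(card_imset (porbit g x) (@perm_inj _ w)); apply: eq_card => y.
by rewrite -[y](permKV w) mem_porbitJ // mem_imset //; exact: perm_inj.
Qed.

Lemma alphaX g w i x : commutes g w -> alpha g w ((g ^+ i)%g x) = alpha g w x.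
Proof.
move=> gw; rewrite /alpha commutesX // !cvalX card_porbitJ //.
by rewrite -mulf_div divff ?mul1r // expf_neq0 ?zeta_neq0.
Qed.

Lemma alpha_porbit g w x y : commutes g w -> y \in porbit g x ->
  alpha g w y = alpha g w x.
Proof. by move=> gw /porbitP[i ->]; apply: alphaX. Qed.

(* If w commutes with g, it permutes the cycles of g and rotates them relative
   to the base points croot; the rotations are recorded by roots of unity. *)
Definition twist g w := \prod_(x | croot g x == x) alpha g w x.

(** The value of [alpha] for [w * w'] at [x] is its value for [w] at [x] times its value for [w'] at
    [w x]. Since [w] permutes the cycles of [g], the second factors run once over all cycles. *)
Lemma twistM g w w' : commutes g w -> commutes g w' ->
  twist g (w * w')%g = twist g w * twist g w'.
Proof.
move=> gw gw'; have gwV : commutes g w^-1%g.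
  apply/forallP=> x; apply/eqP/(@perm_inj _ w).
  by rewrite permKV (eqP (forallP gw _)) permKV.
have crootJ (v : {perm X}) x y : commutes g v -> y \in porbit g x ->
    croot g (v y) = croot g (v x).
  by move=> gv xy; apply: croot_eq; rewrite mem_porbitJ.
(* [w] need not send base points to base points, so the image is moved to the base point of its
   cycle. *)
rewrite /twist [X in _ = _ * X](reindex_onto (fun x => croot g (w x))
  (fun x => croot g (w^-1 x)%g)) => [|x /eqP Dx]; last first.
  by rewrite (crootJ _ _ _ gw (croot_porbit _ _)) permKV.
rewrite [X in _ * X](eq_bigl (fun x => croot g x == x)) => [|x].
  rewrite -big_split /=; apply: eq_bigr => x _.
  rewrite (alpha_porbit gw' (croot_porbit _ _)) /alpha permM.
  by rewrite [RHS]mulrC mulrA divfK ?cval_neq0.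
by rewrite croot_crootK eqxx (crootJ _ _ _ gwV (croot_porbit _ _)) permK.
Qed.

Lemma twist1 w : twist 1%g w = 1.
Proof.
rewrite /twist big1 // => x _; rewrite /alpha; have c1 y : cval 1%g y = 1.
  have p1 : #|porbit 1%g y| = 1%N.
    by rewrite (_ : porbit 1%g y = [set y]) ?cards1 //; apply/setP=> z; rewrite inE;
       apply/porbitP/eqP => [[i ->]|->]; [rewrite expg1n perm1 | exists 0%N; rewrite perm1].
  by rewrite /cval p1 /zeta divn1 (prim_expr_order xi_prim) expr1n.
by rewrite !c1 divff ?oner_eq0.
Qed.

Lemma orb2_id g w x : x \in orb2 g w x.
Proof. by apply/orb2P; exists 0%N, 0%N; rewrite !expg0 !perm1. Qed.

Lemma orb2_trans g w x y z : commutes g w ->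
  y \in orb2 g w x -> z \in orb2 g w y -> z \in orb2 g w x.
Proof.
move=> gw /orb2P[a [b ->]] /orb2P[c [d ->]]; apply/orb2P.
by exists (a + c)%N, (b + d)%N; rewrite (commutesXX _ _ _ gw) !expgD !permM.
Qed.

Lemma orb2_sym g w x y : commutes g w -> y \in orb2 g w x -> x \in orb2 g w y.
Proof.
move=> gw /orb2P[a [b Dy]].
have /porbitP[p Dp] : (w ^+ b)%g x \in porbit g y by rewrite porbit_sym Dy mem_porbit.
have /porbitP[q Dq] : x \in porbit w ((w ^+ b)%g x) by rewrite porbit_sym mem_porbit.
by apply/orb2P; exists p, q; rewrite -(commutesXX _ _ _ gw) -Dp -Dq.
Qed.

Lemma orb2_eq g w x y : commutes g w -> y \in orb2 g w x -> orb2 g w y = orb2 g w x.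
Proof.
move=> gw xy; apply/setP=> z; apply/idP/idP; first exact: orb2_trans xy.
by apply: orb2_trans => //; apply: orb2_sym.
Qed.

Lemma mem_orb2g g w x y : commutes g w -> (g y \in orb2 g w x) = (y \in orb2 g w x).
Proof.
move=> gw; have yg : g y \in orb2 g w y.
  by apply/orb2P; exists 1%N, 0%N; rewrite expg0 perm1 expg1.
apply/idP/idP => [gy_x|y_x]; first exact: orb2_trans gy_x (orb2_sym gw yg).
exact: orb2_trans y_x yg.
Qed.

Lemma mem_orb2w g w x y : commutes g w -> (w y \in orb2 g w x) = (y \in orb2 g w x).
Proof.
move=> gw; have yw : w y \in orb2 g w y.
  by apply/orb2P; exists 0%N, 1%N; rewrite expg0 perm1 expg1.
apply/idP/idP => [wy_x|y_x]; first exact: orb2_trans wy_x (orb2_sym gw yw).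
exact: orb2_trans y_x yw.
Qed.

(* Multiplying alpha along the l cycles of g in the orbit telescopes. *)
Lemma prod_alpha_orb2 g w x l : commutes g w -> (0 < l)%N ->
    (w ^+ l)%g x \in porbit g x ->
    (forall i, (0 < i < l)%N -> (w ^+ i)%g x \notin porbit g x) ->
  \prod_(y in orb2 g w x | croot g y == y) alpha g w y = cval g ((w ^+ l)%g x) / cval g x.
Proof.
move=> gw l_gt0 wl_x wi_x.
pose f (i : 'I_l) := croot g ((w ^+ i)%g x).
have f_inj : injective f.
  have lt_neq (i j : 'I_l) : (i < j)%N -> f i <> f j.
    move=> ltij eq_f; have : (0 < j - i < l)%N.
      by rewrite subn_gt0 ltij (leq_ltn_trans (leq_subr _ _)).
    move=> /wi_x /negP[].
    rewrite -(mem_porbitJ _ _ (commutes_X i gw)).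
    rewrite -permM -expgD subnK ?(ltnW ltij) // -eq_porbit_mem.
    have p_f k : porbit g (f k) = porbit g ((w ^+ k)%g x).
      by apply/eqP; rewrite eq_porbit_mem croot_porbit.
    by rewrite -!p_f eq_f.
  move=> i j eq_f; apply: val_inj => /=; case: (ltngtP i j) => // lt_ij.
    by case: (lt_neq i j lt_ij).
  by case: (lt_neq j i lt_ij).
have wE y i : commutes g w -> alpha g w (f i) = alpha g w ((w ^+ i)%g x).
  by move=> _; rewrite /f (alpha_porbit gw (croot_porbit _ _)).
rewrite (eq_bigl [in f @: [set: 'I_l]]) => [|y].
  rewrite big_imset /=; last by move=> i j _ _; apply: f_inj.
  rewrite (eq_bigl predT) => [|i]; last by rewrite inE.
  rewrite (eq_bigr (fun i : 'I_l => alpha g w ((w ^+ i)%g x))) => [|i _]; last exact: wE.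
  clear -xi_prim M_dvd; elim: l => [|l IHl]; first by rewrite big_ord0 expg0 perm1 divff ?cval_neq0.
  by rewrite big_ord_recr /= IHl /alpha mulrC mulrA divfK ?cval_neq0 // expgSr permM.
apply/andP/imsetP => [[/orb2P[a [b Dy]] /eqP root_y]|[i _ ->]]; last first.
  rewrite /f croot_crootK eqxx; split=> //.
  have /porbitP[a ->] := croot_porbit g ((w ^+ i)%g x).
  by apply/orb2P; exists a, i.
exists (Ordinal (ltn_pmod b l_gt0)) => //; rewrite /f /= -root_y.
apply: croot_eq; have gwl i : commutes g (w ^+ i)%g by exact: commutes_X.
have wq q : (w ^+ (q * l))%g x \in porbit g x.
  elim: q => [|q IHq]; first by rewrite mul0n expg0 perm1 porbit_id.
  rewrite mulSn addnC expgD permM -eq_porbit_mem.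
  by apply/eqP; rewrite -(eqP (etrans (eq_porbit_mem _ _ _) wl_x)); apply/eqP;
     rewrite eq_porbit_mem mem_porbitJ.
rewrite Dy -eq_porbit_mem porbit_perm eq_porbit_mem.
by rewrite {1}(divn_eq b l) expgD permM mem_porbitJ.
Qed.

End Weights.

(** * First returns and joint orbits of two commuting permutations *)

Section Return.

Variable X : finType.
Implicit Types (g w : {perm X}) (x y : X).

Lemma porbit_return g w x : exists l, [/\ 0 < l, (w ^+ l)%g x \in porbit g x &
  forall i, 0 < i < l -> (w ^+ i)%g x \notin porbit g x].
Proof.
have exl : exists l, (0 < l) && ((w ^+ l)%g x \in porbit g x).
  exists #|porbit w x|; rewrite lt0n card_porbit_neq0 permX iter_porbit.
  exact: porbit_id.
case: (ex_minnP exl) => l /andP[l_gt0 wl_x] minl; exists l; split=> // i /andP[i_gt0 lt_il].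
by apply/negP => wi_x; have := minl i; rewrite i_gt0 wi_x leqNgt lt_il => /(_ isT).
Qed.

Lemma return_dvd g w x l i : commutes g w -> 0 < l -> (w ^+ l)%g x \in porbit g x ->
    (forall i, 0 < i < l -> (w ^+ i)%g x \notin porbit g x) ->
  ((w ^+ i)%g x \in porbit g x) = (l %| i).
Proof.
move=> gw l_gt0 wl_x min_l.
have wq q : porbit g ((w ^+ (q * l))%g x) = porbit g x.
  elim: q => [|q IHq]; first by rewrite mul0n expg0 perm1.
  apply/eqP; rewrite mulSn addnC expgD permM eq_porbit_mem.
  have /eqP <- : porbit g ((w ^+ l)%g x) == porbit g x by rewrite eq_porbit_mem.
  by rewrite mem_porbitJ ?commutes_X // -eq_porbit_mem IHq.
have -> : ((w ^+ i)%g x \in porbit g x) = ((w ^+ (i %% l))%g x \in porbit g x).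
  rewrite {1}(divn_eq i l) expgD permM -!eq_porbit_mem.
  suff -> : porbit g ((w ^+ (i %% l))%g ((w ^+ (i %/ l * l))%g x))
          = porbit g ((w ^+ (i %% l))%g x) by [].
  by apply/eqP; rewrite eq_porbit_mem mem_porbitJ ?commutes_X // -eq_porbit_mem wq.
rewrite /dvdn; have [->|nz_i] := posnP (i %% l).
  by rewrite expg0 perm1 porbit_id.
by apply/negbTE/min_l; rewrite nz_i ltn_mod.
Qed.

Lemma porbit_dvd_expg g x i : ((g ^+ i)%g x == x) = (#|porbit g x| %| i).
Proof.
have := eq_expg_porbit g x i 0; rewrite expg0 perm1 mod0n => -[e1 e2].
by apply/eqP/idP => [/e1/eqP|/eqP/e2].
Qed.

End Return.

Section Twist.

Variables (X : finType) (F : fieldType) (xi : F) (M : nat).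
Hypotheses (xi_prim : (M.-primitive_root xi)%R).
Hypothesis M_dvd : forall c, 0 < c <= #|X| -> c %| M.
Implicit Types (g w : {perm X}) (x y : X).
Local Notation alpha := (@alpha X F xi M).
Local Notation cval := (@cval X F xi M).
Local Notation twist := (@twist X F xi M).
Local Notation zeta := (@zeta F xi M).

(** After telescoping, a joint orbit contributes the ratio of [cval] at the first return of [x] to
    its [g]-cycle and at [x]; by hypothesis this return is to [x] itself. *)
Lemma twist_free g w : commutes g w ->
    (forall x i j, (w ^+ i)%g x = (g ^+ j)%g x -> (w ^+ i)%g x = x) ->
  twist g w = 1%R.
Proof.
move=> gw free; rewrite /twist (partition_big (orb2 g w) predT) //=.
rewrite big1 // => S _; have [[x /eqP Dx]|noS] := altP (@existsP _ (fun x => orb2 g w x == S)).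
  have [l [l_gt0 wl_x min_l]] := porbit_return g w x.
  rewrite (eq_bigl (fun y => (y \in orb2 g w x) && (croot g y == y))) => [|y].
    rewrite (prod_alpha_orb2 xi_prim M_dvd gw l_gt0 wl_x min_l).
    have /porbitP[j Dj] := wl_x.
    by rewrite (free _ _ _ Dj) divff // (cval_neq0 xi_prim).
  rewrite andbC -Dx; congr (_ && _); apply/eqP/idP => [<-|]; first exact: orb2_id.
  exact: orb2_eq.
rewrite big1 // => y /andP[_ Sy]; case/existsP: noS; first by exists y.
Qed.

(** Here [l] is the first return of [w] to the [g]-cycle of [x], and [w ^+ l] moves [x] like
    [g ^+ (b * s)]. The telescoped weight is a power of [zeta] for the length of the [g]-cycle; it
    is rewritten through the length of the [w]-orbit, which stays the same when [g] varies in
    [sum_twist]. *)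
Lemma twist_exponent g w x s A : commutes g w -> 0 < s ->
    (g ^+ s)%g x = (w ^+ A)%g x ->
    (forall i, 0 < i < s -> (g ^+ i)%g x \notin porbit w x) ->
  exists l b, [/\ l %| #|porbit w x|, l %| A, A * b = l %[mod #|porbit w x|] &
    (\prod_(y in orb2 g w x | croot g y == y) alpha g w y)%R
       = (zeta #|porbit w x| ^+ (l * b))%R].
Proof.
move=> gw s_gt0 gsx min_s; set d := #|porbit w x|.
have wg : commutes w g by rewrite commutes_sym.
have gs_x : (g ^+ s)%g x \in porbit w x by rewrite gsx mem_porbit.
have sP i : ((g ^+ i)%g x \in porbit w x) = (s %| i) := return_dvd i wg s_gt0 gs_x min_s.
have [l [l_gt0 wl_x min_l]] := porbit_return g w x.
have lP i : ((w ^+ i)%g x \in porbit g x) = (l %| i) := return_dvd i gw l_gt0 wl_x min_l.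
have /porbitP[a Da] := wl_x; set c := #|porbit g x|.
have d_gt0 : 0 < d by rewrite lt0n card_porbit_neq0.
have c_gt0 : 0 < c by rewrite lt0n card_porbit_neq0.
have cP i : ((g ^+ i)%g x == x) = (c %| i) := porbit_dvd_expg g x i.
have dP i : ((w ^+ i)%g x == x) = (d %| i) := porbit_dvd_expg w x i.
have gsX i : (g ^+ (s * i))%g x = (w ^+ (A * i))%g x.
  elim: i => [|i IHi]; first by rewrite !muln0 !expg0 !perm1.
  by rewrite !mulnS !expgD !permM gsx -(commutesXX _ _ _ gw) IHi -!permM -!expgD addnC.
have wlX i : (w ^+ (l * i))%g x = (g ^+ (a * i))%g x.
  elim: i => [|i IHi]; first by rewrite !muln0 !expg0 !perm1.
  by rewrite !mulnS !expgD !permM Da (commutesXX _ _ _ gw) IHi -!permM -!expgD addnC.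
have /dvdnP[b Db] : s %| a by rewrite -sP -Da mem_porbit.
have /eqP gc : (g ^+ c)%g x == x by rewrite cP.
have /eqP wd : (w ^+ d)%g x == x by rewrite dP.
have /dvdnP[r Dr] : s %| c by rewrite -sP gc porbit_id.
have ld : l %| d by rewrite -lP wd porbit_id.
have lA : l %| A by rewrite -lP -gsx mem_porbit.
(* Both [c / s] and [d / l] count the points common to the two cycles through [x]. *)
have eq_r : d = r * l.
  have [r' Dr'] := dvdnP ld; have [A' DA'] := dvdnP lA.
  have r_gt0 : 0 < r by move: c_gt0; rewrite Dr muln_gt0 => /andP[].
  have r'_gt0 : 0 < r' by move: d_gt0; rewrite Dr' muln_gt0 => /andP[].
  rewrite Dr'; congr (_ * _); apply/eqP; rewrite eqn_dvd; apply/andP; split.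
    rewrite -(dvdn_pmul2r l_gt0) -Dr' -dP mulnC wlX cP Db Dr.
    by rewrite mulnAC -mulnA dvdn_mull.
  rewrite -(dvdn_pmul2r s_gt0) -Dr -cP mulnC gsX dP Dr' DA'.
  by rewrite mulnAC -mulnA dvdn_mull.
exists l, b; split=> //.
  by apply/eq_expg_porbit; rewrite -gsX mulnC -Db -Da.
rewrite (prod_alpha_orb2 xi_prim M_dvd gw l_gt0 wl_x min_l) Da (cvalX xi_prim M_dvd).
rewrite mulfK ?(cval_neq0 xi_prim) // /zeta -!exprM; congr (_ ^+ _)%R.
have cM : c %| M by apply: porbit_dvd.
have dM : d %| M by apply: porbit_dvd.
have r_gt0 : 0 < r by move: c_gt0; rewrite Dr muln_gt0 => /andP[].
have [p Dp] := dvdnP cM; have [q Dq] := dvdnP dM.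
rewrite -/c -/d {1}Dp {1}Dq !mulnK // Db.
have /eqP : r * (p * s) = r * (q * l).
  by rewrite (mulnCA r p) -Dr -Dp (mulnCA r q) -eq_r -Dq.
rewrite eqn_pmul2l // => /eqP eq_ps.
by rewrite (mulnC b) mulnA eq_ps -mulnA.
Qed.

Lemma sum_prim_pow N (z : F) : N.-primitive_root%R z -> 1 < N ->
  (\sum_(i < N) z ^+ i = 0)%R.
Proof.
move=> z_prim N_gt1; have zN := prim_expr_order z_prim.
have /eqP := subrX1 z N; rewrite zN subrr eq_sym mulf_eq0 subr_eq0 => /orP[/eqP z1|/eqP//].
by have := prim_order_dvd z_prim 1; rewrite z1 expr1n eqxx dvdn1 gtn_eqF.
Qed.

Lemma orb2_return g w x s y : commutes g w -> 0 < s -> (g ^+ s)%g x \in porbit w x ->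
  reflect (exists2 i, i < s & y \in porbit w ((g ^+ i)%g x)) (y \in orb2 g w x).
Proof.
move=> gw s_gt0 gs_x; have wg : commutes w g by rewrite commutes_sym.
have gsq q : (g ^+ (q * s))%g x \in porbit w x.
  elim: q => [|q IHq]; first by rewrite mul0n expg0 perm1 porbit_id.
  rewrite mulSn addnC expgD permM.
  have /eqP <- : porbit w ((g ^+ s)%g x) == porbit w x by rewrite eq_porbit_mem.
  by rewrite mem_porbitJ ?commutes_X.
apply: (iffP (orb2P _ _ _ _)) => [[a [b ->]]|[i _ /porbitP[b ->]]]; last first.
  by exists i, b; rewrite (commutesXX _ _ _ gw).
exists (a %% s); rewrite ?ltn_mod // -(commutesXX _ _ _ gw) {1}(divn_eq a s).
by rewrite porbit_sym -eq_porbit_mem porbit_perm eq_porbit_mem porbit_sym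
           expgD permM mem_porbitJ ?commutes_X.
Qed.

(** Changing [g] inside one joint orbit leaves the factors of [twist] from the other orbits
    unchanged. *)
Lemma cval_local g g' (O : {set X}) : (forall y, (g y \in O) = (y \in O)) ->
    (forall y, y \notin O -> g' y = g y) -> forall y, y \notin O ->
  croot g' y = croot g y /\ cval g' y = cval g y.
Proof.
move=> gO g'g y yO.
have Ogi i : (g ^+ i)%g y \notin O.
  by elim: i => [|i IHi]; rewrite ?expg0 ?perm1 // expgSr permM gO.
have g'i z i : (forall i, (g ^+ i)%g z \notin O) -> (g' ^+ i)%g z = (g ^+ i)%g z.
  move=> Oz; elim: i => [|i IHi]; first by rewrite !expg0.
  by rewrite !expgSr !permM IHi g'g.
have eq_p : porbit g' y = porbit g y.
  by apply/setP=> z; apply/porbitP/porbitP => -[i ->]; exists i; rewrite g'i.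
have eq_r : croot g' y = croot g y by rewrite /croot eq_p.
split=> //; rewrite /cval /cidx eq_p eq_r; congr (_ ^+ _)%R; congr (index y _).
have Or i : (g ^+ i)%g (croot g y) \notin O.
  have /porbitP[m ->] := croot_porbit g y.
  by rewrite -permM -expgD.
apply: (@eq_from_nth _ (croot g y)); rewrite !size_traject // => i lt_i.
by rewrite !nth_traject // -!permX g'i.
Qed.

(* The orbit of x under g and w contributes distinct powers of a primitive root
   of unity to the summands, and all powers occur. *)
Lemma sum_twist g w x l0 (z : {perm X}) (d := #|porbit w x|) :
    commutes g w -> l0 %| d -> l0 < d ->
    (forall y, z y = if y \in porbit w x then (w ^+ l0)%g y else y) ->
    (forall s A, (g ^+ s)%g x = (w ^+ A)%g x -> l0 %| A) ->
  (\sum_(j < d %/ l0) twist (g * z ^+ j)%g w = 0)%R.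
Proof.
move=> gw l0d l0_lt zE l0A; set N := d %/ l0.
have d_gt0 : 0 < d by rewrite lt0n card_porbit_neq0.
have l0_gt0 : 0 < l0 by apply: dvdn_gt0 l0d.
have DN : N * l0 = d by rewrite divnK.
have N_gt1 : 1 < N by rewrite -(ltn_pmul2r l0_gt0) mul1n DN.
have CwX i y : ((w ^+ i)%g y \in porbit w x) = (y \in porbit w x).
  by rewrite -!eq_porbit_mem porbit_perm.
have zX j y : (z ^+ j)%g y = if y \in porbit w x then (w ^+ (l0 * j))%g y else y.
  elim: j => [|j IHj]; first by rewrite muln0 !expg0 perm1 if_same.
  rewrite expgSr permM IHj; case: ifP => Cy; last by rewrite zE Cy.
  by rewrite zE CwX Cy mulnS addnC expgD permM.
have gjw j : commutes (g * z ^+ j)%g w.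
  apply/forallP=> y; rewrite !permM !zX -(eqP (forallP gw y)).
  rewrite -(expg1 w) CwX !expg1; case: ifP => // _.
  by rewrite -!permM -expgS -expgSr.
(* Up to the first return to the [w]-orbit of [x], the path of [x] under [g * z ^+ j] does not
   depend on [j]; at the return, [w ^+ A] becomes [w ^+ (A + l0 * j)]. *)
have [s [s_gt0 gs_x min_s]] := porbit_return w g x.
have /porbitP[A DA] := gs_x.
have gji j i : i < s -> ((g * z ^+ j) ^+ i)%g x = (g ^+ i)%g x.
  elim: i => [|i IHi] lt_is; first by rewrite !expg0.
  rewrite !expgSr !permM IHi ?(ltnW lt_is) // zX -permM -expgSr.
  by rewrite (negPf (min_s i.+1 _)).
have gjs j : ((g * z ^+ j) ^+ s)%g x = (w ^+ (A + l0 * j))%g x.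
  rewrite -(prednK s_gt0) expgSr permM gji ?prednK // permM -(permM _ g) -expgSr prednK //.
  by rewrite zX gs_x DA -permM -expgD.
have orbj j : orb2 (g * z ^+ j)%g w x = orb2 g w x.
  have gjs_x : ((g * z ^+ j) ^+ s)%g x \in porbit w x by rewrite gjs mem_porbit.
  apply/setP=> y; apply/(orb2_return _ (gjw j) s_gt0 gjs_x)/(orb2_return _ gw s_gt0 gs_x).
    by case=> i lt_i; rewrite gji //; exists i.
  by case=> i lt_i yi; exists i; rewrite ?gji.
set O := orb2 g w x in orbj.
pose K := (\prod_(y | (croot g y == y) && (y \notin O)) alpha g w y)%R.
have twistK j : twist (g * z ^+ j)%g w =
    (K * \prod_(y in orb2 (g * z ^+ j)%g w x | croot (g * z ^+ j)%g y == y)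
           alpha (g * z ^+ j)%g w y)%R.
  rewrite /twist (bigID [in O]) /= mulrC; congr (_ * _)%R; last first.
    by apply: eq_bigl => y; rewrite orbj andbC.
  have gO y : (g y \in O) = (y \in O) by rewrite mem_orb2g.
  have gj_out y : y \notin O -> (g * z ^+ j)%g y = g y.
    move=> yO; rewrite permM zX ifN //; apply: contra yO; rewrite -gO => /porbitP[b ->].
    by apply/orb2P; exists 0, b; rewrite expg0 perm1.
  have loc := cval_local gO gj_out.
  apply: eq_big => y; last first.
    case/andP=> _ yO; rewrite /alpha.
    have wyO : w y \notin O by rewrite mem_orb2w.
    by have [[_ ->] [_ ->]] := (loc y yO, loc (w y) wyO).
  by apply: andb_id2r => yO; have [-> _] := loc y yO.
have expP (j : 'I_N) : exists p : nat * nat, [/\ p.1 %| d, p.1 %| A + l0 * j,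
    (A + l0 * j) * p.2 = p.1 %[mod d] &
    twist (g * z ^+ j)%g w = (K * zeta d ^+ (p.1 * p.2))%R].
  have gj_min i : 0 < i < s -> ((g * z ^+ j) ^+ i)%g x \notin porbit w x.
    by move=> i_s; have /andP[_ lt_is] := i_s; rewrite gji // min_s.
  have [l [b [ld lA lb Dprod]]] := twist_exponent (gjw j) s_gt0 (gjs j) gj_min.
  by exists (l, b); split=> //; rewrite twistK Dprod.
have [p pP] := fin_all_exists expP.
have l0e j : l0 %| (p j).1.
  have [_ _ e _] := pP j.
  have : l0 %| (A + l0 * j) * (p j).2 by rewrite dvdn_mulr // dvdn_add ?(l0A s A DA) ?dvdn_mulr.
  by rewrite /dvdn -(modn_dvdm _ l0d) e (modn_dvdm _ l0d).
(* The exponent of [zeta d ^+ l0], a primitive root of order [N]. It is injective in [j] by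
   [twist_exponent_inj], as the numbers [A + l0 * j] are distinct modulo [d]. *)
pose f (j : 'I_N) : 'I_N := Ordinal (ltn_pmod ((p j).1 %/ l0 * (p j).2) (ltnW N_gt1)).
have De j : (p j).1 * (p j).2 = l0 * ((p j).1 %/ l0 * (p j).2).
  by rewrite mulnA (mulnC l0) divnK.
have f_inj : injective f.
  move=> j j' /(congr1 val) /= eq_f.
  have [d1 A1 e1 _] := pP j; have [d2 A2 e2 _] := pP j'.
  have := twist_exponent_inj d1 d2 A1 A2 e1 e2; rewrite !De -DN (mulnC N).
  rewrite -!muln_modr eq_f => /(_ erefl) /eqP; rewrite eqn_modDl -!muln_modr.
  by rewrite eqn_pmul2l // !modn_small // => /eqP/val_inj.
have zd_prim : (d.-primitive_root (zeta d))%R.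
  exact: (dvdn_prim_root xi_prim (porbit_dvd M_dvd w x)).
have zN_prim : (N.-primitive_root (zeta d ^+ l0))%R.
  have := exp_prim_root zd_prim l0; rewrite (_ : gcdn l0 d = l0) //.
  exact/gcdn_idPl.
rewrite (eq_bigr (fun j => K * (zeta d ^+ l0) ^+ f j)%R) => [|j _]; last first.
  have [_ _ _ ->] := pP j; rewrite De exprM /=; congr (_ * _)%R.
  by rewrite prim_expr_mod.
have eqS : (\sum_(i < N) (zeta d ^+ l0) ^+ i = \sum_(j < N) (zeta d ^+ l0) ^+ f j)%R.
  by rewrite (reindex_inj f_inj).
by rewrite -mulr_sumr -eqS sum_prim_pow ?mulr0.
Qed.

End Twist.

Local Open Scope ring_scope.

(** * Young idempotents and traces *)

Section Trace.

Variable F : fieldType.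

(** Only the row space of [U] matters, so the symmetrizer defining a module can be replaced by an
    idempotent. With [R] the inclusion and [S] the coordinate map, [E = E S R], and the trace is
    cyclic. *)
Lemma trace_in_submod n (U E G : 'M[F]_n) :
    E *m E = E -> (U :=: E)%MS -> (U *m G <= U)%MS ->
  \tr (in_submod U (val_submod 1%:M *m G)) = \tr (E *m G).
Proof.
move=> EE eqUE stabU; set R := val_submod 1%:M.
have sRU : (R <= U)%MS := val_submodP _.
have subE m (W : 'M_(m, n)) : (W <= U)%MS -> W *m E = W.
  by rewrite eqUE => /submxP[X ->]; rewrite -mulmxA EE.
have sEU : (E <= U)%MS by rewrite eqUE.
rewrite in_submodE mxtrace_mulC; set S := in_submod U 1%:M.
have ESR : E *m S *m R = E by rewrite /S -in_submodE /R -val_submodE in_submodK.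
have sRGU : (R *m G <= U)%MS := submx_trans (submxMr G sRU) stabU.
rewrite -{1}(subE _ _ sRGU) mulmxA mxtrace_mulC.
by rewrite mulmxA [_ *m (R *m G)]mulmxA ESR.
Qed.

Lemma trace_idem n (E : 'M[F]_n) : E *m E = E -> \tr E = (\rank E)%:R.
Proof.
move=> EE; rewrite -{1}[E]mulmx1 -(@trace_in_submod n E E 1%:M) ?mulmx1 //.
by rewrite val_submodK mxtrace1.
Qed.

End Trace.

(** The average of [rho] is idempotent, so its trace is a rank. As [rho 1] may be any idempotent,
    the projection onto a submodule can be made part of [rho]. *)
Lemma trace_mulmorph_ge0 (F : numFieldType) (gT : finGroupType) (H : {group gT})
    n (rho : gT -> 'M[F]_n) :
    {in H &, forall x y, rho x *m rho y = rho (x * y)%g} ->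
  0 <= \sum_(x in H) \tr (rho x).
Proof.
move=> rhoM; set S := \sum_(x in H) rho x.
have HnZ : #|H|%:R != 0 :> F by rewrite pnatr_eq0 -lt0n cardG_gt0.
have SrhoE y : y \in H -> rho y *m S = S.
  move=> Hy; rewrite mulmx_sumr [RHS](reindex_inj (mulgI y)) /=.
  by apply: eq_big => x; rewrite ?groupMl // => Hx; rewrite rhoM.
have SS : S *m S = #|H|%:R *: S.
  rewrite {1}/S mulmx_suml (eq_bigr (fun _ => S)); last by move=> y /SrhoE.
  by rewrite sumr_const scaler_nat.
have trS : \tr S = #|H|%:R * \tr (#|H|%:R^-1 *: S).
  by rewrite linearZ /= mulrA mulfV ?mul1r.
rewrite -raddf_sum /= -/S trS mulr_ge0 ?ler0n // trace_idem ?ler0n //.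
by rewrite -scalemxAl -scalemxAr SS !scalerA -mulrA mulVf ?mulr1.
Qed.

(** * The group algebra and its two regular actions *)

Section GroupAlgebra.

Variables (F : numFieldType) (gT : finGroupType).
Implicit Types (y z : {ffun gT -> F}) (s r : gT).

Definition conv y z : {ffun gT -> F} := [ffun s => \sum_r y r * z (r^-1 * s)%g].

Definition gop N (rho : gT -> 'M[F]_N) z : 'M[F]_N := \sum_s z s *: rho s.

Definition pairing z (phi : gT -> F) : F := \sum_s z s * phi s.

Lemma gop_conv N (rho : gT -> 'M[F]_N) y z :
    (forall s r, rho (s * r)%g = rho s *m rho r) ->
  gop rho (conv y z) = gop rho y *m gop rho z.
Proof.
move=> rhoM; rewrite /gop mulmx_suml.
under eq_bigr do rewrite ffunE scaler_suml.
rewrite exchange_big /=; apply: eq_bigr => r _.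
rewrite (reindex_inj (mulgI r)) mulmx_sumr; apply: eq_bigr => s _.
by rewrite mulKg rhoM -scalemxAl -scalemxAr scalerA.
Qed.

Lemma pairing_trace N (rho : gT -> 'M[F]_N) (B : 'M_N) z :
  pairing z (fun s => \tr (rho s *m B)) = \tr (gop rho z *m B).
Proof.
rewrite /gop mulmx_suml raddf_sum; apply: eq_bigr => s _ /=.
by rewrite -scalemxAl mxtraceZ.
Qed.

Lemma pairing_convC y z (phi : gT -> F) :
  (forall s r, phi (s ^ r)%g = phi s) -> pairing (conv y z) phi = pairing (conv z y) phi.
Proof.
move=> phiJ; rewrite /pairing.
have E a b : \sum_s conv a b s * phi s = \sum_r \sum_s a r * b s * phi (r * s)%g.
  under eq_bigr do rewrite ffunE mulr_suml.
  rewrite exchange_big /=; apply: eq_bigr => r _.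
  by rewrite (reindex_inj (mulgI r)); apply: eq_bigr => s _; rewrite mulKg.
rewrite !E exchange_big /=; apply: eq_bigr => s _; apply: eq_bigr => r _.
by rewrite (mulrC (y r)) -(phiJ (r * s)%g r) conjgE -mulgA mulKg.
Qed.

Local Notation G := [set: gT]%G.
Local Notation reg := (regular_repr F G).
Local Notation unitv g := (delta_mx 0 (gring_index G g) : 'rV[F]_(gcard G)).

Definition lreg s : 'M[F]_(gcard G) := \matrix_i unitv (s * enum_val i)%g.
Definition Lft := gop lreg.
Definition Rgt := gop reg.
Definition vec z : 'rV[F]_(gcard G) := \sum_s z s *: unitv s.

Lemma unitv_reg g s : unitv g *m reg s = unitv (g * s)%g.
Proof. by rewrite -rowE rowK gring_indexK ?inE. Qed.

Lemma unitv_lreg g s : unitv g *m lreg s = unitv (s * g)%g.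
Proof. by rewrite -rowE rowK gring_indexK ?inE. Qed.

Lemma unitv_eq (A B : 'M[F]_(gcard G)) :
  (forall g, unitv g *m A = unitv g *m B) -> A = B.
Proof.
by move=> eqAB; apply/row_matrixP=> i; rewrite !rowE -(gring_valK i) eqAB.
Qed.

Lemma regM s r : reg (s * r)%g = reg s *m reg r.
Proof. by rewrite repr_mxM ?inE. Qed.

Lemma lreg_regC s r : lreg s *m reg r = reg r *m lreg s.
Proof.
by apply: unitv_eq => g; rewrite !mulmxA unitv_lreg !unitv_reg unitv_lreg mulgA.
Qed.

Lemma unitv_Rgt g z : unitv g *m Rgt z = \sum_s z s *: unitv (g * s)%g.
Proof.
rewrite mulmx_sumr; apply: eq_bigr => s _.
by rewrite -scalemxAr unitv_reg.
Qed.

Lemma unitv_Lft g z : unitv g *m Lft z = \sum_s z s *: unitv (s * g)%g.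
Proof.
rewrite mulmx_sumr; apply: eq_bigr => s _.
by rewrite -scalemxAr unitv_lreg.
Qed.

Lemma vec_conv_Rgt y z : vec (conv y z) = vec y *m Rgt z.
Proof.
rewrite /vec mulmx_suml; under eq_bigr do rewrite ffunE scaler_suml.
rewrite exchange_big /=; apply: eq_bigr => r _.
rewrite (reindex_inj (mulgI r)) -scalemxAl unitv_Rgt scaler_sumr.
by apply: eq_bigr => s _; rewrite mulKg scalerA.
Qed.

Lemma vec_conv_Lft y z : vec (conv y z) = vec z *m Lft y.
Proof.
rewrite /vec mulmx_suml; under eq_bigr do rewrite ffunE scaler_suml.
rewrite exchange_big /= (eq_bigr (fun r => \sum_s
  (y r * z s) *: unitv (r * s)%g)) => [|r _]; last first.
  by rewrite (reindex_inj (mulgI r)); apply: eq_bigr => s _; rewrite mulKg.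
rewrite exchange_big /=; apply: eq_bigr => s _.
rewrite -scalemxAl unitv_Lft scaler_sumr.
by apply: eq_bigr => r _; rewrite scalerA mulrC.
Qed.

Lemma LftRgtC y z : Lft y *m Rgt z = Rgt z *m Lft y.
Proof.
rewrite /Lft /Rgt /gop mulmx_suml mulmx_sumr; apply: eq_bigr => s _.
rewrite mulmx_suml mulmx_sumr; apply: eq_bigr => r _.
by rewrite -!(scalemxAl, scalemxAr) lreg_regC !scalerA mulrC.
Qed.

Lemma Lft_conv y z : Lft (conv y z) = Lft z *m Lft y.
Proof.
apply: unitv_eq => g; rewrite mulmxA.
have -> : unitv g *m Lft z = vec z *m reg g.
  rewrite unitv_Lft /vec mulmx_suml; apply: eq_bigr => s _.
  by rewrite -scalemxAl unitv_reg.
have -> : unitv g *m Lft (conv y z) = vec (conv y z) *m reg g.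
  rewrite unitv_Lft /vec mulmx_suml; apply: eq_bigr => s _.
  by rewrite -scalemxAl unitv_reg.
rewrite vec_conv_Lft -!mulmxA; congr (_ *m _).
rewrite /Lft /gop mulmx_suml mulmx_sumr; apply: eq_bigr => s _.
by rewrite -scalemxAl -scalemxAr lreg_regC.
Qed.

Lemma vecE z s : vec z 0 (gring_index G s) = z s.
Proof.
rewrite /vec summxE (bigD1 s) //= big1 => [|r neq_rs]; rewrite !mxE eqxx.
  by rewrite eqxx mulr1 addr0.
have [/(congr1 enum_val)|] := eqVneq (gring_index G s) (gring_index G r).
  by rewrite !gring_indexK ?inE // => eq_sr; rewrite eq_sr eqxx in neq_rs.
by rewrite mulr0.
Qed.

Lemma vec_inj : injective vec.
Proof. by move=> y z eq_yz; apply/ffunP=> s; rewrite -!vecE eq_yz. Qed.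

Lemma vec_surj (v : 'rV[F]_(gcard G)) : exists z, v = vec z.
Proof.
exists [ffun s => v 0 (gring_index G s)]; apply/rowP=> i.
by rewrite -(gring_valK i) vecE ffunE gring_valK.
Qed.

Lemma unitv1_Lft z : unitv 1%g *m Lft z = vec z.
Proof. by rewrite unitv_Lft; apply: eq_bigr => s _; rewrite mulg1. Qed.

Lemma unitv1_Rgt z : unitv 1%g *m Rgt z = vec z.
Proof. by rewrite unitv_Rgt; apply: eq_bigr => s _; rewrite mul1g. Qed.

(** Von Neumann regularity. By Maschke there is an equivariant projection [P] onto the right ideal
    generated by [c]. It is left multiplication by its value at [1], which lies in the ideal and so
    has the form [c x]; and [P] fixes [c]. *)
Lemma group_algebra_regular c : exists x, conv (conv c x) c == c.
Proof.
have modU : mxmodule reg (Lft c).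
  apply/mxmoduleP=> r _; rewrite (_ : _ *m _ = reg r *m Lft c) ?submxMl //.
  rewrite /Lft /gop mulmx_suml mulmx_sumr; apply: eq_bigr => s _.
  by rewrite -scalemxAl -scalemxAr lreg_regC.
have charF : ([pchar F]^'.-group G)%g.
  by rewrite /pgroup pcharf'_nat pnatr_eq0 -lt0n cardG_gt0.
have [W modW defUW dxUW] := mx_Maschke_pchar reg charF modU (submx1 _).
set P := proj_mx (Lft c) W.
have dx0 : (Lft c :&: W = 0)%MS by apply/mxdirect_addsP.
have PC : {in G, forall r, P *m reg r = reg r *m P}.
  have /hom_mxP homP : (1%:M <= dom_hom_mx reg P)%MS.
    by rewrite -defUW proj_mx_hom.
  by move=> r Gr; have := homP r Gr; rewrite !mul1mx.
have /submxP[X defP] : (P <= Lft c)%MS by rewrite -[P]mul1mx proj_mx_sub.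
have [x def_x] := vec_surj (unitv 1%g *m X).
exists x; apply/eqP/vec_inj.
rewrite vec_conv_Rgt vec_conv_Lft -def_x -(mulmxA _ X) -defP.
have -> : unitv 1%g *m P *m Rgt c = vec c *m P.
  rewrite -unitv1_Rgt -mulmxA -[RHS]mulmxA; congr (_ *m _); move: P {defP} PC => P' PC.
  rewrite /Rgt /gop mulmx_suml mulmx_sumr; apply: eq_bigr => s _.
  by rewrite -scalemxAl -scalemxAr PC ?inE.
by rewrite proj_mx_id // -unitv1_Lft submxMl.
Qed.

End GroupAlgebra.

Lemma trace_lreg_reg (F : numFieldType) (gT : finGroupType) (a b : gT) :
  \tr (lreg F a *m regular_repr F [set: gT]%G b) = \sum_(g : gT) (a * g * b == g)%g%:R.
Proof.
have bij : {on [pred _ | true], bijective (gring_index [set: gT]%G)}.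
  apply: onW_bij; exists enum_val; last exact: gring_valK.
  by move=> g; rewrite gring_indexK ?inE.
rewrite /mxtrace (reindex _ bij); apply: eq_bigr => g _ /=.
set M := _ *m _; have -> : M (gring_index [set: gT]%G g) (gring_index [set: gT]%G g)
    = ((delta_mx 0 (gring_index [set: gT]%G g) : 'rV_(gcard [set: gT]%G)) *m M)
        0 (gring_index [set: gT]%G g).
  by rewrite -rowE [RHS]mxE.
rewrite /M mulmxA unitv_lreg unitv_reg mxE eqxx /=; congr (_%:R).
have idx_inj : injective (gring_index [set: gT]).
  by move=> u v /(congr1 enum_val); rewrite !gring_indexK ?inE.
by rewrite (inj_eq idx_inj) eq_sym.
Qed.

Section ConvA.
Variables (F : numFieldType) (gT : finGroupType).
Implicit Types y z : {ffun gT -> F}.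

Lemma Rgt_conv y z : Rgt (conv y z) = Rgt y *m Rgt z.
Proof. by apply: gop_conv => s r; exact: regM. Qed.

Lemma convA y z x : conv y (conv z x) = conv (conv y z) x :> {ffun gT -> F}.
Proof. by apply: vec_inj; rewrite vec_conv_Rgt Rgt_conv mulmxA -!vec_conv_Rgt. Qed.

(** Inversion exchanges the fixed points of [g |-> s g r] with those of [g |-> r g s]. *)
Lemma trace_Lft_Rgt y z : \tr (Lft y *m Rgt z) = \tr (Lft z *m Rgt y).
Proof.
have trE s r : \tr (lreg F s *m regular_repr F [set: gT]%G r)
             = \tr (lreg F r *m regular_repr F [set: gT]%G s).
  rewrite !trace_lreg_reg (reindex_inj invg_inj); apply: eq_bigr => g _.
  congr (_ %:R); rewrite -(inj_eq invg_inj) !invMg !invgK.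
  by rewrite mulgA -(inj_eq (mulgI r)) -(inj_eq (mulIg s)) !mulgA mulgV mul1g
             mulgKV eq_sym.
have trS a b : \tr (Lft a *m Rgt b) = \sum_s \sum_r a s * b r
    * \tr (lreg F s *m regular_repr F [set: gT]%G r).
  rewrite /Lft /Rgt /gop mulmx_suml raddf_sum; apply: eq_bigr => s _ /=.
  rewrite mulmx_sumr raddf_sum; apply: eq_bigr => r _ /=.
  by rewrite -scalemxAl -scalemxAr !mxtraceZ mulrA.
rewrite !trS exchange_big; apply: eq_bigr => s _; apply: eq_bigr => r _.
by rewrite trE (mulrC (y r)).
Qed.

End ConvA.

(** * Young symmetrizers and Specht characters *)

Section Young.

Variable F : numFieldType.
Implicit Types (sh : seq nat).

Definition rsym n sh : {ffun 'S_n -> F} := [ffun s => (s \in row_stab n sh)%:R].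
Definition csym n sh : {ffun 'S_n -> F} :=
  [ffun s => (-1) ^+ odd_perm s * (s \in col_stab n sh)%:R].
Definition ygen n sh := conv (rsym n sh) (csym n sh).

Lemma young_symE n sh (V : lmodType F) (e : 'S_n -> V) :
  young_sym sh e = \sum_s ygen n sh s *: e s.
Proof.
rewrite /young_sym; under [RHS]eq_bigr do rewrite ffunE scaler_suml.
rewrite [RHS]exchange_big [LHS]big_mkcond /=; apply: eq_bigr => p _.
under [RHS]eq_bigr do rewrite [rsym _ _ _]ffunE.
case: ifP => _; last first.
  by rewrite big1 // => s _; rewrite mul0r scale0r.
rewrite big_mkcond [RHS](reindex_inj (mulgI p)); apply: eq_bigr => q _ /=.
rewrite mulKg mul1r ffunE; case: ifP => _; first by rewrite mulr1.
by rewrite mulr0 scale0r.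
Qed.

Lemma row_stabP n sh (p : 'S_n) :
  reflect (forall i, reshape_index sh (p i) = reshape_index sh i)
          (p \in row_stab n sh).
Proof. by rewrite inE; apply: (iffP forallP) => H i; apply/eqP. Qed.

Lemma col_stabP n sh (p : 'S_n) :
  reflect (forall i, reshape_offset sh (p i) = reshape_offset sh i)
          (p \in col_stab n sh).
Proof. by rewrite inE; apply: (iffP forallP) => H i; apply/eqP. Qed.

Lemma row_stabM n sh (p r : 'S_n) : p \in row_stab n sh ->
  (p * r \in row_stab n sh)%g = (r \in row_stab n sh).
Proof.
move/row_stabP=> pP; apply/row_stabP/row_stabP => rP i.
  by have := rP (p^-1 i)%g; rewrite permM permKV => ->; rewrite -pP permKV.
by rewrite permM rP pP.
Qed.

Lemma col_stabM n sh (p r : 'S_n) : p \in col_stab n sh ->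
  (p * r \in col_stab n sh)%g = (r \in col_stab n sh).
Proof.
move/col_stabP=> pP; apply/col_stabP/col_stabP => rP i.
  by have := rP (p^-1 i)%g; rewrite permM permKV => ->; rewrite -pP permKV.
by rewrite permM rP pP.
Qed.

Lemma tperm_row_stab n sh (i j : 'I_n) :
  reshape_index sh i = reshape_index sh j -> tperm i j \in row_stab n sh.
Proof. by move=> eq_ij; apply/row_stabP => k; case: tpermP => // ->. Qed.

Lemma tperm_col_stab n sh (i j : 'I_n) :
  reshape_offset sh i = reshape_offset sh j -> tperm i j \in col_stab n sh.
Proof. by move=> eq_ij; apply/col_stabP => k; case: tpermP => // ->. Qed.

(** A box is determined by its row and column, so row and column stabilizers meet only in [1]. This
    shows that the symmetrizer and its idempotent are nonzero. *)
Lemma ygen1 n sh : ygen n sh 1%g = 1.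
Proof.
rewrite ffunE (bigD1 1%g) //= big1 => [|p neq1]; rewrite !ffunE.
  rewrite invg1 mulg1 odd_perm1 expr0 mul1r addr0.
  by rewrite !(introT (row_stabP _ _)) ?(introT (col_stabP _ _)) ?mulr1 // => i;
    rewrite perm1.
rewrite mulg1; have [pP|] := boolP (p \in _); last by rewrite mul0r.
have [qP|] := boolP (_ \in col_stab _ _); last by rewrite !mulr0.
case/eqP: neq1; apply/permP=> i; rewrite perm1; apply: val_inj => /=.
rewrite -(reshape_indexK sh (p i)) -[RHS](reshape_indexK sh i).
move/row_stabP: pP => ->; congr flatten_index.
by have /col_stabP/(_ (p i)) := qP; rewrite permK => ->.
Qed.

(* Semisimplicity replaces the computation of the square of the Young
   symmetrizer: if c x c = c then c x is an idempotent with the same right ideal. *)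
Definition yinv n sh := xchoose (group_algebra_regular (ygen n sh)).
Definition yidem n sh := conv (ygen n sh) (yinv n sh).

Lemma yidem_ygen n sh : conv (yidem n sh) (ygen n sh) = ygen n sh.
Proof. exact/eqP/(xchooseP (group_algebra_regular (ygen n sh))). Qed.

Lemma yidemK n sh : conv (yidem n sh) (yidem n sh) = yidem n sh.
Proof. by rewrite {2}/yidem convA yidem_ygen. Qed.

Lemma yidem_neq0 n sh : yidem n sh != 0.
Proof.
apply/eqP=> e0; have := ygen1 n sh; rewrite -yidem_ygen e0 ffunE big1.
  by move/eqP; rewrite eq_sym oner_eq0.
by move=> r _; rewrite ffunE mul0r.
Qed.

(* The character of the Specht module of shape sh. *)
Definition ychar n sh (s : 'S_n) : F :=
  \tr (Lft (yidem n sh) *m regular_repr F [set: 'S_n]%G s).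

Lemma ycharJ n sh (s r : 'S_n) : ychar sh (s ^ r)%g = ychar sh s :> F.
Proof.
rewrite /ychar conjgE !regM; set E := Lft _.
have EC g : E *m regular_repr F [set: 'S_n]%G g
    = regular_repr F [set: 'S_n]%G g *m E.
  rewrite /E /Lft /gop mulmx_suml mulmx_sumr; apply: eq_bigr => a _.
  by rewrite -scalemxAl -scalemxAr lreg_regC.
rewrite mxtrace_mulC -!mulmxA -EC mxtrace_mulC -!mulmxA -regM mulgV repr_mx1.
by rewrite mulmx1 EC.
Qed.

Lemma pairing_ychar n sh sh' :
  pairing (yidem n sh) (ychar sh') = \tr (Lft (yidem n sh') *m Rgt (yidem n sh)).
Proof.
rewrite /Rgt /gop mulmx_sumr raddf_sum; apply: eq_bigr => s _ /=.
by rewrite -scalemxAr mxtraceZ.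
Qed.

Lemma pairing_ycharC n sh sh' :
  pairing (yidem n sh) (ychar sh') = pairing (yidem n sh') (ychar sh).
Proof. by rewrite !pairing_ychar; exact: trace_Lft_Rgt. Qed.

(** Left and right multiplications commute. The product projects onto the elements [e' x e], that
    is, onto the homomorphisms between the two Specht modules, so that the pairing is the dimension
    of this space. *)
Lemma Lft_Rgt_idem n sh sh' (E := Lft (yidem n sh') *m Rgt (yidem n sh)) :
  E *m E = E.
Proof.
by rewrite /E mulmxA -(mulmxA (Lft _)) -LftRgtC mulmxA -Lft_conv yidemK
           -mulmxA -Rgt_conv yidemK.
Qed.

Lemma pairing_ychar_ge0 n sh sh' : 0 <= pairing (yidem n sh) (ychar sh').
Proof. by rewrite pairing_ychar trace_idem ?ler0n ?Lft_Rgt_idem. Qed.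

Lemma pairing_ychar_gt0 n sh : 0 < pairing (yidem n sh) (ychar sh).
Proof.
rewrite pairing_ychar trace_idem ?Lft_Rgt_idem // ltr0n lt0n mxrank_eq0.
apply/eqP => E0; have /eqP[] := yidem_neq0 n sh.
apply: vec_inj; rewrite -{1}yidemK vec_conv_Rgt -{1}yidemK vec_conv_Lft.
rewrite -mulmxA E0 mulmx0 /vec big1 // => s _.
by rewrite ffunE scale0r.
Qed.

Lemma csym_tperm n sh (i j : 'I_n) (V : lmodType F) (e : 'S_n -> V) :
    i != j -> reshape_offset sh i = reshape_offset sh j ->
  \sum_s csym n sh s *: e (tperm i j * s)%g = - \sum_s csym n sh s *: e s.
Proof.
move=> neq_ij eq_ij; rewrite (reindex_inj (mulgI (tperm i j))) -sumrN.
apply: eq_bigr => s _; rewrite mulgA tperm2 mul1g !ffunE col_stabM.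
  by rewrite odd_mul_tperm neq_ij addTb signrN mulNr scaleNr.
exact: tperm_col_stab.
Qed.

Lemma csym_tpermr n sh (i j : 'I_n) (V : lmodType F) (e : 'S_n -> V) :
    i != j -> reshape_offset sh i = reshape_offset sh j ->
  \sum_s csym n sh s *: e (s * tperm i j)%g = - \sum_s csym n sh s *: e s.
Proof.
move=> neq_ij eq_ij; rewrite (reindex_inj (mulIg (tperm i j))) -sumrN.
apply: eq_bigr => s _; rewrite -mulgA tperm2 mulg1 !ffunE.
rewrite odd_permM odd_tperm neq_ij addbT signrN mulNr scaleNr.
have /col_stabP tP := tperm_col_stab eq_ij.
suff -> : (s * tperm i j \in col_stab n sh)%g = (s \in col_stab n sh) by [].
by apply/col_stabP/col_stabP => sP k; move: (sP k); rewrite permM tP.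
Qed.

(** The transposition [t] of [i] and [j] changes the sign of the column antisymmetrizer, and its
    conjugate by [g] is absorbed by the row symmetrizer; hence the product with [g] in the middle is
    its own opposite. *)
Lemma Lft_csym_rsym n sh sh' :
    (forall g : 'S_n, exists i j : 'I_n, [/\ i != j,
       reshape_offset sh i = reshape_offset sh j &
       reshape_index sh' (g i) = reshape_index sh' (g j)]) ->
  Lft (csym n sh) *m Rgt (rsym n sh') = 0.
Proof.
move=> bad; apply: unitv_eq => g; rewrite mulmx0.
have [i [j [neq_ij eq_c eq_r]]] := bad g.
set x := _ *m _; suff : x = - x.
  by move/eqP; rewrite -addr_eq0 -mulr2n -scaler_nat scaler_eq0 pnatr_eq0 => /eqP.
pose t := tperm i j; pose t' := tperm (g i) (g j).
have tg : (t * g = g * t')%g by rewrite /t' -tpermJ -conjgC.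
have tRow : regular_repr F [set: 'S_n]%G t' *m Rgt (rsym n sh') = Rgt (rsym n sh').
  apply: unitv_eq => k; rewrite mulmxA unitv_reg !unitv_Rgt.
  rewrite [RHS](reindex_inj (mulgI t')); apply: eq_bigr => s _.
  by rewrite mulgA !ffunE row_stabM // tperm_row_stab.
pose e s := (delta_mx 0 (gring_index [set: 'S_n]%G (s * g)%g) : 'rV[F]_(gcard _))
              *m Rgt (rsym n sh').
have Ex : x = \sum_s csym n sh s *: e s.
  rewrite /x mulmxA unitv_Lft mulmx_suml; apply: eq_bigr => s _.
  by rewrite -scalemxAl.
rewrite {2}Ex -(csym_tpermr e neq_ij eq_c) Ex; apply: eq_bigr => s _.
by congr (_ *: _); rewrite /e -mulgA -/t tg mulgA -[in RHS]unitv_reg -mulmxA tRow.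
Qed.

End Young.

Lemma fixcJ (X Y : finType) (u r : {perm X}) (s : {perm Y}) :
  fixc (u ^ r) s = fixc u s.
Proof.
pose h (f : {ffun X -> Y}) := [ffun x => f (r x)].
pose h' (f : {ffun X -> Y}) := [ffun x => f (r^-1 x)%g].
have hK : cancel h h' by move=> f; apply/ffunP=> x; rewrite !ffunE permKV.
have hK' : cancel h' h by move=> f; apply/ffunP=> x; rewrite !ffunE permK.
have bijh : bijective h by exists h'.
rewrite /fixc -[RHS](on_card_preimset (onW_bij _ bijh)); apply: eq_card => f.
rewrite !inE; apply/forallP/forallP => fP x.
  by have := fP (r x); rewrite permJ !ffunE.
by have := fP (r^-1 x)%g; rewrite !ffunE -permJ permKV.
Qed.

Section Traces.

Variable F : numFieldType.

Lemma trace_specht t sh (s : 'S_t) :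
  \tr (specht F t sh s) = ychar F sh s.
Proof.
rewrite /ychar /=; apply: trace_in_submod.
- by rewrite -Lft_conv yidemK.
- have eqv : specht_gen F t sh = vec (ygen F t sh).
    by rewrite /specht_gen young_symE.
  have eqL : (Lft (yidem F t sh) :=: Lft (ygen F t sh))%MS.
    apply/eqmxP/andP; split; first by rewrite Lft_conv submxMl.
    by rewrite -{1}yidem_ygen Lft_conv submxMl.
  apply: eqmx_trans _ (eqmx_sym eqL); apply/eqmxP/andP; split.
    apply: cyclic_mx_sub; last by rewrite eqv -unitv1_Lft submxMl.
    apply/mxmoduleP=> r _; rewrite (_ : _ *m _ =
      regular_repr F [set: 'S_t]%G r *m Lft (ygen F t sh)) ?submxMl //.
    rewrite /Lft /gop mulmx_suml mulmx_sumr; apply: eq_bigr => a _.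
    by rewrite -scalemxAl -scalemxAr lreg_regC.
  apply/row_subP=> i; rewrite rowE -(gring_valK i) unitv_Lft.
  rewrite (_ : \sum_s _ = specht_gen F t sh *m
    regular_repr F [set: 'S_t]%G (enum_val i)).
    by rewrite mxmodule_trans ?cyclic_mx_module ?inE ?cyclic_mx_id.
  rewrite eqv /vec mulmx_suml; apply: eq_bigr => a _.
  by rewrite -scalemxAl unitv_reg.
- by apply: mxmodule_trans; rewrite ?cyclic_mx_module ?inE.
Qed.

Lemma place_mxM t n (s r : 'S_n) :
  place_mx F t (s * r)%g = place_mx F t s *m place_mx F t r.
Proof.
apply/matrixP=> i j; rewrite !mxE.
pose f : {ffun 'I_n -> 'I_t} := [ffun k => word j (r k)].
rewrite (bigD1 (enum_rank f)) //= big1 ?addr0 => [|l neq_l]; last first.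
  rewrite !mxE [word l == _](_ : _ = false) ?mulr0 //; apply/eqP=> eq_l.
  by case/eqP: neq_l; apply: enum_val_inj; rewrite enum_rankK /f -eq_l.
rewrite !mxE !word_rank eqxx mulr1; congr (_ == _)%:R.
by apply/ffunP=> k; rewrite !ffunE permM.
Qed.

Lemma trace_place_tens t n (u : 'S_n) (s : 'S_t) :
  \tr (place_mx F t u *m tens_mx n (perm_mx s)) = (fixc u s)%:R.
Proof.
rewrite mxtrace_mulC /fixc -sum1_card natr_sum big_mkcond /=.
rewrite /mxtrace (reindex (@enum_rank _)); last first.
  by apply: onW_bij; apply: enum_rank_bij.
apply: eq_bigr => f _; rewrite mxE.
pose i : {ffun 'I_n -> 'I_t} := [ffun k => f (u k)].
rewrite (bigD1 (enum_rank i)) //= big1 ?addr0 => [|l neq_l]; last first.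
  rewrite !mxE [word l == _](_ : _ = false) ?mulr0 //; apply/eqP=> eq_l.
  case/eqP: neq_l; apply: enum_val_inj; rewrite enum_rankK.
  by apply/ffunP=> k; rewrite [enum_val l](eq_l) !ffunE word_rank.
rewrite !mxE !word_rank [_ == _](_ : _ = true) ?mulr1; last first.
  by apply/eqP/ffunP=> k; rewrite !ffunE.
rewrite inE; case: ifP => [/forallP fP|/negbT].
  by rewrite big1 // => k _; rewrite !mxE ffunE (eqP (fP k)) eqxx.
rewrite negb_forall => /existsP[k neq_k].
by rewrite (bigD1 k) //= !mxE ffunE eq_sym (negPf neq_k) mul0r.
Qed.

(** The Schur module is a row space, so the symmetrizer must be the right factor here, unlike in
    [yidem]. The two idempotents pair equally with class functions by [pairing_convC]. *)
Lemma gop_place_idem t n sh (E := gop (@place_mx F t n) (conv (yinv F n sh) (ygen F n sh))) :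
  E *m E = E /\ (gop (@place_mx F t n) (ygen F n sh) :=: E)%MS.
Proof.
have gM : forall s r : 'S_n, place_mx F t (s * r)%g = place_mx F t s *m place_mx F t r.
  exact: place_mxM.
split.
  by rewrite /E -(gop_conv _ _ gM) -convA (convA (ygen F n sh)) -/(yidem F n sh)
             yidem_ygen.
apply/eqmxP/andP; split; last by rewrite /E (gop_conv _ _ gM) submxMl.
by rewrite -{1}yidem_ygen /yidem -convA (gop_conv _ _ gM) submxMl.
Qed.

Lemma trace_res_schur t (lam : intpart) (s : 'S_t) :
  \tr (res_schur F t lam s)
    = pairing (yidem F (psize lam) lam) (fun u => (fixc u s)%:R).
Proof.
rewrite /yidem pairing_convC; last by move=> u r; rewrite fixcJ.
have [EE eqU] := gop_place_idem t (psize lam) lam.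
have eqS : schur_module F t lam = gop (@place_mx F t (psize lam)) (ygen F _ lam).
  by rewrite /schur_module young_symE.
rewrite /= /schur_mx (trace_in_submod EE); last 2 first.
- by rewrite eqS.
- exact: schur_module_stable.
rewrite -pairing_trace; apply: eq_bigr => u _.
by rewrite trace_place_tens.
Qed.

End Traces.

(** * Dominance and vanishing of pairings *)

Lemma leq_sumn_take k m sh : (k <= m)%N -> (sumn (take k sh) <= sumn (take m sh))%N.
Proof.
move=> le_km; have -> : take k sh = take k (take m sh) by rewrite take_takel.
by rewrite -{2}(cat_take_drop k (take m sh)) sumn_cat leq_addr.
Qed.

Lemma reshape_index_ltn sh i k : (i < sumn sh)%N ->
  (reshape_index sh i < k)%N = (i < sumn (take k sh))%N.
Proof.
move=> lt_i; have ltc := reshape_offsetP lt_i.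
rewrite -{2}(reshape_indexK sh i) /flatten_index.
case: ltnP => [lt_rk|le_kr]; symmetry.
  apply: leq_trans (leq_sumn_take sh lt_rk).
  rewrite (take_nth 0%N) ?reshape_indexP // sumn_rcons.
  by rewrite ltn_add2l.
apply/negbTE; rewrite -leqNgt.
exact: leq_trans (leq_sumn_take sh le_kr) (leq_addr _ _).
Qed.

Lemma widen_ord_inj m n (le_mn : (m <= n)%N) : injective (widen_ord le_mn).
Proof. by move=> i j /(congr1 val) /= /val_inj. Qed.

Lemma card_reshape_index n sh k : sumn sh = n ->
  #|[set i : 'I_n | (reshape_index sh i < k)%N]| = sumn (take k sh).
Proof.
move=> <-; have le_s : (sumn (take k sh) <= sumn sh)%N.
  by rewrite -{2}(cat_take_drop k sh) sumn_cat leq_addr.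
rewrite -[RHS]card_ord.
rewrite -(card_imset predT (@widen_ord_inj _ _ le_s)); apply: eq_card => i.
rewrite inE reshape_index_ltn //; apply/idP/imsetP => [lt_i|[j _ ->]]; last exact: (ltn_ord j).
by exists (Ordinal lt_i) => //; apply: val_inj.
Qed.

(** The count is done column by column of [sh]: the boxes of one column go to distinct rows of
    [sh'], so at most [k] of them go to the first [k] rows. *)
Lemma dominance_card n sh sh' (g : 'S_n) k :
    sumn sh = n -> sorted geq sh ->
    (forall i j : 'I_n, reshape_offset sh i = reshape_offset sh j ->
       reshape_index sh' (g i) = reshape_index sh' (g j) -> i = j) ->
  (#|[set i : 'I_n | (reshape_index sh' i < k)%N]|
     <= #|[set i : 'I_n | (reshape_index sh i < k)%N]|)%N.
Proof.
move=> sz_sh sort_sh good; set L := [set i | _]; set R := [set i | _].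
have -> : #|L| = #|[set i : 'I_n | (reshape_index sh' (g i) < k)%N]|.
  rewrite -(card_imset L (@perm_inj _ g^-1%g)); apply: eq_card => i.
  rewrite inE; apply/imsetP/idP => [[j]|lt_i]; last first.
    by exists (g i); rewrite ?permK // inE.
  by rewrite inE => lt_j ->; rewrite permKV.
have off_lt (i : 'I_n) : (reshape_offset sh i < n)%N.
  exact: leq_ltn_trans (leq_subr _ _) (ltn_ord i).
pose off i := Ordinal (off_lt i).
have cardE (P : pred 'I_n) : #|[set i | P i]|
    = \sum_(c < n) #|[set i | P i && (off i == c)]|.
  rewrite -sum1_card (partition_big off predT) //=; apply: eq_bigr => c _.
  by rewrite -sum1_card; apply: eq_bigl => i; rewrite !inE.
rewrite /R !cardE; apply: leq_sum => c _.
(* Either column [c] lies within the first [k] rows and the bound is trivial, or it reaches below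
   them and so has [k] boxes in the first [k] rows. *)
have [/existsP[i /andP[/eqP off_i le_ki]]|] := boolP
    [exists i, (off i == c) && (k <= reshape_index sh i)%N]; last first.
  rewrite negb_exists => /forallP allk.
  apply/subset_leq_card/subsetP=> i; rewrite !inE => /andP[_ off_i].
  by have := allk i; rewrite off_i /= -ltnNge => ->.
apply: (@leq_trans k).
  pose f (i : 'I_n) : 'I_k.+1 := inord (reshape_index sh' (g i)).
  set S := [set _ | _]; rewrite -(card_in_imset (f := f) (D := mem S)); last first.
    move=> a b; rewrite !inE => /andP[lta /eqP offa] /andP[ltb /eqP offb].
    move/(congr1 val); rewrite /= !inordK ?ltnS ?(ltnW lta) ?(ltnW ltb) //.
    by apply: good; have /(congr1 val) := etrans offa (esym offb).
  apply: (@leq_trans #|'I_k|); last by rewrite card_ord.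
  rewrite -(card_imset predT (@widen_ord_inj _ _ (leqnSn k))).
  apply/subset_leq_card/subsetP=> _ /imsetP[a Sa ->]; move: Sa; rewrite !inE => /andP[lta _].
  apply/imsetP; exists (Ordinal lta) => //; apply: val_inj.
  by rewrite /= inordK // ltnS ltnW.
have box (r : 'I_k) : (c < nth 0%N sh r)%N.
  have lt_i : (i < sumn sh)%N by rewrite sz_sh.
  rewrite -off_i /=; apply: leq_trans (reshape_offsetP lt_i) _.
  have le_ri : (r <= reshape_index sh i)%N by apply: leq_trans le_ki; apply: ltnW.
  have := sorted_leq_nth (T := nat) (leT := geq).
  move/(_ (fun _ _ _ h1 h2 => leq_trans h2 h1) leqnn 0%N sh sort_sh).
  apply=> //; rewrite inE ?reshape_indexP //.
  exact: leq_ltn_trans le_ri (reshape_indexP lt_i).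
pose h (r : 'I_k) : 'I_n := cast_ord sz_sh (Ordinal (flatten_indexP (box r))).
have h_inj : injective h.
  move=> r r' /(congr1 (fun i : 'I_n => reshape_index sh i)) /=.
  by rewrite !flatten_indexKl // => /val_inj.
apply: (@leq_trans #|'I_k|); first by rewrite card_ord.
rewrite -(card_imset predT h_inj).
apply/subset_leq_card/subsetP=> _ /imsetP[r _ ->]; rewrite !inE.
rewrite flatten_indexKl // ltn_ord /=; apply/eqP/val_inj => /=.
by rewrite flatten_indexKr.
Qed.

Section Vanishing.

Variable F : numFieldType.

Lemma pairing_ychar_dominance n sh sh' :
    sumn sh = n -> sumn sh' = n -> sorted geq sh ->
    pairing (yidem F n sh) (ychar F sh') != 0 ->
  forall k, (sumn (take k sh') <= sumn (take k sh))%N.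
Proof.
move=> szn szn' sort_sh; rewrite pairing_ycharC pairing_ychar => neq0 k.
have [/existsP[g /forallP good]|] := boolP [exists g : 'S_n, forall i : 'I_n, forall j : 'I_n,
   (reshape_offset sh i == reshape_offset sh j) &&
   (reshape_index sh' (g i) == reshape_index sh' (g j)) ==> (i == j)].
  rewrite -(card_reshape_index k szn) -(card_reshape_index k szn').
  apply: (dominance_card (g := g) _ szn) => // i j eo ei.
  by have /forallP/(_ j) := good i; rewrite eo ei !eqxx /= => /eqP.
rewrite negb_exists => /forallP bad; case/eqP: neq0.
set E := yidem F n sh; set E' := yidem F n sh'.
have -> : Lft E = Lft (conv (csym F n sh) (yinv F n sh)) *m Lft (rsym F n sh).
  by rewrite -Lft_conv convA.
have -> : Rgt E' = Rgt (rsym F n sh') *m Rgt (conv (csym F n sh') (yinv F n sh')).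
  by rewrite -Rgt_conv convA.
rewrite Lft_conv -!mulmxA (mulmxA (Lft (rsym _ _ _))) LftRgtC -!mulmxA.
rewrite (mulmxA (Lft (csym _ _ _))) Lft_csym_rsym ?mul0mx ?mulmx0 ?mxtrace0 //.
move=> g; have := bad g; rewrite negb_forall; case/existsP=> i.
rewrite negb_forall; case/existsP=> j; rewrite negb_imply.
by case/andP=> /andP[/eqP eo /eqP ei] ne; exists i, j.
Qed.

Lemma eq_part_sumn_take (lam mu : intpart) :
  (forall k, sumn (take k lam) = sumn (take k mu)) -> lam = mu.
Proof.
move=> eq_s; apply: val_inj => /=.
have eq_nth k : nth 0%N lam k = nth 0%N mu k.
  have sumS (s : seq nat) : (sumn (take k s) + nth 0 s k = sumn (take k.+1 s))%N.
    have [lt_k|le_k] := ltnP k (size s).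
      by rewrite (take_nth 0%N) // sumn_rcons.
    by rewrite nth_default // addn0 !take_oversize // (leq_trans le_k).
  by have := sumS lam; rewrite eq_s => e1; have := sumS mu;
     rewrite -eq_s -eq_s -e1 eq_s => /addnI.
have nz (nu : intpart) k : (nth 0%N nu k != 0%N) = (k < size nu)%N.
  have [lt_k|le_k] := ltnP k (size nu); last by rewrite nth_default.
  have /andP[_ nu0] := partsP nu; apply: contra nu0 => /eqP <-.
  exact: mem_nth.
have eq_sz : size lam = size mu.
  by apply/eqP; rewrite eqn_leq leqNgt -nz eq_nth nz ltnn leqNgt -nz -eq_nth nz ltnn.
exact: (@eq_from_nth _ 0%N).
Qed.

(** As the pairing is symmetric, a nonzero value would give dominance in both directions. *)
Lemma pairing_ychar_part_neq (lam mu : intpart) :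
    psize lam = psize mu -> lam != mu ->
  pairing (yidem F (psize lam) mu) (ychar F lam) = 0.
Proof.
move=> eq_sz neq; apply/eqP; apply: contraNT neq => neq0; apply/eqP.
have [/andP[slam _] /andP[smu _]] := (partsP lam, partsP mu).
apply: eq_part_sumn_take => k; apply/eqP; rewrite eqn_leq; apply/andP; split.
  exact: (@pairing_ychar_dominance (psize lam) mu lam (esym eq_sz) erefl smu neq0).
rewrite pairing_ycharC in neq0.
exact: (@pairing_ychar_dominance (psize lam) lam mu erefl (esym eq_sz) slam neq0).
Qed.

Lemma tens_permM t n (s r : 'S_t) : tens_mx n (perm_mx (s * r) : 'M[F]_t)
  = tens_mx n (perm_mx s) *m tens_mx n (perm_mx r).
Proof. by rewrite perm_mxM tens_mxM. Qed.

Lemma pairing_fixcE t n sh (u : 'S_n) :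
  pairing (yidem F t sh) (fun s => (fixc u s)%:R)
    = \tr (gop (fun s => tens_mx n (perm_mx s)) (yidem F t sh) *m place_mx F t u).
Proof.
rewrite -pairing_trace; apply: eq_bigr => s _.
by rewrite -trace_place_tens mxtrace_mulC.
Qed.

(** Exchanging two values that [f] misses fixes the basis tensor of [f], while it changes the sign
    of the antisymmetrizer if they lie in one column. *)
Lemma gop_csym_tens0 t n sh :
    (forall f : {ffun 'I_n -> 'I_t}, exists i j : 'I_t, [/\ i != j,
       reshape_offset sh i = reshape_offset sh j, i \notin codom f & j \notin codom f]) ->
  gop (fun s => tens_mx n (perm_mx s)) (csym F t sh) = 0.
Proof.
move=> unhit; apply/row_matrixP=> a; rewrite row0 rowE.
have [i [j [neq_ij eq_ij]]] := unhit (word a).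
move=> /negP ni /negP nj; set x := _ *m _; suff : x = - x.
  by move/eqP; rewrite -addr_eq0 -mulr2n -scaler_nat scaler_eq0 pnatr_eq0 => /eqP.
pose e s := (delta_mx 0 a : 'rV[F]_ _) *m tens_mx n (perm_mx s).
have Ex : x = \sum_s csym F t sh s *: e s.
  by rewrite /x /gop mulmx_sumr; apply: eq_bigr => s _; rewrite -scalemxAr.
rewrite {2}Ex -(csym_tperm e neq_ij eq_ij) Ex; apply: eq_bigr => s _.
congr (_ *: _); rewrite /e tens_permM mulmxA; congr (_ *m _).
apply/rowP=> b; rewrite -rowE !mxE eqxx /=.
have fixk k : tperm i j (word a k) = word a k.
  by apply: tpermD; apply/eqP=> eqk; [case: ni | case: nj]; rewrite eqk codom_f.
have [->|neq_ab] := eqVneq b a.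
  by rewrite big1 // => k _; rewrite !mxE fixk eqxx.
apply/eqP; rewrite eq_sym prodf_seq_eq0; apply/hasP.
have [k neq_k] : exists k, word a k != word b k.
  apply/existsP; rewrite -negb_forall; apply: contra neq_ab => /forallP eq_ab.
  by apply/eqP/enum_val_inj/ffunP => k; apply/esym/eqP/eq_ab.
by exists k; rewrite ?mem_index_enum //= !mxE fixk (negPf neq_k).
Qed.

(* The columns number t - |kap|, while f : 'I_n -> 'I_t misses more boxes than
   that, so that it misses two boxes of some column. *)
Lemma pairing_fixc_pad0 t n (kap : intpart) (u : 'S_n) :
    (n < psize kap)%N -> admissible t kap ->
  pairing (yidem F t (pad t kap)) (fun s => (fixc u s)%:R) = 0.
Proof.
move=> lt_n adm; have le_kt : (psize kap <= t)%N := leq_trans (leq_addl _ _) adm.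
have TM := @tens_permM t n.
rewrite pairing_fixcE /yidem /ygen !(gop_conv _ _ TM).
rewrite gop_csym_tens0 ?mulmx0 ?mul0mx ?mxtrace0 // => f.
set m := (t - psize kap)%N.
have off_lt (i : 'I_t) : (reshape_offset (pad t kap) i < m)%N.
  have lt_i : (i < sumn (pad t kap))%N by rewrite /= subnK.
  apply: leq_trans (reshape_offsetP lt_i) _.
  (* Admissibility enters here: the added first row, of length [m], is the longest one, so there are
     at most [m] columns. *)
  have head_le : (head 0 kap <= m)%N by rewrite leq_subRL // addnC.
  case: (reshape_index _ _) => //= r; apply: leq_trans head_le.
  have /andP[skap _] := partsP kap.
  case: (parts kap) skap => [|a s] /=; first by rewrite nth_nil.
  case: r => //= r path_s; have [lt_r|/(nth_default 0%N)->//] := ltnP r (size s).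
  have tr_geq : transitive geq by move=> x y z h1 h2; apply: leq_trans h2 h1.
  exact: (allP (order_path_min tr_geq path_s) _ (mem_nth 0%N lt_r)).
pose off i : 'I_m := Ordinal (off_lt i).
pose S := [set i | i \notin codom f].
have ltS : (m < #|S|)%N.
  have -> : S = ~: [set i in codom f] by apply/setP=> i; rewrite !inE.
  rewrite cardsCs setCK card_ord.
  have leC : (#|[set i in codom f]| <= n)%N.
    by rewrite cardsE (leq_trans (leq_image_card _ _)) // card_ord.
  by rewrite /m ltn_sub2l // (leq_ltn_trans leC) // (leq_trans lt_n).
have [/existsP[i /existsP[j /and4P[Si Sj ne eo]]]|] := boolP [exists i, exists j,
    [&& i \in S, j \in S, i != j & off i == off j]].
  exists i, j; split=> //; first by move/eqP/(congr1 val): eo.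
    by rewrite inE in Si.
  by rewrite inE in Sj.
rewrite negb_exists => /forallP noP; suff: (#|S| <= m)%N by rewrite leqNgt ltS.
apply: (@leq_trans #|'I_m|); last by rewrite card_ord.
rewrite -(card_in_imset (f := off) (D := mem S)) ?max_card //.
move=> i j Si Sj eo; apply/eqP; have := noP i; rewrite negb_exists.
by move/forallP/(_ j); rewrite Si Sj eo eqxx andbT /= negbK.
Qed.

End Vanishing.

(** * Restriction coefficients and their inverse for large [t] *)

Lemma trace_dadd_muln (F : fieldType) (gT : finGroupType) (G : {group gT}) (I : Type) (r : seq I)
    (P : pred I) (V : I -> representation F G) (m : I -> nat) x :
  \tr ((\big[@dadd_grepr F gT G / grepr0]_(i <- r | P i) muln_grepr (V i) (m i)) x)
    = \sum_(i <- r | P i) (m i)%:R * \tr (V i x).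
Proof.
have trD (V1 V2 : representation F G) :
    \tr (dadd_grepr V1 V2 x) = \tr (V1 x) + \tr (V2 x).
  by rewrite /= mxtrace_block.
have tr0 : \tr ((@grepr0 F gT G) x) = 0 by rewrite /= /mxtrace big_ord0.
elim/big_rec2: _ => // i y V' _ IH; rewrite trD IH; congr (_ + _).
rewrite /muln_grepr mulr_natl; elim: (m i) => [|k IHk]; first by rewrite big_ord0.
by rewrite big_ord_recl trD IHk mulrS.
Qed.

Section Stable.

Variables (F : numFieldType) (at_ : nat -> intpart -> intpart -> nat).
Variables (a : intpart -> intpart -> nat) (b : intpart -> intpart -> int).
Hypotheses (at_def : restriction_coefs F at_) (a_def : stable_limit at_ a).
Hypothesis (b_def : inverse_coefs a b).

Lemma trace_res_sum t lam (s : 'S_t) :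
  \tr (res_schur F t lam s) =
    \sum_(nu <- intparts t | admissible t nu) (at_ t lam nu)%:R * ychar F (pad t nu) s.
Proof.
rewrite (mxtrace_rsim (at_def t lam)) ?inE // trace_dadd_muln.
by apply: eq_bigr => nu _; rewrite trace_specht.
Qed.

(** The restricted character is a combination of the functions [fixc u] with [u] of degree
    [psize lam], which the idempotent of [pad t nu] annihilates. *)
Lemma at_large_eq0 t lam nu : (psize lam < psize nu)%N -> admissible t nu ->
  at_ t lam nu = 0%N.
Proof.
move=> lt_sz adm.
have nu_t : nu \in intparts t by rewrite mem_intparts (leq_trans (leq_addl _ _) adm).
pose phi (s : 'S_t) : F := \tr (res_schur F t lam s).
have phi0 : pairing (yidem F t (pad t nu)) phi = 0.
  rewrite /pairing /phi; under eq_bigr do rewrite trace_res_schur mulr_sumr.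
  rewrite exchange_big /= big1 // => u _.
  under eq_bigr do rewrite mulrCA; rewrite -mulr_sumr.
  by have := pairing_fixc_pad0 F u lt_sz adm; rewrite /pairing => ->; rewrite mulr0.
move: phi0; rewrite /pairing /phi.
under eq_bigr do rewrite trace_res_sum mulr_sumr.
rewrite exchange_big /=.
under eq_bigr => mu _.
  under eq_bigr do rewrite mulrCA.
  rewrite -mulr_sumr -/(pairing _ _); over.
(* Multiplicities and pairings are nonnegative, so every term of the vanishing sum is zero. *)
move/eqP; rewrite psumr_eq0 => [/allP/(_ nu nu_t)|mu _]; last first.
  by rewrite mulr_ge0 ?ler0n ?pairing_ychar_ge0.
rewrite adm /= mulf_eq0 pnatr_eq0 => /orP[/eqP//|].
by rewrite gt_eqF // pairing_ychar_gt0.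
Qed.

Lemma stable_inverse kap : exists T, forall t, (T <= t)%N -> forall s : 'S_t,
  \sum_(lam <- intparts (psize kap)) (b lam kap)%:~R * \tr (res_schur F t lam s)
    = ychar F (pad t kap) s.
Proof.
set k := psize kap.
have [T0 T0P] : exists T, forall t, (T <= t)%N -> forall lam nu,
    lam \in intparts k -> nu \in intparts k -> at_ t lam nu = a lam nu.
  suff [T TP] : exists T, forall t, (T <= t)%N -> forall p,
      p \in [seq (x, y) | x <- intparts k, y <- intparts k] -> at_ t p.1 p.2 = a p.1 p.2.
    exists T => t le_t lam nu lam_k nu_k; apply: (TP t le_t (lam, nu)).
    by apply/allpairsP; exists (lam, nu).
  elim: [seq _ | _ <- _, _ <- _] => [|p s [T TP]]; first by exists 0%N.
  have [T' T'P] := a_def p.1 p.2; exists (maxn T T') => t.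
  rewrite geq_max => /andP[le_T le_T'] q; rewrite inE => /predU1P[->|]; last exact: TP.
  exact: T'P.
(* From [k + k] on, all partitions of size at most [k] are admissible. *)
exists (maxn T0 (k + k)) => t; rewrite geq_max => /andP[le_T0 le_kt] s.
have le_k : (k <= t)%N by apply: leq_trans (leq_addr _ _) le_kt.
have adm nu : nu \in intparts k -> admissible t nu.
  rewrite mem_intparts => le_nu; apply: leq_trans _ le_kt.
  by apply: leq_add => //; apply: leq_trans le_nu; rewrite /psize; case: (parts nu) => //= x y;
     rewrite leq_addr.
have traceE lam : lam \in intparts k -> \tr (res_schur F t lam s)
    = \sum_(nu <- intparts k) (a lam nu)%:R * ychar F (pad t nu) s.
  move=> lam_k; rewrite trace_res_sum.
  rewrite (bigID (fun nu => psize nu <= k)%N) /= [X in _ + X]big1 ?addr0; last first.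
    move=> nu /andP[adm_nu]; rewrite -ltnNge => lt_nu; rewrite at_large_eq0 ?mul0r //.
    by apply: leq_ltn_trans lt_nu; rewrite -mem_intparts.
  have eq_k : perm_eq [seq nu <- intparts t | admissible t nu & (psize nu <= k)%N]
                      (intparts k).
    apply: uniq_perm => [||nu]; first exact/filter_uniq/intparts_uniq.
      exact: intparts_uniq.
    rewrite mem_filter !mem_intparts.
    apply/idP/idP => [/andP[/andP[_ ->]]//|le_nu].
    by rewrite adm ?mem_intparts // le_nu (leq_trans le_nu).
  rewrite -big_filter (perm_big _ eq_k) big_seq [RHS]big_seq /=.
  by apply: eq_bigr => nu nu_k; rewrite T0P.
rewrite big_seq; under eq_bigr => lam lam_k do rewrite traceE // mulr_sumr.
rewrite -big_seq exchange_big /=.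
under eq_bigr => nu _.
  under eq_bigr do rewrite mulrA.
  rewrite -mulr_suml (_ : \sum_(lam <- _) _ = (kap == nu)%:R).
    over.
  have := congr1 (fun z => z%:~R : F) (b_def.2 kap nu); rewrite /= rmorph_sum /=.
  rewrite (_ : (_ == _)%:Z%:~R = (kap == nu)%:R) // => <-.
  by apply: eq_bigr => lam _; rewrite rmorphM.
have kap_k : kap \in intparts k by rewrite mem_intparts.
rewrite (big_rem kap kap_k) /= eqxx mul1r big_seq big1 ?addr0 // => nu.
rewrite mem_rem_uniq ?intparts_uniq // inE => /andP[neq _].
by rewrite eq_sym (negPf neq) mul0r.
Qed.

End Stable.

Lemma fixcJr (X Y : finType) (u : {perm X}) (s r : {perm Y}) :
  fixc u (s ^ r)%g = fixc u s.
Proof.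
pose h (f : {ffun X -> Y}) := [ffun x => r (f x)].
pose h' (f : {ffun X -> Y}) := [ffun x => r^-1%g (f x)].
have hK : cancel h h' by move=> f; apply/ffunP=> x; rewrite !ffunE permK.
have hK' : cancel h' h by move=> f; apply/ffunP=> x; rewrite !ffunE permKV.
have bijh : bijective h by exists h'.
rewrite /fixc -[LHS](on_card_preimset (onW_bij _ bijh)); apply: eq_card => f.
rewrite !inE; apply: eq_forallb => x; rewrite !ffunE permJ.
by rewrite (inj_eq perm_inj).
Qed.

Section Inversion.

Variable F : numFieldType.

(** The character at [s] is a weighted count of the [g] with [r * g * s = g]. Each of the [n!]
    elements [g] determines [s] as a conjugate of [r^-1], where [phi s^-1] equals [phi r]. *)
Lemma sum_ychar n sh (phi : 'S_n -> F) : (forall s r, phi (s ^ r)%g = phi s) ->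
  \sum_s ychar F sh s * phi s^-1%g = (n`!)%:R * pairing (yidem F n sh) phi.
Proof.
move=> phiJ.
have charE s : ychar F sh s = \sum_r yidem F n sh r * \sum_g (r * g * s == g)%g%:R.
  rewrite /ychar /Lft /gop mulmx_suml raddf_sum; apply: eq_bigr => r _ /=.
  by rewrite -scalemxAl mxtraceZ trace_lreg_reg.
under eq_bigr do rewrite charE mulr_suml.
rewrite exchange_big mulr_sumr /=; apply: eq_bigr => r _.
under eq_bigr do rewrite -mulrA mulr_suml.
rewrite -mulr_sumr exchange_big mulrCA /=; congr (_ * _).
rewrite (eq_bigr (fun=> phi r)) => [|g _].
  by rewrite sumr_const mulr_natl card_Sn.
rewrite (bigD1 (r^-1 ^ g)%g) //= big1 ?addr0 => [|s neq].
  have -> : (r * g * (r^-1 ^ g) == g)%g by rewrite conjgE !mulgA mulgK mulgV mul1g.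
  by rewrite mul1r conjVg invgK phiJ.
rewrite (_ : (_ == g) = false) ?mul0r //; apply: contraNF neq => /eqP eqg.
by rewrite conjgE (_ : r^-1 * g = g * s)%g ?mulKg // -{1}eqg -mulgA mulKg.
Qed.

Lemma place_mxV t n (s : 'S_n) : place_mx F t s^-1%g = (place_mx F t s)^T.
Proof.
apply/matrixP=> i j; rewrite !mxE; congr (_ %:R); congr nat_of_bool.
by apply/eqP/eqP => eqw; apply/ffunP=> k;
   have := congr1 (fun f : {ffun 'I_n -> 'I_t} => f (s k)) eqw;
   have := congr1 (fun f : {ffun 'I_n -> 'I_t} => f (s^-1 k)%g) eqw;
   rewrite !ffunE ?permK ?permKV.
Qed.

End Inversion.

(** * Counting equivariant maps *)

(** Each translation by [z ^+ j] only permutes the sum, so [N] translated copies can be added term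
    by term; [N] may differ from the order of [z]. *)
Lemma sum_coset_eq0 (F : numFieldType) (gT : finGroupType) (P : pred gT) (z : gT) N
    (sg ps : gT -> F) : (0 < N)%N ->
    (forall j g, P (g * z ^+ j)%g = P g) ->
    (forall j g, P g -> sg (g * z ^+ j)%g = sg g) ->
    (forall g, P g -> \sum_(j < N) ps (g * z ^+ j)%g = 0) ->
  \sum_(g | P g) sg g * ps g = 0.
Proof.
move=> N_gt0 PM sgM ps0; apply: (mulIf (x := N%:R)); first by rewrite pnatr_eq0 -lt0n.
rewrite mul0r mulr_natr -[N in LHS]card_ord -sumr_const /=.
transitivity (\sum_(j < N) \sum_(g | P g) sg g * ps (g * z ^+ j)%g).
  apply: eq_bigr => j _; rewrite (reindex_inj (mulIg (z ^+ j)%g)) /=.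
  apply: eq_big => [g|g]; first exact: PM.
  by rewrite PM => Pg; rewrite sgM.
by rewrite exchange_big /= big1 // => g Pg; rewrite -mulr_sumr ps0 ?mulr0.
Qed.

Lemma sum_swap_eq0 (F : numFieldType) (gT : finGroupType) (P : pred gT) (k : gT)
    (phi : gT -> F) :
    (forall g, P (g * k)%g = P g) -> (forall g, P g -> phi (g * k)%g = - phi g) ->
  \sum_(g | P g) phi g = 0.
Proof.
move=> PM phiM; set S := \sum_(g | _) _; suff : S = - S.
  by move/eqP; rewrite -addr_eq0 -mulr2n mulrn_eq0 => /eqP.
rewrite {1}/S (reindex_inj (mulIg k)) /= -sumrN.
apply: eq_big => [g|g]; first exact: PM.
by rewrite PM => Pg; rewrite phiM.
Qed.

(** * Weighted sums over the permutations preserving the fibres of an equivariant map *)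

Section TwistedSum.

Variables (X Y : finType) (F : numFieldType) (xi : F) (M : nat).
Hypotheses (xi_prim : M.-primitive_root xi).
Hypothesis M_dvd : forall c, (0 < c <= #|X|)%N -> (c %| M)%N.
Local Notation twist := (@twist X F xi M).

Variables (h : X -> option Y) (s : {perm Y}) (w : {perm X}).
Hypothesis hw : forall x, h (w x) = omap s (h x).

Let A := [set x | h x == None].

Definition fiber_comm (g : {perm X}) :=
  [forall x, [&& w (g x) == g (w x), h (g x) == h x & (x \in A) ==> (g x == x)]].

Definition inj_off := [forall x, forall y, (h x != None) && (h x == h y) ==> (x == y)].

Lemma hwX i x : h ((w ^+ i)%g x) = omap (s ^+ i)%g (h x).
Proof.
elim: i => [|i IHi]; first by rewrite !expg0 perm1; case: (h x) => //= y; rewrite perm1.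
by rewrite !expgSr permM hw IHi; case: (h x) => //= y; rewrite permM.
Qed.

Lemma stabs_hA : stabs w A.
Proof. by apply/forallP=> x; rewrite !inE hw; case: (h x). Qed.

Lemma fiber_commP g : reflect [/\ commutes g w, forall x, h (g x) = h x &
  forall x, x \in A -> g x = x] (fiber_comm g).
Proof.
apply: (iffP forallP) => [gP|[gw hg gA] x]; last first.
  by rewrite (eqP (forallP gw x)) hg !eqxx /=; apply/implyP => /gA->.
split; first by apply/forallP=> x; have /and3P[] := gP x.
  by move=> x; have /and3P[_ /eqP] := gP x.
by move=> x Ax; have /and3P[_ _ /implyP/(_ Ax)/eqP] := gP x.
Qed.

Lemma fiber_comm1 : fiber_comm 1%g.
Proof.
by apply/fiber_commP; split=> [|x|x _]; rewrite ?perm1 //; apply/forallP=> x; rewrite !perm1.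
Qed.

Lemma fiber_commM g g' : fiber_comm g -> fiber_comm g' -> fiber_comm (g * g')%g.
Proof.
move=> /fiber_commP[gw hg gA] /fiber_commP[g'w hg' g'A]; apply/fiber_commP; split.
- by apply/forallP=> x; rewrite !permM (eqP (forallP g'w _)) (eqP (forallP gw _)).
- by move=> x; rewrite permM hg' hg.
- by move=> x Ax; rewrite permM gA ?g'A.
Qed.

Lemma fiber_commV g : fiber_comm g -> fiber_comm g^-1%g.
Proof.
move=> /fiber_commP[gw hg gA]; apply/fiber_commP; split.
- apply/forallP=> x; apply/eqP/(@perm_inj _ g).
  by rewrite permKV -(eqP (forallP gw _)) permKV.
- by move=> x; rewrite -hg permKV.
- by move=> x Ax; rewrite -{1}[x]gA // permK.
Qed.

Lemma fiber_commMr g g' : fiber_comm g' -> fiber_comm (g * g')%g = fiber_comm g.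
Proof.
move=> Gg'; apply/idP/idP => Gg; last exact: fiber_commM.
by rewrite -[g](mulgK g') fiber_commM ?fiber_commV.
Qed.

Lemma fiber_commX g i : fiber_comm g -> fiber_comm (g ^+ i)%g.
Proof.
move=> Gg; elim: i => [|i IHi]; first by rewrite expg0 fiber_comm1.
by rewrite expgS fiber_commM.
Qed.

Lemma stabs_fiber_comm g : fiber_comm g -> stabs g A.
Proof. by case/fiber_commP=> _ hg _; apply/forallP=> x; rewrite !inE hg. Qed.

Let tau g := induced w A g.

Lemma tauE g : fiber_comm g -> forall x, omap (tau g) (quo w A x) = quo w A (g x).
Proof.
move=> Gg; apply: inducedP; last exact: stabs_fiber_comm.
by rewrite commutes_sym; case/fiber_commP: Gg.
Qed.

Lemma tau_uniq g (u : {perm 'I_(ncyc w A)}) : fiber_comm g ->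
  (forall x, omap u (quo w A x) = quo w A (g x)) -> u = tau g.
Proof.
move=> Gg; have gw : commutes w g by rewrite commutes_sym; case/fiber_commP: Gg.
exact: (induced_uniq gw (stabs_fiber_comm Gg)).
Qed.

Lemma quo_porbit x y : y \in porbit w x -> quo w A y = quo w A x.
Proof.
case/porbitP=> i ->; have wiA : ((w ^+ i)%g x \in A) = (x \in A) by rewrite stabsX ?stabs_hA.
have [Ax|Ax] := boolP (x \in A).
  by transitivity (@None 'I_(ncyc w A)); apply/eqP; rewrite ?[None == _]eq_sym quo_eq_None ?wiA.
by apply/eqP; rewrite eq_sym quo_eq ?wiA ?mem_porbit.
Qed.

Lemma sign_porbits_induced g : fiber_comm g ->
  (-1) ^+ #|porbits (induced g A w)| = (-1) ^+ ncyc w A * (-1) ^+ tau g :> F.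
Proof.
move=> Gg; have [gw _ _] := fiber_commP _ Gg.
rewrite card_porbits_induced ?stabs_hA ?stabs_fiber_comm //.
rewrite -[LHS]signr_odd -[X in X * _]signr_odd -signr_addb; congr (_ ^+ (_ : bool)).
by rewrite /odd_perm -/(tau g) card_ord addbA addbb.
Qed.

(** Here [h] is not injective on the [w]-orbit of [x]. Its rotation [z] by [w ^+ l0] preserves the
    fibres and leaves [tau] unchanged, while the weights along the translates by powers of [z] sum
    to zero. *)
Lemma sum_fiber_comm_twist x v : h x = Some v -> ~~ (#|porbit w x| %| #|porbit s v|)%N ->
  \sum_(g | fiber_comm g) (-1) ^+ tau g * twist g w = 0.
Proof.
set d := #|porbit w x|; set l0 := #|porbit s v| => hx ndvd.
have hwx i : h ((w ^+ i)%g x) = Some ((s ^+ i)%g v) by rewrite hwX hx.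
have l0P i : (h ((w ^+ i)%g x) == h x) = (l0 %| i)%N.
  by rewrite hwx hx -porbit_dvd_expg.
have l0d : (l0 %| d)%N by rewrite -l0P permX iter_porbit.
have l0_lt : (l0 < d)%N.
  rewrite ltn_neqAle dvdn_leq ?lt0n ?card_porbit_neq0 // andbT.
  by apply: contraNneq ndvd => ->.
pose zf y := if y \in porbit w x then (w ^+ l0)%g y else y.
have CwX i y : ((w ^+ i)%g y \in porbit w x) = (y \in porbit w x).
  by rewrite -!eq_porbit_mem porbit_perm.
have zf_inj : injective zf.
  move=> y y'; rewrite /zf; case: ifP => Cy; case: ifP => Cy' //.
  - by move/perm_inj.
  - by move=> eq_y; rewrite -eq_y CwX Cy in Cy'.
  - by move=> eq_y; rewrite eq_y CwX Cy' in Cy.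
pose z := perm zf_inj; have zE y : z y = zf y by rewrite permE.
have Gz : fiber_comm z.
  apply/fiber_commP; split.
  - apply/forallP=> y; rewrite !zE /zf (CwX 1%N); case: ifP => // _.
    by rewrite -!permM -expgS -expgSr.
  - move=> y; rewrite zE /zf; case: ifP => // /porbitP[i ->].
    by rewrite -permM -expgD !hwx addnC expgD permM;
       have /eqP -> : (s ^+ l0)%g v == v by rewrite porbit_dvd_expg.
  - move=> y; rewrite inE zE /zf => /eqP hy; case: ifP => // /porbitP[i Dy].
    by rewrite Dy hwx in hy.
have tauz g j : fiber_comm g -> tau (g * z ^+ j)%g = tau g.
  move=> Gg; apply/esym/tau_uniq; first by rewrite fiber_commM ?fiber_commX.
  move=> y; rewrite tauE // permM; apply/esym/quo_porbit.
  elim: j => [|j IHj]; first by rewrite expg0 perm1 porbit_id.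
  rewrite expgSr permM zE /zf; case: ifP => // _.
  by rewrite -eq_porbit_mem porbit_perm eq_porbit_mem.
have N_gt0 : (0 < d %/ l0)%N.
  by rewrite divn_gt0 ?(ltnW l0_lt) // lt0n card_porbit_neq0.
apply: (sum_coset_eq0 N_gt0 (z := z)) => [j g|j g Gg|g Gg].
- exact/fiber_commMr/fiber_commX.
- by rewrite (tauz g j Gg).
have [gw hg _] := fiber_commP _ Gg.
apply: (sum_twist xi_prim M_dvd gw l0d l0_lt zE) => a b eq_ab.
rewrite -l0P -eq_ab; apply/eqP; elim: a {eq_ab} => [|a IHa]; first by rewrite expg0 perm1.
by rewrite expgSr permM hg IHa.
Qed.

(* Multiplication by the involution k exchanging the w-orbits of x and y along
   the fibres of h reverses the sign. *)
Lemma sum_fiber_comm_swap x y v : h x = Some v -> h y = Some v -> x != y ->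
    (forall u v', h u = Some v' -> (#|porbit w u| %| #|porbit s v'|)%N) ->
  \sum_(g | fiber_comm g) (-1) ^+ tau g * twist g w = 0.
Proof.
move=> hx hy neq_xy free.
have injw u u' : h u != None -> u' \in porbit w u -> h u' = h u -> u' = u.
  case hu: (h u) => [v'|] // _ /porbitP[i ->]; rewrite hwX hu /= => -[/eqP].
  rewrite porbit_dvd_expg => dvd_i; apply/eqP; rewrite porbit_dvd_expg.
  exact: dvdn_trans (free _ _ hu) dvd_i.
have hC u : u \in porbit w x -> h u != None by case/porbitP=> i ->; rewrite hwX hx.
have hC' u : u \in porbit w y -> h u != None by case/porbitP=> i ->; rewrite hwX hy.
have injC u0 u u' : u \in porbit w u0 -> u' \in porbit w u0 -> h u != None ->
    h u = h u' -> u = u'.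
  move=> Cu Cu' hu eq_h; apply/esym/injw => //.
  by rewrite -eq_porbit_mem (eqP (etrans (eq_porbit_mem _ _ _) Cu')) eq_sym eq_porbit_mem.
have disj u : u \in porbit w x -> u \notin porbit w y.
  move=> Cu; apply/negP=> Cu'; case/eqP: neq_xy; apply: (injC x).
  - exact: porbit_id.
  - rewrite porbit_sym -eq_porbit_mem; apply/eqP.
    rewrite -(eqP (etrans (eq_porbit_mem _ _ _) Cu)).
    by rewrite (eqP (etrans (eq_porbit_mem _ _ _) Cu')).
  - by rewrite hx.
  - by rewrite hx hy.
pose part u0 u := odflt u [pick u' in porbit w u0 | h u' == h u].
have partP u0 u1 u : h u0 = h u1 -> u \in porbit w u1 ->
    part u0 u \in porbit w u0 /\ h (part u0 u) = h u.
  move=> eq_h /porbitP[i Du]; rewrite /part; case: pickP => [u' /andP[Cu' /eqP]|] //=.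
  by move/(_ ((w ^+ i)%g u0)); rewrite mem_porbit Du !hwX eq_h eqxx.
have hxy : h x = h y by rewrite hx.
pose kf u := if u \in porbit w x then part y u else if u \in porbit w y then part x u else u.
have kfx u : u \in porbit w x -> kf u \in porbit w y /\ h (kf u) = h u.
  by move=> Cu; rewrite /kf Cu; apply: (partP y x).
have kfy u : u \in porbit w y -> kf u \in porbit w x /\ h (kf u) = h u.
  move=> Cu; rewrite /kf ifN; last by apply/negP=> /disj; rewrite Cu.
  by rewrite Cu; apply: (partP x y).
have kf_out u : u \notin porbit w x -> u \notin porbit w y -> kf u = u.
  by move=> /negPf nx /negPf ny; rewrite /kf nx ny.
have kfK : involutive kf.
  move=> u; have [Cu|nCu] := boolP (u \in porbit w x).
    have [Cku hku] := kfx u Cu; have [Ckku hkku] := kfy _ Cku.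
    by apply: (injC x) => //; rewrite ?hkku ?hku //; exact: hC.
  have [Cu|nCu'] := boolP (u \in porbit w y); last by rewrite !kf_out.
  have [Cku hku] := kfy u Cu; have [Ckku hkku] := kfx _ Cku.
  by apply: (injC y) => //; rewrite ?hkku ?hku //; exact: hC'.
pose k := perm (inv_inj kfK); have kE u : k u = kf u by rewrite permE.
have Cw u0 u : (w u \in porbit w u0) = (u \in porbit w u0).
  by rewrite -!eq_porbit_mem (porbit_perm w 1).
have hk u : h (k u) = h u.
  rewrite kE; have [/kfx[]//|nCu] := boolP (u \in porbit w x).
  by have [/kfy[]//|nCu'] := boolP (u \in porbit w y); rewrite kf_out.
have Gk : fiber_comm k.
  apply/fiber_commP; split=> // [|u].
    apply/forallP=> u; apply/eqP; have eq_h : h (w (k u)) = h (k (w u)) by rewrite hk !hw hk.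
    rewrite !kE in eq_h *; have [Cu|nCu] := boolP (u \in porbit w x).
      have [Cku _] := kfx u Cu; have [Ckwu _] := kfx (w u) (etrans (Cw _ _) Cu).
      by apply: (injC y) => //; rewrite ?Cw //; apply: hC'; rewrite Cw.
    have [Cu|nCu'] := boolP (u \in porbit w y); last by rewrite !kf_out ?Cw.
    have [Cku _] := kfy u Cu; have [Ckwu _] := kfy (w u) (etrans (Cw _ _) Cu).
    by apply: (injC x) => //; rewrite ?Cw //; apply: hC; rewrite Cw.
  rewrite inE kE => hu; apply: kf_out; apply/negP.
    by move/hC; rewrite hu.
  by move/hC'; rewrite hu.
have xA : x \notin A by rewrite inE hx.
have yA : y \notin A by rewrite inE hy.
have [i Di _] := quo_val w xA; have [j Dj _] := quo_val w yA.
have neq_ij : i != j.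
  apply/eqP=> eq_ij; have := quo_eq w xA yA; rewrite Di Dj eq_ij eqxx.
  by move/esym/disj; rewrite porbit_id.
have quo_k u : omap (tperm i j) (quo w A u) = quo w A (k u).
  have quoC u0 u' : u' \in porbit w u0 -> quo w A u' = quo w A u0 by exact: quo_porbit.
  rewrite kE; have [Cu|nCu] := boolP (u \in porbit w x).
    by rewrite (quoC _ _ Cu) Di /= tpermL -Dj; apply/esym/quoC; case: (kfx u Cu).
  have [Cu|nCu'] := boolP (u \in porbit w y).
    by rewrite (quoC _ _ Cu) Dj /= tpermR -Di; apply/esym/quoC; case: (kfy u Cu).
  rewrite kf_out //; have [Au|Au] := boolP (u \in A).
    by have /eqP -> : quo w A u == None by rewrite quo_eq_None.
  have [l Dl _] := quo_val w Au; rewrite Dl /= tpermD //; apply/eqP=> eq_l.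
    by have := quo_eq w xA Au; rewrite Di Dl eq_l eqxx (negPf nCu).
  by have := quo_eq w yA Au; rewrite Dj Dl eq_l eqxx (negPf nCu').
apply: (sum_swap_eq0 (k := k)) => [g|g Gg]; first exact: fiber_commMr.
(* By [free], [h] is injective on each [w]-orbit outside [A], and [g'] is the identity on [A]; so
   [twist_free] applies and only the sign is left. *)
have twist1 g' : fiber_comm g' -> twist g' w = 1.
  case/fiber_commP=> g'w hg' g'A; apply: (twist_free xi_prim M_dvd g'w) => u a b eq_u.
  have hg'X : h ((g' ^+ b)%g u) = h u.
    by elim: b {eq_u} => [|b IHb]; rewrite ?expg0 ?perm1 // expgSr permM hg' IHb.
  case hu: (h u) => [v'|]; last first.
    rewrite eq_u; elim: b {eq_u hg'X} => [|b IHb]; rewrite ?expg0 ?perm1 //.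
    by rewrite expgSr permM IHb g'A // inE hu.
  by apply: injw; rewrite ?hu ?mem_porbit // eq_u hg'X hu.
have Ggk : fiber_comm (g * k)%g by apply: fiber_commM.
have tauk : (tau g * tperm i j)%g = tau (g * k)%g.
  apply: tau_uniq => // u; rewrite permM -quo_k -tauE //.
  by case: (quo w A u) => //= l; rewrite permM.
have mul1_opp (a b p q : F) : p = 1 -> q = 1 -> a = - b -> a * p = - (b * q).
  by move=> -> -> ->; rewrite !mulr1.
apply: (mul1_opp _ _ _ _ (twist1 _ Ggk) (twist1 _ Gg)).
by rewrite -tauk odd_permM odd_tperm neq_ij addbT signrN.
Qed.

(** Non-injectivity occurs either inside one [w]-orbit, where the weights cancel, or only between
    different orbits, where the signs cancel. For [h] injective off [A], the only term is
    [g = 1]. *)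
Theorem sum_fiber_comm :
  \sum_(g | fiber_comm g) (-1) ^+ #|porbits (induced g A w)| * twist g w
    = if inj_off then (-1) ^+ ncyc w A else 0.
Proof.
rewrite (eq_bigr (fun g => (-1) ^+ ncyc w A * ((-1) ^+ tau g * twist g w))); last first.
  by move=> g Gg; rewrite sign_porbits_induced // mulrA.
rewrite -mulr_sumr; case: ifP => [injh|/negbT noninj]; last first.
  have [free|] := boolP [forall u, forall v', (h u == Some v') ==>
     (#|porbit w u| %| #|porbit s v'|)%N].
    move: noninj; rewrite negb_forall => /existsP[x].
    rewrite negb_forall => /existsP[y]; rewrite negb_imply => /andP[/andP[hx /eqP hxy] neq].
    case Dx: (h x) hx => [v|] // _.
    rewrite (sum_fiber_comm_swap Dx _ neq) ?mulr0 -?hxy //.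
    move=> u v' hu; have /forallP/(_ u)/forallP/(_ v') := free.
    by rewrite hu eqxx.
  rewrite negb_forall => /existsP[u]; rewrite negb_forall => /existsP[v'].
  rewrite negb_imply => /andP[/eqP hu ndvd].
  by rewrite (sum_fiber_comm_twist hu ndvd) mulr0.
rewrite (bigD1 1%g) ?fiber_comm1 //= big1 ?addr0 => [|g /andP[Gg neq1]]; last first.
  case/eqP: neq1; apply/permP=> x; rewrite perm1; have [_ hg gA] := fiber_commP _ Gg.
  have [/gA//|Ax] := boolP (x \in A).
  have /forallP/(_ (g x))/forallP/(_ x) := injh; rewrite hg eqxx andbT.
  by rewrite inE in Ax; rewrite Ax => /eqP.
rewrite (twist1 xi_prim) mulr1 -(tau_uniq fiber_comm1 (u := 1%g)) ?odd_perm1 ?mulr1 //.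
by move=> x; rewrite perm1; case: (quo w A x) => //= l; rewrite perm1.
Qed.

End TwistedSum.

(** * Permutations carrying one partial map to another *)

Section Fresh.

Variables (T Y : finType).
Implicit Types (f : T -> option Y) (C : {set T}).

Definition pequiv f f' : {set {perm Y}} :=
  [set s : {perm Y} | [forall a, omap s (f a) == f' a]].

Lemma pequivP f f' (s : {perm Y}) : reflect (forall a, omap s (f a) = f' a) (s \in pequiv f f').
Proof. by rewrite inE; apply: (iffP forallP) => H a; apply/eqP. Qed.

Lemma pequiv_ker f f' s : s \in pequiv f f' -> same_ker f f'.
Proof.
move/pequivP=> sP; apply/forallP=> a; rewrite -sP; apply/andP; split.
  by case: (f a).
apply/forallP=> b; rewrite -sP; case: (f a) (f b) => [x|] [y|] //=.
by rewrite !(inj_eq Some_inj) (inj_eq perm_inj).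
Qed.

(** Fresh values are taken only once, so [f] adds nothing but singleton classes to the kernel of
    [f0], and counts by [card_perm_ext] can be compared. *)
Definition fresh_on C f0 f := [/\ forall a, a \notin C -> f a = f0 a,
  forall a, a \in C -> f a != None /\ f0 a = None & forall a b, a \in C -> f a = f b -> a = b].

Lemma fresh_ker C f0 f0' f f' : fresh_on C f0 f -> fresh_on C f0' f' ->
  same_ker f0 f0' -> same_ker f f'.
Proof.
move=> [fC fN finj] [f'C f'N f'inj] /forallP ker0.
have ker_in a b : a \in C -> ((f a == f b) = (a == b)) * ((f' a == f' b) = (a == b)).
  move=> Ca; split; apply/eqP/eqP => [|->//]; [exact: finj | exact: f'inj].
apply/forallP=> a; have [Ca|Ca] := boolP (a \in C).
  have [[fa _] [f'a _]] := (fN a Ca, f'N a Ca).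
  rewrite (negPf fa) (negPf f'a) eqxx /=.
  by apply/forallP=> b; rewrite !ker_in.
have /andP[k1 /forallP k2] := ker0 a; rewrite fC // f'C // k1 /=; apply/forallP=> b.
have [Cb|Cb] := boolP (b \in C); last by rewrite fC // f'C.
by rewrite -(fC a) // -(f'C a) // [f a == _]eq_sym [f' a == _]eq_sym !ker_in.
Qed.

Lemma fresh_sub C f0 f0' f f' : fresh_on C f0 f -> fresh_on C f0' f' ->
  pequiv f f' \subset pequiv f0 f0'.
Proof.
move=> [fC fN _] [f'C f'N _]; apply/subsetP=> s /pequivP sP; apply/pequivP=> a.
have [Ca|Ca] := boolP (a \in C); first by have [[_ ->] [_ ->]] := (fN a Ca, f'N a Ca).
by rewrite -fC // -f'C.
Qed.

Lemma card_pim_ker f f' : same_ker f f' -> #|pim f| = #|pim f'|.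
Proof.
case/perm_ext=> s sP; rewrite -(card_imset _ (@perm_inj _ s)); apply: eq_card => y.
apply/imsetP/pimP => [[z /pimP[a Da] ->]|[a]]; first by exists a; rewrite -sP Da.
by rewrite -sP; case Da: (f a) => [z|] //= -[<-]; exists z => //; apply/pimP; exists a.
Qed.

Lemma same_kerxx f : same_ker f f.
Proof. by apply/forallP=> a; rewrite eqxx; apply/forallP=> c. Qed.

End Fresh.

Section Average.

Variables (X Z Y : finType) (u : {perm Z}) (w : {perm X}).

Definition glue (r : Z -> Y) (h : X -> option Y) (a : Z + X) : option Y :=
  match a with inl z => Some (r z) | inr x => h x end.

Definition glue_map (a : Z + X) : Z + X :=
  match a with inl z => inl (u^-1 z)%g | inr x => inr (w x) end.

Lemma glue_map_inj : injective glue_map.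
Proof. by move=> [z|x] [z'|x'] //= [/perm_inj->]. Qed.

(* The permutations carrying r to r \o u^-1 and h to h \o w. *)
Definition compat r h := pequiv (glue r h) (glue r h \o glue_map).

Variable r : {ffun Z -> Y}.
Let R := [set r z | z in Z].

Definition flat (h : {ffun X -> option Y}) : {ffun X -> option Y} :=
  [ffun x => if h x is Some y then if y \in R then Some y else None else None].

Definition erase (C : {set X}) (h : {ffun X -> option Y}) : {ffun X -> option Y} :=
  [ffun x => if x \in C then None else h x].

Definition total_on (C : {set X}) (h : {ffun X -> option Y}) :=
  [forall x, (x \in C) ==> (h x != None)].

Lemma compat_stable s h x : s \in compat r h ->
  (h (w x) == None) = (h x == None).
Proof. by move/pequivP/(_ (inr x)) => /= <-; case: (h x). Qed.

Lemma compat_flat s (h : {ffun X -> option Y}) x : s \in compat r h ->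
  (flat h (w x) == None) = (flat h x == None).
Proof.
move/pequivP=> sP; have /= := sP (inr x); rewrite !ffunE => <-.
case: (h x) => //= y; suff -> : (s y \in R) = (y \in R) by case: ifP.
have sR z : s (r z) = r (u^-1 z)%g by have /= [] := sP (inl z).
apply/imsetP/imsetP => [[z _ Dz]|[z _ ->]]; last by exists (u^-1 z)%g.
exists (u z) => //; apply: (@perm_inj _ s); rewrite sR permK; exact: Dz.
Qed.

Section Cycle.

Variables (b h0 : {ffun X -> option Y}) (x0 : X).
Let C := porbit w x0.
Hypotheses (bC : forall x, x \in C -> b x = None) (h0C : forall x, x \in C -> h0 x = None).
Hypotheses (flat_h0 : flat h0 = b) (inj_h0 : inj_off h0).
Hypothesis leY : (#|Z| + #|X| <= #|Y|)%N.

Definition extensions := [set h : {ffun X -> option Y} |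
  [&& erase C h == h0, flat h == b, inj_off h & total_on C h]].

Let CT : {set Z + X} := [set a | if a is inr x then x \in C else false].

Lemma extension_fresh h : h \in extensions -> fresh_on CT (glue r h0) (glue r h).
Proof.
rewrite inE => /and4P[/eqP eh /eqP fh ih /forallP th].
have hC x : x \notin C -> h x = h0 x by move=> nCx; rewrite -eh ffunE (negPf nCx).
split=> [[z|x]|[z|x]|[z|x] a]; rewrite ?inE //=; first exact: hC.
  by move=> Cx; rewrite h0C // (implyP (th x)).
move=> Cx; have := implyP (th x) Cx; case Dx: (h x) => [y|] // _.
case: a => [z|x'] /= Da; last first.
  have /forallP/(_ x)/forallP/(_ x') := ih; rewrite Dx -Da eqxx /= => /eqP->.
  by [].
have := congr1 (fun f : {ffun X -> option Y} => f x) fh; rewrite ffunE Dx bC //.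
by case: Da => ->; rewrite imset_f.
Qed.

Lemma extension_fresh_move h : h \in extensions ->
  fresh_on CT (glue r h0 \o glue_map) (glue r h \o glue_map).
Proof.
move/extension_fresh=> [fC fN finj].
have mvC a : (glue_map a \in CT) = (a \in CT).
  by case: a => [z|x]; rewrite !inE //= -!eq_porbit_mem (porbit_perm w 1).
split=> [a Ca|a Ca|a c Ca eq_ac] /=; first by rewrite fC ?mvC.
  by apply: fN; rewrite mvC.
by apply/glue_map_inj/finj; rewrite ?mvC.
Qed.

Lemma extension_exists : exists h, h \in extensions.
Proof.
pose S := pim (glue r h0).
(* Room for fresh values: at most [#|Z| + #|~: C|] values are already taken. *)
have leS : (#|C| <= #|~: S|)%N.
  have : (#|S| <= #|Z| + #|~: C|)%N.
    pose im (a : Z + X) := match a with inl z => Some (r z) | inr x => h0 x end.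
    have sub : S \subset R :|: [set y | [exists x in ~: C, h0 x == Some y]].
      apply/subsetP=> y /pimP[[z|x] /= Dy]; rewrite inE.
        by case: Dy => <-; rewrite imset_f.
      apply/orP; right; rewrite inE; apply/existsP; exists x; rewrite Dy eqxx andbT inE.
      by apply/negP=> /h0C; rewrite Dy.
    apply: leq_trans (subset_leq_card sub) (leq_trans (leq_card_setU _ _) _).
    apply: leq_add; first exact: leq_imset_card.
    rewrite -(card_imset _ (@Some_inj _)).
    apply: leq_trans (leq_imset_card h0 (~: C)).
    apply/subset_leq_card/subsetP=> _ /imsetP[y + ->].
    by rewrite inE => /existsP[x /andP[xC /eqP <-]]; rewrite imset_f.
  move=> leS; rewrite -(leq_add2l #|S|) cardsC; apply: leq_trans leY.
  by rewrite -(cardsC C) (addnC #|C|) addnA leq_add2r.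
have [y0 Sy0] : exists y0, y0 \in ~: S.
  apply/set0Pn; rewrite -card_gt0; apply: leq_trans leS.
  by rewrite lt0n card_porbit_neq0.
pose ext x := nth y0 (enum (~: S)) (index x (enum C)).
have idx_lt x : x \in C -> (index x (enum C) < size (enum (~: S)))%N.
  move=> Cx; rewrite -cardE; apply: leq_trans leS.
  by rewrite cardE index_mem mem_enum.
have extS x : x \in C -> ext x \notin S.
  by move=> Cx; rewrite -in_setC -mem_enum mem_nth ?idx_lt.
have ext_inj x x' : x \in C -> x' \in C -> ext x = ext x' -> x = x'.
  move=> Cx Cx' /eqP; rewrite nth_uniq ?enum_uniq ?idx_lt // => /eqP eq_i.
  by rewrite -(nth_index x0 (s := enum C) (x := x)) ?mem_enum // eq_i nth_index ?mem_enum.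
have notS x x' : x \in C -> h0 x' <> Some (ext x).
  by move=> Cx h0x'; case/negP: (extS x Cx); apply/pimP; exists (inr x').
exists [ffun x => if x \in C then Some (ext x) else h0 x].
rewrite inE; apply/and4P; split.
- by apply/eqP/ffunP=> x; rewrite !ffunE; case: (boolP (x \in C)) => // Cx; rewrite h0C.
- apply/eqP/ffunP=> x; rewrite ffunE ffunE; case: ifP => Cx; last first.
    by have := congr1 (fun f : {ffun X -> option Y} => f x) flat_h0; rewrite ffunE.
  rewrite bC // ifN //; apply: contra (extS x Cx) => /imsetP[z _ ->].
  by apply/pimP; exists (inl z).
- apply/forallP=> x; apply/forallP=> x'; rewrite !ffunE; apply/implyP.
  case: ifP => Cx; case: ifP => Cx' /andP[nN /eqP].
  + by move=> [/ext_inj ->].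
  + by move/esym/notS=> /(_ Cx).
  + by move/notS=> /(_ Cx').
  + by move=> eqx; have /forallP/(_ x)/forallP/(_ x') := inj_h0; rewrite nN eqx eqxx.
- by apply/forallP=> x; apply/implyP=> Cx; rewrite ffunE Cx.
Qed.

(** The permutations fixing [glue r h0] are sorted by the extension to which they carry [h1]. By
    [card_perm_ext] each class is as large as the matching [compat r h], and their union as large as
    [compat r h0] unless that set is empty. *)
Lemma sum_extensions : (\sum_(h in extensions) #|compat r h| = #|compat r h0|)%N.
Proof.
have [h1 Eh1] := extension_exists; have fr1 := extension_fresh Eh1.
have [e0|[s s0]] := set_0Vmem (compat r h0).
  rewrite e0 cards0 big1 // => h Eh; apply/eqP; rewrite cards_eq0 -subset0 -e0.
  exact: (fresh_sub (extension_fresh Eh) (extension_fresh_move Eh)).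
have ker0 := pequiv_ker s0; set f0 := glue r h0 in fr1 ker0.
transitivity (\sum_(h in extensions) #|pequiv (glue r h1) (glue r h)|)%N.
  apply: eq_bigr => h Eh; have fr := extension_fresh Eh.
  have ker1 := fresh_ker fr1 fr (same_kerxx f0).
  rewrite /compat /pequiv (card_perm_ext (fresh_ker fr (extension_fresh_move Eh) ker0)).
  by rewrite (card_perm_ext ker1) (card_pim_ker ker1).
transitivity #|pequiv f0 f0|; last first.
  by rewrite /compat /pequiv (card_perm_ext (same_kerxx f0)) (card_perm_ext ker0).
pose hs (s : {perm Y}) : {ffun X -> option Y} := [ffun x => omap s (h1 x)].
have hsE s1 : s1 \in pequiv f0 f0 -> hs s1 \in extensions.
  move/pequivP=> s1P; move: (Eh1); rewrite !inE => /and4P[/eqP eh /eqP fh ih th].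
  have sR y : (s1 y \in R) = (y \in R).
    have sr z : s1 (r z) = r z by have /= [] := s1P (inl z).
    apply/imsetP/imsetP => -[z _ Dz]; exists z => //; last by rewrite Dz sr.
    by apply: (@perm_inj _ s1); rewrite Dz sr.
  apply/and4P; split.
  - apply/eqP/ffunP=> x; rewrite !ffunE; case: ifP => Cx; first by rewrite h0C.
    have e1 : h1 x = h0 x by rewrite -eh ffunE Cx.
    by rewrite e1; have /= := s1P (inr x).
  - apply/eqP/ffunP=> x; rewrite !ffunE; have := congr1 (fun f : {ffun X -> option Y} => f x) fh.
    rewrite ffunE => <-; case Dx: (h1 x) => [y|] //=; rewrite sR; case: ifP => // /imsetP[z _ ->].
    by have /= [->] := s1P (inl z).
  - apply/forallP=> x; apply/forallP=> x'; rewrite !ffunE.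
    have /forallP/(_ x)/forallP/(_ x') := ih.
    case: (h1 x) (h1 x') => [y|] [y'|] //=.
    by rewrite !(inj_eq Some_inj) (inj_eq perm_inj).
  - apply/forallP=> x; rewrite ffunE; have /forallP/(_ x) := th.
    by case: (h1 x).
rewrite -[RHS]sum1_card (partition_big hs (mem extensions)) //=.
apply: eq_bigr => h Eh; rewrite -sum1_card; apply: eq_bigl => s1.
have fr := extension_fresh Eh; apply/idP/andP => [s1P|[/pequivP s1P /eqP Dh]].
  split; first exact: (subsetP (fresh_sub fr1 fr)).
  by apply/eqP/ffunP=> x; rewrite ffunE; have /= := pequivP _ _ _ s1P (inr x).
apply/pequivP=> -[z|x] /=; first by have /= := s1P (inl z).
by rewrite -Dh ffunE.
Qed.

End Cycle.
Hypothesis leY : (#|Z| + #|X| <= #|Y|)%N.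
Variable F : numFieldType.

Definition osign (h : {ffun X -> option Y}) : F := (-1) ^+ ncyc w [set x | h x == None].

(* The w-orbit C of x0 may be mapped to fresh values or to None: by
   sum_extensions the total weight is the same, but the signs are opposite. *)
Lemma sum_flat_eq0 (b : {ffun X -> option Y}) x0 : b x0 = None ->
  \sum_(h : {ffun X -> option Y} | inj_off h && (flat h == b)) osign h * #|compat r h|%:R = 0.
Proof.
move=> bx0; set C := porbit w x0.
have [bC|] := boolP [forall x, (x \in C) ==> (b x == None)]; last first.
  rewrite negb_forall => /existsP[x]; rewrite negb_imply => /andP[/porbitP[i ->] bi].
  rewrite big1 // => h /andP[_ /eqP fh]; have [->|[s sP]] := set_0Vmem (compat r h).
    by rewrite cards0 mulr0.
  case/eqP: bi; elim: i => [|i IHi]; first by rewrite expg0 perm1.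
  by apply/eqP; rewrite expgSr permM -fh (compat_flat _ sP) fh IHi.
have {}bC x : x \in C -> b x = None by move=> Cx; apply/eqP/(implyP (forallP bC x)).
rewrite (partition_big (erase C) predT) //= big1 // => h0 _.
have [/and3P[/eqP flat_h0 inj_h0 /eqP er_h0]|invalid] :=
    boolP [&& flat h0 == b, inj_off h0 & erase C h0 == h0]; last first.
  rewrite big_pred0 // => h; apply: contraNF invalid => /andP[/andP[ih /eqP fh] /eqP <-].
  apply/and3P; split.
  - apply/eqP/ffunP=> x; rewrite !ffunE; case: (boolP (x \in C)) => [/bC->//|_].
    by rewrite -fh ffunE.
  - apply/forallP=> x; apply/forallP=> x'; rewrite !ffunE; apply/implyP.
    case: ifP => // _; case: ifP => _ /andP[nN /eqP eqx]; first by rewrite eqx in nN.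
    by have /forallP/(_ x)/forallP/(_ x') := ih; rewrite nN eqx eqxx.
  - by apply/eqP/ffunP=> x; rewrite !ffunE; case: (x \in C).
have h0C x : x \in C -> h0 x = None by move=> Cx; rewrite -er_h0 ffunE Cx.
rewrite (bigID (total_on C)) /=.
rewrite (eq_bigl [in extensions b h0 x0]) => [|h]; last first.
  by rewrite inE -/C; case: (inj_off h); case: (flat h == b); rewrite ?andbF.
have sgnE h : h \in extensions b h0 x0 -> osign h = - osign h0.
  rewrite inE -/C => /and4P[/eqP eh _ _ /forallP th].
  rewrite /osign /ncyc (_ : cyc_off w _ = C |: cyc_off w [set x | h0 x == None]).
    have nC : C \notin cyc_off w [set x | h0 x == None].
      apply/imsetP=> -[x]; rewrite !inE => hx eqC; case/eqP: hx; apply: h0C.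
      by rewrite -/C eqC porbit_id.
    by rewrite cardsU1 nC exprS mulN1r.
  apply/setP=> S; rewrite in_setU1; apply/imsetP/predU1P => [[x]|[->|/imsetP[x]]].
  - rewrite !inE => hx ->; have [Cx|Cx] := boolP (x \in C).
      by left; apply/eqP; rewrite eq_porbit_mem.
    by right; apply: imset_f; rewrite !inE -eh ffunE (negPf Cx).
  - by exists x0; rewrite // !inE (implyP (th x0)) // porbit_id.
  - rewrite !inE => h0x ->; exists x; rewrite // !inE.
    by apply: contraNneq h0x => hx; rewrite -eh ffunE hx if_same.
rewrite (eq_bigr (fun h : {ffun X -> option Y} => - osign h0 * #|compat r h|%:R));
  last by move=> h /sgnE->.
rewrite -mulr_sumr -natr_sum (sum_extensions bC h0C flat_h0 inj_h0 leY).
rewrite (bigD1 h0) /=; last first.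
  rewrite inj_h0 flat_h0 er_h0 !eqxx /=; apply/negP=> /forallP/(_ x0).
  by rewrite porbit_id h0C ?porbit_id.
rewrite big1 => [|h]; first by rewrite addr0 mulNr addNr.
case/andP=> /andP[/andP[_ /eqP eh] ntot] neq.
have [->|[s sP]] := set_0Vmem (compat r h); first by rewrite cards0 mulr0.
case/eqP: neq; rewrite -eh; apply/ffunP=> x; rewrite ffunE; case: ifP => // Cx.
move: ntot; rewrite negb_forall => /existsP[y]; rewrite negb_imply negbK => /andP[Cy /eqP hy].
have /porbitP[i ->] : x \in porbit w y.
  by rewrite -eq_porbit_mem (eqP (etrans (eq_porbit_mem _ _ _) Cx)) eq_sym eq_porbit_mem.
apply/eqP; elim: i => [|i IHi]; first by rewrite expg0 perm1 hy.
by rewrite expgSr permM (compat_stable _ sP).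
Qed.

(** A surviving [h] is defined everywhere, so that [osign] counts all cycles of [w] and is
    constant. *)
Lemma sum_compat :
  \sum_(h : {ffun X -> option Y} | inj_off h) osign h * #|compat r h|%:R =
  (-1) ^+ #|porbits w| *
    (\sum_(h : {ffun X -> option Y} | [&& inj_off h, flat h == h & [forall x, h x != None]])
       #|compat r h|)%:R.
Proof.
rewrite (partition_big flat predT) //= natr_sum mulr_sumr.
rewrite [RHS]big_mkcond; apply: eq_bigr => b _.
have [tot|] := boolP [forall x, b x != None]; last first.
  rewrite negb_forall => /existsP[x]; rewrite negbK => /eqP bx.
  by rewrite (sum_flat_eq0 bx) !andbF.
have flatb h : flat h = b -> h = b.
  move=> fh; apply/ffunP=> x; have := forallP tot x.
  by rewrite -fh ffunE; case: (h x) => [y|] //; case: ifP.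
rewrite andbT; case: ifP => [/andP[ib /eqP fb]|invalid]; last first.
  rewrite big_pred0 // => h; apply/negbTE; apply: contraFN invalid => /andP[ih /eqP fh].
  by have eqh := flatb h fh; rewrite -eqh ih fh eqh eqxx.
rewrite (big_pred1 b) => [|h] /=.
  congr (_ * _); rewrite /osign /ncyc; congr (_ ^+ _).
  rewrite /cyc_off (_ : [set x | b x == None] = set0) ?setC0.
    by apply: eq_card => S; apply/imsetP/imsetP => -[x _ ->]; exists x.
  by apply/setP=> x; rewrite !inE (negPf (forallP tot x)).
apply/andP/eqP => [[_ /eqP/flatb]//|->].
by rewrite ib fb.
Qed.

End Average.

(** * The functional attached to [w] and its values on averages of traces *)

Section Dual.

Variables (X : finType) (F : numFieldType) (xi : F) (M : nat).
Hypotheses (xi_prim : M.-primitive_root xi).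
Hypothesis M_dvd : forall c, (0 < c <= #|X|)%N -> (c %| M)%N.
Implicit Types (g w : {perm X}) (A : {set X}).

Definition admits w g A :=
  [&& commutes g w, stabs w A & [forall x, (x \in A) ==> (g x == x)]].

Definition dform w (phi : forall m, 'S_m -> F) : F :=
  \sum_(g : {perm X}) \sum_(A : {set X} | admits w g A)
    (-1) ^+ #|porbits (induced g A w)| * @twist X F xi M g w * phi _ (induced g A w).

(** By [fixc_induced] the terms become equivariant partial maps [h], with [A] the set where [h] is
    [None]; for fixed [h] the sum over [g] is [sum_fiber_comm]. *)
Lemma dform_fixc (Y : finType) w (s : {perm Y}) :
  dform w (fun m v => (fixc v s)%:R)
    = \sum_(h : {ffun X -> option Y} | [forall x, h (w x) == omap s (h x)])
        (if inj_off h then osign w F h else 0).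
Proof.
rewrite /dform.
transitivity (\sum_(g : {perm X}) \sum_(A : {set X}) \sum_(h : {ffun X -> option Y} |
    [forall x, h (w x) == omap s (h x)] && (fiber_comm h w g && (A == [set x | h x == None])))
    (-1) ^+ #|porbits (induced g A w)| * @twist X F xi M g w).
  apply: eq_bigr => g _; rewrite big_mkcond; apply: eq_bigr => A _.
  case: ifP => [/and3P[gw wA /forallP gA]|notadm].
    have gsA : stabs g A.
      apply/forallP=> x; apply/eqP; apply/idP/idP => [Agx|Ax]; last by rewrite (eqP (implyP (gA x) Ax)).
      by have /eqP/perm_inj := implyP (gA _) Agx => ggx; rewrite ggx in Agx.
    rewrite fixc_induced //; set B := [set h : {ffun _} | _].
    rewrite -[#|B|]sum1_card natr_sum mulr_sumr.
    apply: eq_big => [h|h _]; last by rewrite mulr1.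
    rewrite inE; apply/forallP/and3P => [hP|[/forallP hw /fiber_commP[_ hg _] /eqP->] x].
      have hN x : (h x == None) = (x \in A) by have /and3P[/eqP] := hP x.
      split; first by apply/forallP=> x; have /and3P[] := hP x.
        apply/fiber_commP; split=> // x; first by have /and3P[_ /eqP] := hP x.
        by rewrite inE hN => Ax; apply/eqP/(implyP (gA x)).
      by apply/eqP/setP=> x; rewrite inE hN.
    by rewrite inE hg hw !eqxx.
  rewrite big_pred0 // => h; apply: contraFF notadm => /and3P[/forallP hw /fiber_commP[gw _ gA] /eqP->].
  have hwE x : h (w x) = omap s (h x) by apply/eqP.
  rewrite /admits gw (stabs_hA hwE) /=; apply/forallP=> x; apply/implyP=> Ax.
  by rewrite gA.
rewrite (eq_bigr (fun g : {perm X} => \sum_(h : {ffun X -> option Y} |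
    [forall x, h (w x) == omap s (h x)]) \sum_(A : {set X} |
    fiber_comm h w g && (A == [set x | h x == None]))
    (-1) ^+ #|porbits (induced g A w)| * @twist X F xi M g w)) => [|g _]; last first.
  rewrite (exchange_big_dep (fun h : {ffun X -> option Y} =>
    [forall x, h (w x) == omap s (h x)])) => [|A h _ /andP[]//].
  by apply: eq_bigr => h hw; apply: eq_bigl => A; rewrite hw.
rewrite exchange_big /=; apply: eq_bigr => h /forallP hw.
have hwE x : h (w x) = omap s (h x) by apply/eqP.
rewrite /osign -(sum_fiber_comm xi_prim M_dvd hwE) [RHS]big_mkcond.
apply: eq_bigr => g _; case: ifP => Gg; last first.
  by rewrite big_pred0.
by rewrite (big_pred1 [set x | h x == None]).
Qed.

Lemma sum_fixc_dform (Z Y : finType) (u : {perm Z}) w :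
  \sum_(s : {perm Y}) (fixc u s^-1%g)%:R * dform w (fun m v => (fixc v s)%:R)
  = \sum_(r : {ffun Z -> Y}) \sum_(h : {ffun X -> option Y} | inj_off h)
       osign w F h * #|compat u w r h|%:R.
Proof.
transitivity (\sum_(s : {perm Y}) \sum_(r : {ffun Z -> Y}) \sum_(h : {ffun X -> option Y} | inj_off h)
   (s \in compat u w r h)%:R * osign w F h).
  apply: eq_bigr => s _; rewrite dform_fixc -big_mkcondr /fixc -sum1_card natr_sum.
  rewrite [X in X * _]big_mkcond mulr_suml /=; apply: eq_bigr => r _.
  case: ifP => [|/negbT]; rewrite inE => rP.
    rewrite mul1r big_mkcondl; apply: eq_bigr => h _; case: ifP => [/forallP hw|/negbT].
      suff -> : s \in compat u w r h by rewrite mul1r.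
      apply/pequivP=> -[z|x] /=; last by rewrite (eqP (hw x)).
      by rewrite -{1}(permKV u z) (eqP (forallP rP _)) permKV.
    rewrite negb_forall => /existsP[x neq]; case: (boolP (_ \in _)) => [/pequivP/(_ (inr x)) /=|].
      by move=> eqh; rewrite -eqh eqxx in neq.
    by rewrite mul0r.
  rewrite mul0r big1 // => h _; case: (boolP (_ \in _)) => [/pequivP sP|]; last by rewrite mul0r.
  case/negP: rP; apply/forallP=> z; apply/eqP/(@perm_inj _ s).
  by rewrite permKV; have /= [->] := sP (inl (u z)); rewrite permK.
rewrite exchange_big /=; apply: eq_bigr => r _; rewrite exchange_big /=.
apply: eq_bigr => h _; rewrite -mulr_suml mulrC; congr (_ * _).
by rewrite -natr_sum -sum1_card [in RHS]big_mkcond.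
Qed.

(** A surviving [h] would inject [X] into the image of [r], which has at most [#|Z|] elements. *)
Lemma sum_fixc_dform0 (Z Y : finType) (u : {perm Z}) w :
    (#|Z| < #|X|)%N -> (#|X| + #|X| <= #|Y|)%N ->
  \sum_(s : {perm Y}) (fixc u s^-1%g)%:R * dform w (fun m v => (fixc v s)%:R) = 0.
Proof.
move=> ltZX leY; rewrite sum_fixc_dform big1 // => r _.
have leZY : (#|Z| + #|X| <= #|Y|)%N by apply: leq_trans leY; rewrite leq_add2r ltnW.
rewrite sum_compat // big_pred0 ?mulr0 // => h; apply/negbTE/negP => /and3P[ih /eqP fh /forallP th].
suff : (#|X| <= #|Z|)%N by rewrite leqNgt ltZX.
have h_inj : injective h.
  by move=> x x' eqx; have /forallP/(_ x)/forallP/(_ x') := ih;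
     rewrite eqx eqxx th => /eqP.
apply: leq_trans (leq_imset_card (fun z => Some (r z)) Z).
rewrite -(card_imset _ h_inj); apply/subset_leq_card/subsetP=> _ /imsetP[x _ ->].
have := th x; rewrite -fh ffunE; case: (h x) => [y|] //; case: ifP => // /imsetP[z _ ->] _.
by rewrite imset_f.
Qed.

(** Now [r] must be injective and [h] is [r] composed with a permutation of [X]. Compatibility with
    some [s] is the conjugacy condition, and then [(#|Y| - #|X|)!] permutations [s] are compatible;
    the number of injections [r] completes this to [#|Y|!]. *)
Lemma sum_fixc_dform1 (Y : finType) (u w : {perm X}) : (#|X| + #|X| <= #|Y|)%N ->
  \sum_(s : {perm Y}) (fixc u s^-1%g)%:R * dform w (fun m v => (fixc v s)%:R)
   = (-1) ^+ #|porbits w| * (#|Y|`! * #|[set p : {perm X} | (u^-1 ^ p == w)%g]|)%:R.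
Proof.
move=> leY; rewrite sum_fixc_dform.
under eq_bigr do rewrite sum_compat //.
rewrite -mulr_sumr -natr_sum; congr (_ * _%:R).
pose N := #|[set p : {perm X} | (u^-1 ^ p == w)%g]|.
transitivity (\sum_(r : {ffun X -> Y} | injectiveb r) (#|Y| - #|X|)`! * N)%N; last first.
  rewrite sum_nat_const -[in LHS]cardsE card_inj_ffuns mulnA ffact_fact //.
  by apply: leq_trans leY; rewrite leq_addr.
rewrite [RHS]big_mkcond; apply: eq_bigr => r _; case: ifP => [/injectiveP r_inj|ninj]; last first.
  rewrite big1 // => h /and3P[ih /eqP fh /forallP th]; case/negP: (negbT ninj).
  have h_inj : injective h.
    by move=> x x' eqx; have /forallP/(_ x)/forallP/(_ x') := ih;
       rewrite eqx eqxx th => /eqP.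
  suff: (#|X| <= #|[set r z | z in X]|)%N.
    move=> le_r; apply/injectiveP => x x' eqx.
    have /imset_injP rinj : #|[set r z | z in X]| == #|X|.
      by rewrite eqn_leq leq_imset_card le_r.
    by apply: rinj.
  rewrite -(card_imset [set r z | z in X] (@Some_inj _)) -(card_imset _ h_inj).
  apply/subset_leq_card/subsetP=> _ /imsetP[x _ ->].
  have := th x; rewrite -fh ffunE; case: (h x) => [y|] //; case: ifP => // Ry _.
  by rewrite imset_f.
pose hp (p : {perm X}) : {ffun X -> option Y} := [ffun x => Some (r (p x))].
have hp_inj : injective hp.
  move=> p p' eq_h; apply/permP=> x; apply: r_inj; apply: Some_inj.
  by have := congr1 (fun f : {ffun X -> option Y} => f x) eq_h; rewrite !ffunE.
rewrite (eq_bigl [in hp @: [set: {perm X}]]) => [|h]; last first.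
  apply/and3P/imsetP => [[ih /eqP fh /forallP th]|[p _ ->]]; last first.
    split; apply/forallP=> x || apply/eqP/ffunP=> x; rewrite ?ffunE ?imset_f //.
    by apply/forallP=> x'; rewrite !ffunE /=; apply/implyP=> /eqP[/r_inj/perm_inj->].
  have : forall x, exists z, h x = Some (r z).
    move=> x; have := th x; rewrite -fh ffunE; case: (h x) => [y|] //.
    by case: ifP => // /imsetP[z _ ->] _; exists z.
  case/fin_all_exists=> q hq.
  have q_inj : injective q.
    by move=> x x' eqx; have /forallP/(_ x)/forallP/(_ x') := ih;
       rewrite !hq eqx eqxx => /eqP.
  by exists (perm q_inj) => //; apply/ffunP=> x; rewrite ffunE permE hq.
rewrite big_imset /=; last by move=> p p' _ _; apply: hp_inj.
rewrite (reindex_inj invg_inj) /= mulnC -sum_nat_const.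
transitivity (\sum_(p : {perm X} | (u^-1 ^ p == w)%g) (#|Y| - #|X|)`!)%N; last first.
  by apply: eq_bigl => p; rewrite inE.
rewrite [RHS]big_mkcond; apply: eq_big => [p|p _]; first by rewrite inE.
have condE : ((u^-1 ^ p == w)%g) = [forall x, (u^-1 (p^-1 x) == p^-1 (w x))%g].
  apply/eqP/forallP => [<- x|pP]; first by rewrite conjgE !permM permK.
  by apply/permP=> x; rewrite conjgE !permM (eqP (pP x)) permKV.
rewrite condE; case: ifP => [/forallP pP|/negbT].
  pose f (x : X) := Some (r x).
  have -> : compat u w r (hp p^-1%g) = pequiv f (f \o u^-1%g).
    apply/setP=> s; apply/pequivP/pequivP => sP; first by move=> x; apply: (sP (inl x)).
    case=> [z|x] /=; first exact: (sP z).
    by rewrite !ffunE -(eqP (pP x)); apply: (sP (p^-1 x)%g).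
  rewrite /pequiv card_perm_ext; last first.
    apply/forallP=> x; apply/forallP=> x'; rewrite !(inj_eq Some_inj) !(inj_eq r_inj).
    by rewrite (inj_eq perm_inj).
  congr (_ - _)`!; rewrite -(card_imset predT r_inj); apply: eq_card => y.
  apply/pimP/imsetP => [[x [<-]]|[x _ ->]]; by exists x.
rewrite negb_forall => /existsP[x neq]; apply/eqP; rewrite cards_eq0; apply/eqP/setP=> s.
rewrite in_set0; apply/negP=> /pequivP sP; case/eqP: neq; apply: r_inj.
have /= [e1] := sP (inl (p^-1 x)%g); have := sP (inr x); rewrite /= !ffunE /= => -[e2].
by rewrite -e1 e2.
Qed.

End Dual.

(** * The dual basis *)

Section Families.

Variables (F : numFieldType) (xi : F) (M k t : nat).
Hypotheses (xi_prim : M.-primitive_root xi).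
Hypothesis M_dvd : forall c, (0 < c <= k)%N -> (c %| M)%N.
Hypothesis le_kt : (k + k <= t)%N.

Definition fam := forall m, 'S_m -> F.
Definition class_fam (phi : fam) := forall m (s r : 'S_m), phi m (s ^ r)%g = phi m s.

(** At [u = 1] and [s = 1] this is the moment of order [n + m] of the number of fixed points of a
    random permutation, which is a Bell number if [n + m <= t]. *)
Definition bell n (u : 'S_n) : fam :=
  fun m s => (t`!)%:R^-1 * \sum_(v : 'S_t) (fixc u v^-1%g)%:R * (fixc s v)%:R.

Lemma bellC n (u : 'S_n) m (s : 'S_m) : bell u s = bell s u.
Proof.
rewrite /bell; congr (_ * _); rewrite (reindex_inj invg_inj); apply: eq_bigr => v _.
by rewrite invgK mulrC.
Qed.

Lemma bell_class n (u : 'S_n) : class_fam (bell u).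
Proof. by move=> m s r; congr (_ * _); apply: eq_bigr => v _; rewrite fixcJ. Qed.

Definition dual j (w : 'S_j) (phi : fam) : F :=
  (-1) ^+ #|porbits w| * dform xi M w phi.

Lemma dform_bell j (w : 'S_j) n (u : 'S_n) : dform xi M w (bell u) =
  (t`!)%:R^-1 * \sum_(v : 'S_t) (fixc u v^-1%g)%:R * dform xi M w (fun m s => (fixc s v)%:R).
Proof.
rewrite /dform mulr_sumr.
under [RHS]eq_bigr do rewrite !mulr_sumr.
rewrite exchange_big; apply: eq_bigr => g _ /=.
under [RHS]eq_bigr do rewrite !mulr_sumr.
rewrite exchange_big; apply: eq_bigr => A _ /=.
rewrite /bell !mulr_sumr; apply: eq_bigr => v _.
by rewrite mulrCA; congr (_ * _); rewrite mulrCA.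
Qed.

Let fact_neq0 n : (n`!)%:R != 0 :> F.
Proof. by rewrite pnatr_eq0 -lt0n fact_gt0. Qed.

Let M_dvd_ord j : (j <= k)%N -> forall c, (0 < c <= #|'I_j|)%N -> (c %| M)%N.
Proof.
by move=> le_jk c; rewrite card_ord => /andP[c_gt0 le_cj]; rewrite M_dvd // c_gt0 (leq_trans le_cj).
Qed.

Lemma dual_bell0 j (w : 'S_j) n (u : 'S_n) : (n < j <= k)%N -> dual w (bell u) = 0.
Proof.
case/andP=> lt_nj le_jk; rewrite /dual dform_bell.
rewrite (sum_fixc_dform0 xi_prim (M_dvd_ord le_jk)) ?mulr0 // !card_ord //.
by apply: leq_trans le_kt; rewrite leq_add.
Qed.

Lemma dual_bell1 j (w u : 'S_j) : (j <= k)%N ->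
  dual w (bell u) = #|[set p : 'S_j | (u^-1 ^ p == w)%g]|%:R.
Proof.
move=> le_jk; rewrite /dual dform_bell.
rewrite (sum_fixc_dform1 xi_prim (M_dvd_ord le_jk)); last first.
  by rewrite !card_ord; apply: leq_trans le_kt; rewrite leq_add.
by rewrite natrM card_ord [_^-1 * _]mulrCA signrMK mulKf.
Qed.

Lemma sum_class_conj j (phi : 'S_j -> F) (u : 'S_j) :
    (forall s r, phi (s ^ r)%g = phi s) ->
  (j`!)%:R^-1 * \sum_w phi w^-1%g * #|[set p : 'S_j | (u^-1 ^ p == w)%g]|%:R = phi u.
Proof.
move=> phiJ; transitivity ((j`!)%:R^-1 * \sum_(p : 'S_j) phi u); last first.
  by rewrite sumr_const card_Sn -(mulr_natl (phi u)) mulKf.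
congr (_ * _); transitivity (\sum_w \sum_(p : 'S_j | (u^-1 ^ p == w)%g) phi w^-1%g).
  apply: eq_bigr => w _; rewrite sumr_const mulr_natr; congr (_ *+ _).
  by apply: eq_card => p; rewrite inE.
rewrite [RHS](partition_big (fun p : 'S_j => (u^-1 ^ p)%g) predT) //=.
apply: eq_bigr => w _.
by apply: eq_bigr => p /eqP <-; rewrite conjVg invgK phiJ.
Qed.

Variable Gamma : fam -> F.
Hypothesis Gamma_sum : forall (I : finType) (c : I -> F) (phi : I -> fam),
  Gamma (fun m s => \sum_i c i * phi i m s) = \sum_i c i * Gamma (phi i).
Hypothesis Gamma_local : forall phi psi : fam,
  (forall m, (m <= k)%N -> phi m =1 psi m) -> Gamma phi = Gamma psi.
Hypothesis Gamma_bell : forall n (u : 'S_n), (n <= k)%N -> Gamma (bell u) = 0.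

(* Pairing the lowest nonzero component of phi, of degree j, with the dual
   functionals of degree j yields a combination of families bell u that agrees
   with phi up to degree j. *)
Lemma Gamma_class_eq0 (phi : fam) : class_fam phi -> Gamma phi = 0.
Proof.
have Gamma0 (psi : fam) : (forall m, (m <= k)%N -> psi m =1 fun=> 0) -> Gamma psi = 0.
  move=> psi0; have := Gamma_sum (I := 'I_0) (fun=> 0) (fun=> psi); rewrite big_ord0 => <-.
  by apply: Gamma_local => m le_mk s; rewrite psi0 // big_ord0.
(* Induction on the number [d] of degrees up to [k] in which [psi] may be nonzero. *)
suff H d psi : class_fam psi -> (forall m, (m + d <= k)%N -> psi m =1 fun=> 0) ->
    Gamma psi = 0.
  move=> phi_class; apply: (H k.+1) => // m; rewrite addnS ltnNge.
  by rewrite leq_addl.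
elim: d psi => [|d IHd] psi psi_class psi0.
  by apply: Gamma0 => m le_mk; apply: psi0; rewrite addn0.
have [lt_kd|le_dk] := ltnP k d.
  by apply: IHd => // m le_md; have := leq_trans (leq_addl m d) le_md; rewrite leqNgt lt_kd.
pose j := (k - d)%N; have le_jk : (j <= k)%N by apply: leq_subr.
(* [Gamma_sum] takes one finite index type; inadmissible triples get coefficient [0]. *)
pose I := ('S_j * 'S_j * {set 'I_j})%type.
pose c (i : I) : F := let: (w, g, A) := i in
  (j`!)%:R^-1 * (psi j w^-1%g * ((-1) ^+ #|porbits w| * (if admits w g A then
     (-1) ^+ #|porbits (induced g A w)| * @twist 'I_j F xi M g w else 0))).
pose chi (i : I) : fam := let: (w, g, A) := i in bell (induced g A w).
pose Psi : fam := fun m s => \sum_i c i * chi i m s.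
have Psi0 : Gamma Psi = 0.
  rewrite Gamma_sum big1 // => -[[w g] A] _; rewrite Gamma_bell ?mulr0 //.
  rewrite (leq_trans (leq_imset_card _ _)) // (leq_trans (max_card _)) //.
  by rewrite card_ord.
(* By the symmetry [bellC], the values of the combination are dual functionals applied to [bell s],
   which are known for [s] of degree at most [j]. *)
have PsiE m s : Psi m s = (j`!)%:R^-1 * \sum_w psi j w^-1%g * dual w (bell s).
  rewrite /Psi /dual /dform mulr_sumr.
  transitivity (\sum_w \sum_g \sum_A c (w, g, A) * chi (w, g, A) m s).
    by rewrite !pair_bigA; apply: eq_bigr => -[[w g] A] _.
  apply: eq_bigr => w _; rewrite !mulr_sumr; apply: eq_bigr => g _.
  rewrite [in RHS]big_mkcond !mulr_sumr; apply: eq_bigr => A _ /=.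
  rewrite bellC -!mulrA; congr (_ * (_ * (_ * _))).
  by case: ifP => _; rewrite ?mul0r // mulrA.
have Psi_class : class_fam Psi.
  by move=> m s r; apply: eq_bigr => -[[w g] A] _; rewrite /chi bell_class.
have Psi_j : Psi j =1 psi j.
  move=> s; rewrite PsiE; under eq_bigr do rewrite dual_bell1 //.
  exact: sum_class_conj.
have Psi_lt m s : (m < j)%N -> Psi m s = 0.
  move=> lt_mj; rewrite PsiE big1 ?mulr0 // => w _.
  by rewrite dual_bell0 ?mulr0 // lt_mj.
pose rest : fam := fun m s => psi m s - Psi m s.
have rest0 : Gamma rest = 0.
  apply: IHd => [m s r|m le_md s]; first by rewrite /rest psi_class Psi_class.
  have : (m <= j)%N by rewrite leq_subRL // addnC.
  rewrite leq_eqVlt => /predU1P[eq_mj|lt_mj].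
    by move: s; rewrite eq_mj => s; rewrite /rest Psi_j subrr.
  rewrite /rest Psi_lt // psi0 ?subr0 // addnS.
  by move: lt_mj; rewrite /j ltn_subRL addnC.
have := Gamma_sum (I := bool) (fun=> 1) (fun b => if b then Psi else rest).
rewrite big_bool /= Psi0 rest0 mulr0 addr0 => <-.
by apply: Gamma_local => m _ s; rewrite big_bool /= !mul1r /rest addrC subrK.
Qed.

End Families.

(** * Positivity *)

Section Positivity.

Variables (F : numFieldType) (xi : F) (M k t : nat) (sh lam : seq nat).
Hypotheses (xi_prim : M.-primitive_root xi).
Hypothesis M_dvd : forall c, (0 < c <= #|'I_k|)%N -> (c %| M)%N.

(** The character of ['S_k] on the subspace of the tensor power cut out by the Young idempotent of
    [sh], see [pairing_fixcE]. *)
Definition tens_char (u : 'S_k) : F := pairing (yidem F t sh) (fun s => (fixc u s)%:R).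

(** This is the order of [H] times the dimension of its invariants in a tensor product: the dual of
    the module of [tens_char], the line [theta], and the Specht module of [lam] pulled back along
    [pi]. Transposing [E1] accounts for the dual and for [w^-1]. *)
Lemma twisted_sum_ge0 (H : {group 'S_k}) n (theta : 'S_k -> F) (pi : 'S_k -> 'S_n) :
    {in H &, {morph theta : w w' / (w * w')%g >-> w * w'}} ->
    {in H &, {morph pi : w w' / (w * w')%g >-> (w * w')%g}} ->
  0 <= \sum_(w in H) tens_char w^-1%g * theta w * ychar F lam (pi w).
Proof.
move=> thetaM piM.
pose E1 := gop (fun s : 'S_t => tens_mx k (perm_mx s)) (yidem F t sh).
pose E2 := Lft (yidem F n lam).
pose rho w := theta w *: tprod (E1^T *m place_mx F t w)
  (E2 *m regular_repr F [set: 'S_n]%G (pi w)).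
have E1P w : E1 *m place_mx F t w = place_mx F t w *m E1.
  rewrite /E1 /gop mulmx_suml mulmx_sumr; apply: eq_bigr => s _.
  by rewrite -scalemxAl -scalemxAr place_tensC.
have E1E : E1 *m E1 = E1 by rewrite -(gop_conv _ _ (@tens_permM F t k)) yidemK.
have E1TP w : E1^T *m place_mx F t w = place_mx F t w *m E1^T.
  by apply: trmx_inj; rewrite !trmx_mul !trmxK -!place_mxV E1P.
have E2P s : E2 *m regular_repr F [set: 'S_n]%G s = regular_repr F [set: 'S_n]%G s *m E2.
  rewrite /E2 /Lft /gop mulmx_suml mulmx_sumr; apply: eq_bigr => a _.
  by rewrite -scalemxAl -scalemxAr lreg_regC.
have E2E : E2 *m E2 = E2 by rewrite /E2 -Lft_conv yidemK.
have rhoM : {in H &, forall w w', rho w *m rho w' = rho (w * w')%g}.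
  move=> w w' Hw Hw'.
  rewrite /rho -scalemxAl -scalemxAr scalerA -tprodE thetaM // piM //.
  congr (_ *: tprod _ _).
  - by rewrite -mulmxA (mulmxA (place_mx F t w)) -E1TP -mulmxA mulmxA -trmx_mul E1E -place_mxM.
  - rewrite -[LHS]mulmxA (mulmxA (regular_repr _ _ _)) -E2P -(mulmxA E2) (mulmxA E2 E2) E2E.
    by rewrite -regM.
have := trace_mulmorph_ge0 rhoM.
congr (_ <= _); apply: eq_bigr => w _; rewrite /rho mxtraceZ mxtrace_prod.
rewrite mulrA; congr (_ * _); rewrite mulrC; congr (_ * _).
rewrite /tens_char pairing_fixcE place_mxV -/E1 -mxtrace_tr trmx_mul trmxK.
exact: mxtrace_mulC.
Qed.

Section Stabilizer.

Variables (g : 'S_k) (A : {set 'I_k}).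

Lemma admits_group_set : [forall x, (x \in A) ==> (g x == x)] ->
  group_set [set w | admits w g A].
Proof.
move=> gA; apply/group_setP; split.
  rewrite inE /admits gA andbT; apply/andP; split; apply/forallP=> x; rewrite !perm1 //.
move=> w w'; rewrite !inE /admits gA !andbT => /andP[gw wA] /andP[gw' w'A].
apply/andP; split; apply/forallP=> x; rewrite !permM.
  by rewrite (eqP (forallP gw x)) (eqP (forallP gw' _)).
by rewrite (eqP (forallP w'A _)) (eqP (forallP wA x)).
Qed.

Lemma inducedM w w' : admits w g A -> admits w' g A ->
  induced g A (w * w')%g = (induced g A w * induced g A w')%g.
Proof.
case/and3P=> gw wA _ /and3P[gw' w'A _]; apply/esym/induced_uniq.
- apply/forallP=> x; rewrite !permM.
  by rewrite (eqP (forallP gw x)) (eqP (forallP gw' _)).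
- by apply/forallP=> x; rewrite !permM (eqP (forallP w'A _)) (eqP (forallP wA x)).
move=> x; rewrite permM -inducedP // -(inducedP gw wA).
by case: (quo g A x) => //= j; rewrite permM.
Qed.

(** Both signs and [twist] are multiplicative on the stabilizer of [(g, A)], hence so is their
    product. *)
Lemma stabilizer_sum_ge0 :
  0 <= \sum_(w | admits w g A) tens_char w^-1%g *
     ((-1) ^+ odd_perm w * (-1) ^+ odd_perm (induced g A w) * @twist 'I_k F xi M g w)
     * ychar F lam (induced g A w).
Proof.
have [gA|] := boolP [forall x, (x \in A) ==> (g x == x)]; last first.
  by move=> ngA; rewrite big_pred0 // => w; rewrite /admits (negPf ngA) !andbF.
pose H := Group (admits_group_set gA).
pose theta w : F := (-1) ^+ odd_perm w * (-1) ^+ odd_perm (induced g A w)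
  * @twist 'I_k F xi M g w.
have mulE (x x' y y' z z' r q p : F) :
  r = x * x' -> q = y * y' -> p = z * z' -> r * q * p = x * y * z * (x' * y' * z').
  by move=> -> -> ->; rewrite (mulrACA _ z) (mulrACA x).
have sgM m (s s' : 'S_m) : (-1) ^+ odd_perm (s * s')%g = (-1) ^+ odd_perm s * (-1) ^+ odd_perm s' :> F.
  by rewrite odd_permM signr_addb.
have piM : {in H &, {morph induced g A : w w' / (w * w')%g >-> (w * w')%g}}.
  by move=> w w'; rewrite !inE; apply: inducedM.
have thetaM : {in H &, {morph theta : w w' / (w * w')%g >-> w * w'}}.
  move=> w w' Hw Hw'; have indM := piM w w' Hw Hw'.
  have [gw gw'] : commutes g w /\ commutes g w'.
    by move: Hw Hw'; rewrite !inE => /and3P[gw _ _] /and3P[gw' _ _].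
  apply: mulE; first exact: sgM.
    exact: etrans (congr1 (fun v => (-1) ^+ odd_perm v) indM) (sgM _ _ _).
  have twistE := twistM xi_prim M_dvd gw gw'; exact: twistE.
have := twisted_sum_ge0 thetaM piM.
by rewrite (eq_bigl (fun w => admits w g A)) => [|w]; last by rewrite inE.
Qed.

End Stabilizer.
End Positivity.

(** * Comparison of the Schur and dual expansions *)

Section Reciprocity.

Variables (F : numFieldType) (xi : F) (M t : nat) (kap : intpart) (c : intpart -> F).
Let k := psize kap.
Hypotheses (xi_prim : M.-primitive_root xi).
Hypothesis M_dvd : forall d, (0 < d <= k)%N -> (d %| M)%N.
Hypothesis le_kt : (k + k <= t)%N.
Hypothesis cE : forall s : 'S_t,
  \sum_(lam <- intparts k) c lam * \tr (res_schur F t lam s) = ychar F (pad t kap) s.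

Definition schur_form (phi : fam F) : F :=
  \sum_(lam <- intparts k) c lam * pairing (yidem F (psize lam) lam) (@phi (psize lam)).

Definition dual_form (phi : fam F) : F :=
  (k`!)%:R^-1 * \sum_(w : 'S_k) tens_char F t (pad t kap) w^-1%g * dual xi M w phi.

(** [sum_ychar] turns the pairing with the idempotent into an average against the character of
    [pad t kap], into which [cE] is substituted. *)
Lemma schur_form_bell n (u : 'S_n) :
  schur_form (bell F t u) = tens_char F t (pad t kap) u.
Proof.
have t0 : (t`!)%:R != 0 :> F by rewrite pnatr_eq0 -lt0n fact_gt0.
apply: (mulfI t0); rewrite /tens_char -sum_ychar => [|s r]; last by rewrite fixcJr.
under [RHS]eq_bigr do rewrite -cE mulr_suml.
rewrite exchange_big mulr_sumr; apply: eq_bigr => lam _.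
rewrite mulrCA; under [RHS]eq_bigr do rewrite -mulrA.
rewrite -mulr_sumr; congr (_ * _); rewrite /pairing /bell.
rewrite mulr_sumr; under [RHS]eq_bigr do rewrite trace_res_schur /pairing mulr_suml.
rewrite exchange_big; apply: eq_bigr => s _ /=.
rewrite mulrCA mulVKf // mulr_sumr; apply: eq_bigr => v _.
by rewrite -mulrA; congr (_ * _); apply: mulrC.
Qed.

(** Below degree [k] both sides vanish, the right one by [pairing_fixc_pad0]; in degree [k] the dual
    functionals reproduce the class function. *)
Lemma dual_form_bell n (u : 'S_n) : (n <= k)%N ->
  dual_form (bell F t u) = tens_char F t (pad t kap) u.
Proof.
rewrite leq_eqVlt => /predU1P[eq_nk|lt_nk]; last first.
  rewrite /dual_form big1 ?mulr0 => [|w _].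
    rewrite /tens_char pairing_fixc_pad0 // /admissible (leq_trans _ le_kt) //.
    rewrite leq_add2r /k /psize; case: (parts kap) => //= i s.
    exact: leq_addr.
  by rewrite (dual_bell0 xi_prim M_dvd le_kt) ?lt_nk ?leqnn ?mulr0.
move: u; rewrite eq_nk => u; rewrite /dual_form.
under eq_bigr do rewrite (dual_bell1 xi_prim M_dvd le_kt) //.
by apply: sum_class_conj => s r; apply: eq_bigr => v _; rewrite fixcJ.
Qed.

Lemma schur_formE (phi : fam F) : class_fam phi -> schur_form phi = dual_form phi.
Proof.
move=> phi_class; apply/eqP; rewrite -subr_eq0; apply/eqP.
apply: (Gamma_class_eq0 xi_prim M_dvd le_kt
  (Gamma := fun phi => schur_form phi - dual_form phi)) phi_class.
- move=> I d psi; under [RHS]eq_bigr do rewrite mulrBr.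
  rewrite [RHS]sumrB; congr (_ - _).
    rewrite /schur_form; under [RHS]eq_bigr do rewrite mulr_sumr.
    rewrite [RHS]exchange_big; apply: eq_bigr => lam _ /=.
    under [RHS]eq_bigr do rewrite mulrCA; rewrite -mulr_sumr; congr (_ * _).
    rewrite /pairing; under [RHS]eq_bigr do rewrite mulr_sumr.
    rewrite exchange_big; apply: eq_bigr => s _ /=.
    by rewrite mulr_sumr; apply: eq_bigr => i _; rewrite mulrCA.
  rewrite /dual_form; under [RHS]eq_bigr do rewrite mulrCA; rewrite -mulr_sumr; congr (_ * _).
  under [RHS]eq_bigr do rewrite mulr_sumr.
  rewrite exchange_big; apply: eq_bigr => w _ /=.
  under [RHS]eq_bigr do rewrite mulrCA; rewrite -mulr_sumr; congr (_ * _).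
  rewrite /dual; under [RHS]eq_bigr do rewrite mulrCA; rewrite -mulr_sumr; congr (_ * _).
  rewrite /dform; under [RHS]eq_bigr do rewrite mulr_sumr.
  rewrite exchange_big; apply: eq_bigr => g _ /=.
  under [RHS]eq_bigr do rewrite mulr_sumr.
  rewrite exchange_big; apply: eq_bigr => A _ /=.
  by rewrite mulr_sumr; apply: eq_bigr => i _; rewrite mulrCA.
- move=> psi psi' eq_psi; congr (_ - _).
    rewrite /schur_form !big_seq; apply: eq_bigr => lam; rewrite mem_intparts => le_lam.
    by congr (_ * _); apply: eq_bigr => s _; rewrite eq_psi.
  congr (_ * _); apply: eq_bigr => w _; congr (_ * (_ * _)).
  apply: eq_bigr => g _; apply: eq_bigr => A _; congr (_ * _); apply: eq_psi.
  by rewrite (leq_trans (leq_imset_card _ _)) // (leq_trans (max_card _)) // card_ord.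
by move=> n u le_nk; rewrite schur_form_bell dual_form_bell // subrr.
Qed.

Variable lam : intpart.
Hypothesis le_lam : (psize lam <= k)%N.

(** Its support in one degree, with the vanishing of pairings between different shapes of that size,
    isolates [c lam]. *)
Definition irr_fam : fam F := fun m s => if m == psize lam then ychar F lam s else 0.

Lemma schur_form_irr : schur_form irr_fam
  = c lam * pairing (yidem F (psize lam) lam) (@ychar F (psize lam) lam).
Proof.
have lam_in : lam \in intparts k by rewrite mem_intparts.
rewrite /schur_form (bigD1_seq lam) ?intparts_uniq //= [X in _ + X]big1 ?addr0.
  by congr (_ * _); apply: eq_bigr => s _; rewrite /irr_fam eqxx.
move=> mu neq; rewrite /pairing /irr_fam; case: eqP => [eq_sz|_]; last first.
  by rewrite big1 ?mulr0 // => s _; rewrite mulr0.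
have := pairing_ychar_part_neq F eq_sz neq; rewrite pairing_ycharC /pairing => ->.
by rewrite mulr0.
Qed.

(** In degree [m], the parity of the number of cycles is the sign of the permutation times
    [(-1) ^+ m]. Applied to [w] and to the induced permutation, of degree [psize lam] in nonzero
    terms, this yields precisely the global sign. *)
Lemma dual_form_irr_ge0 : 0 <= (-1) ^+ (k + psize lam) * dual_form irr_fam.
Proof.
have M_dvd' d : (0 < d <= #|'I_k|)%N -> (d %| M)%N by rewrite card_ord; apply: M_dvd.
have signE m (s : 'S_m) : (-1) ^+ #|porbits s| = (-1) ^+ m * (-1) ^+ odd_perm s :> F.
  rewrite -[LHS]signr_odd -[X in X * _]signr_odd -signr_addb; congr (_ ^+ (_ : bool)).
  by rewrite /odd_perm card_ord addbA addbb.
have irrE m (s : 'S_m) : m = psize lam -> irr_fam s = ychar F lam s.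
  by move=> /eqP eq_m; rewrite /irr_fam eq_m.
have irr0 m (s : 'S_m) : m != psize lam -> irr_fam s = 0.
  by move=> /negPf neq; rewrite /irr_fam neq.
have mulE (x y z p q r v p' q' v' : F) : x * x = 1 -> y * y = 1 ->
    p' = x * p -> q' = y * q -> v' = v ->
    x * y * (z * (p' * (q' * r * v'))) = z * (p * q * r) * v.
  move=> xx yy -> -> ->.
  by transitivity ((x * x) * (y * y) * (z * (p * q * r) * v)); [ring | rewrite xx yy !mul1r].
have sqr_sign m : (-1) ^+ m * (-1) ^+ m = 1 :> F by rewrite -exprD addnn -signr_odd odd_double.
have -> : (-1) ^+ (k + psize lam) * dual_form irr_fam = (k`!)%:R^-1 *
   \sum_g \sum_(A : {set 'I_k}) \sum_(w | admits w g A) (-1) ^+ k * (-1) ^+ psize lam *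
     (tens_char F t (pad t kap) w^-1%g * ((-1) ^+ #|porbits w| *
        ((-1) ^+ #|porbits (induced g A w)| * @twist _ F xi M g w
          * irr_fam (induced g A w)))).
  rewrite /dual_form mulrCA exprD; congr (_ * _).
  rewrite mulr_sumr; under eq_bigr do rewrite /dual /dform !mulr_sumr.
  rewrite exchange_big; apply: eq_bigr => g _ /=.
  under eq_bigr do rewrite !mulr_sumr.
  by rewrite (exchange_big_dep predT).
rewrite mulr_ge0 ?invr_ge0 ?ler0n // sumr_ge0 // => g _; rewrite sumr_ge0 // => A _.
have [eq_m|neq] := eqVneq (ncyc g A) (psize lam); last first.
  by rewrite big1 // => w _; rewrite irr0 // !mulr0.
rewrite (eq_bigr (fun w => tens_char F t (pad t kap) w^-1%g *
     ((-1) ^+ odd_perm w * (-1) ^+ odd_perm (induced g A w) * @twist 'I_k F xi M g w)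
     * ychar F lam (induced g A w))) => [|w _]; last first.
  apply: mulE; [exact: sqr_sign | exact: sqr_sign | exact: signE | | exact: irrE].
  exact: etrans (signE _ _) (congr1 (fun m => (-1) ^+ m * _) eq_m).
exact: stabilizer_sum_ge0 xi_prim M_dvd' g A.
Qed.

Lemma coef_ge0 : 0 <= (-1) ^+ (k + psize lam) * c lam.
Proof.
have := dual_form_irr_ge0; rewrite -schur_formE; last first.
  by move=> m s r; rewrite /irr_fam ycharJ.
by rewrite schur_form_irr mulrA pmulr_lge0 // pairing_ychar_gt0.
Qed.

End Reciprocity.

Lemma prim_root_exists (F : numClosedFieldType) n : (0 < n)%N ->
  exists z : F, n.-primitive_root z.
Proof.
pose p : {poly F} := 'X^n - 1; have [r Dp] := closed_field_poly_normal p.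
move=> n_gt0; rewrite (monicP _) ?monicXnsubC // scale1r in Dp.
have rn1 : all n.-unity_root r by apply/allP=> z; rewrite -root_prod_XsubC -Dp.
have sz_r : (n < (size r).+1)%N.
  by rewrite -(size_prod_XsubC r id) -Dp size_XnsubC.
have [|z] := hasP (has_prim_root n_gt0 rn1 _ sz_r); last by exists z.
by rewrite -separable_prod_XsubC -Dp separable_Xn_sub_1 // pnatr_eq0 -lt0n.
Qed.

Theorem inverse_coefs_sign (F : numClosedFieldType)
    (at_ : nat -> intpart -> intpart -> nat)
    (a : intpart -> intpart -> nat) (b : intpart -> intpart -> int) :
    restriction_coefs F at_ -> stable_limit at_ a -> inverse_coefs a b ->
  forall lam nu : intpart,
  0 <= (-1) ^ ((psize lam)%:Z - (psize nu)%:Z) * b lam nu.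
Proof.
move=> at_def a_def b_def lam nu; have [b0 _] := b_def.
have [lt_nu|le_lam] := ltnP (psize nu) (psize lam); first by rewrite b0 ?mulr0.
have [T stableT] := stable_inverse at_def a_def b_def nu.
pose t := maxn T (psize nu + psize nu).
(* The order of [xi] is a factorial, so that every cycle length up to [psize nu] divides it. *)
have [xi xi_prim] := prim_root_exists F (fact_gt0 (psize nu)).
have M_dvd d : (0 < d <= psize nu)%N -> (d %| (psize nu)`!)%N by exact: dvdn_fact.
have := coef_ge0 xi_prim M_dvd (leq_maxr T _) (stableT t (leq_maxl _ _)) le_lam.
have <- : ((-1) ^ ((psize lam)%:Z - (psize nu)%:Z))%:~R = (-1) ^+ (psize nu + psize lam) :> F.
  rewrite exprzDr ?unitrN1 // -exprnN -exprVn invrN1 exprD.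
  by rewrite rmorphM !rmorphXn rmorphN1 mulrC.
by rewrite -rmorphM ler0z.
Qed.

Theorem theorem1 (R : realType)
    (at_ : nat -> intpart -> intpart -> nat)
    (a : intpart -> intpart -> nat) (b : intpart -> intpart -> int)
    (at_def : restriction_coefs R[i] at_)
    (a_def : stable_limit at_ a)
    (b_def : inverse_coefs a b)
    (lam nu : intpart) :
  0 <= (-1) ^ ((psize lam)%:Z - (psize nu)%:Z) * b lam nu.
Proof.
exact: inverse_coefs_sign at_def a_def b_def lam nu.
Qed.
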